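(* Let $\Theta:\mathcal{S}(\mathbb{R}^d)\to\mathcal{S}(\mathbb{R}^d)$ be a multiplier with real-valued symbol $m\in C^\infty(\mathbb{R}^d)$, and let $1\le p\le\infty$. Let $\{f_k\}_{k\in\mathbb{Z}}$ be a doubly infinite sequence of functions on $\mathbb{R}^d$ such that, for all $k\in\mathbb{Z}$, $\Theta f_k=Af_{k+1}$ for a non-zero constant $A\in\mathbb{C}$ and $\|f_k\|_{p}\le M$ for a constant $M>0$ (with $A,M$ independent of $k$). Let $m(\mathbb{R}^d)=\{m(\xi):\xi\in\mathbb{R}^d\}$. Then: (a) If $|A|\in m(\mathbb{R}^d)$ but $-|A|\notin m(\mathbb{R}^d)$, then $\Theta f_0=|A|f_0$. (b) If $-|A|\in m(\mathbb{R}^d)$ but $|A|\notin m(\mathbb{R}^d)$, then $\Theta f_0=-|A|f_0$. (c) If both $|A|$ and $-|A|$ belong to $m(\mathbb{R}^d)$, then $f_0$ can be uniquely written as $f_0=f_++f_-$, where $f_+,f_-\in L^p(\mathbb{R}^d)$ satisfy $\Theta f_+=|A|f_+$ and $\Theta f_-=-|A|f_-$. (d) If neither $|A|$ nor $-|A|$ belongs to $m(\mathbb{R}^d)$, then $f_0=0$.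
   Context: $\mathcal{S}(\mathbb{R}^d)$ is the Schwartz space and $\mathcal{S}(\mathbb{R}^d)'$ the space of tempered distributions. The Fourier transform is $\hat f(\xi)=\int_{\mathbb{R}^d}f(x)e^{-ix\cdot\xi}\,dx$. A multiplier on $\mathcal{S}(\mathbb{R}^d)$ with symbol $m\in C^\infty(\mathbb{R}^d)$ is a continuous linear operator $\Theta:\mathcal{S}(\mathbb{R}^d)\to\mathcal{S}(\mathbb{R}^d)$ with $\widehat{\Theta f}(\xi)=m(\xi)\hat f(\xi)$ for all $f\in\mathcal{S}(\mathbb{R}^d)$, $\xi\in\mathbb{R}^d$. It extends to $T\in\mathcal{S}(\mathbb{R}^d)'$ by $\langle\Theta T,f\rangle=\langle T,\Theta^*f\rangle$ for $f\in\mathcal{S}(\mathbb{R}^d)$, where $\Theta^*$ is the multiplier with symbol $m(-\xi)$. Functions in $L^p(\mathbb{R}^d)$ are regarded as tempered distributions, and $\Theta f$ for $f\in L^p$ is understood in this sense. *)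

(* Defs.v *)
From HB Require Import structures.
From mathcomp Require Import all_boot all_order all_algebra complex.
From mathcomp Require Import all_classical all_reals all_analysis.

Set Implicit Arguments.
Unset Strict Implicit.
Unset Printing Implicit Defensive.

Import Order.TTheory GRing.Theory Num.Theory.
Import numFieldNormedType.Exports.

Local Open Scope classical_set_scope.
Local Open Scope ring_scope.
Local Open Scope complex_scope.

Definition rV_display : measure_display -> measure_display.
Proof. exact. Qed.

(* The product sigma-algebra on row vectors, generated by the coordinates, as
   the library does for tuples; over [R] it is the Borel sigma-algebra of
   [R^n]. *)
Section measurable_rV.
Context {d} {T : sigmaRingType d} (n : nat).

Let coors (i : 'I_n) (x : 'rV[T]_n) : T := x ord0 i.

Let rV_set0 : g_sigma_preimage coors set0.
Proof. exact: sigma_algebra0. Qed.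

Let rV_setC A : g_sigma_preimage coors A -> g_sigma_preimage coors (~` A).
Proof. exact: sigma_algebraC. Qed.

Let rV_bigcup (F : (set 'rV[T]_n)^nat) :
  (forall i, g_sigma_preimage coors (F i)) ->
  g_sigma_preimage coors (\bigcup_i (F i)).
Proof. exact: sigma_algebra_bigcup. Qed.

HB.instance Definition _ := @isMeasurable.Build (rV_display d)
  'rV[T]_n (g_sigma_preimage coors) rV_set0 rV_setC rV_bigcup.

Lemma measurable_coord (i : 'I_n) :
  measurable_fun [set: 'rV[T]_n] (fun x : 'rV[T]_n => x ord0 i).
Proof.
move=> _ Y mY; rewrite setTI; apply: sub_sigma_algebra => /=.
rewrite -bigcup_seq/=; exists i => /=; first by rewrite mem_index_enum.
by exists Y => //; rewrite setTI.
Qed.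
End measurable_rV.

Lemma measurable_fun_rVP d1 d2 (T1 : measurableType d1) (T2 : measurableType d2)
    (n : nat) (f : T1 -> 'rV[T2]_n) :
  (forall i, measurable_fun [set: T1] (fun x => f x ord0 i)) ->
  measurable_fun [set: T1] f.
Proof.
move=> mf _; rewrite /measurable /=.
suff : g_sigma_preimage (fun i => (fun x : 'rV[T2]_n => x ord0 i) \o f)
    `<=` measurable.
  by rewrite g_sigma_preimage_comp => + A mA; apply; exists A.
apply: smallest_sub; first exact: sigma_algebra_measurable.
case: n => [|n] in f mf *; first by rewrite big_ord0.
rewrite -bigcup_mkord_ord; apply: bigcup_sub => i Ii.
by move=> A [B mB <-]; exact: mf.
Qed.

Section lebesgue_measure_cons.
Context (R : realType) (n : nat).
Variable mu : {sigma_finite_measure set 'rV[R]_n -> \bar R}.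

Definition rV_cons (xy : measurableTypeR R * 'rV[R]_n) : 'rV[R]_n.+1 :=
  row_mx (const_mx xy.1 : 'rV[R]_1) xy.2.

Let rV_uncons (x : 'rV[R]_n.+1) : measurableTypeR R * 'rV[R]_n :=
  (x ord0 ord0, @rsubmx R 1 1 n x).

Let rV_consK : cancel rV_cons rV_uncons.
Proof.
move=> [x y]; congr pair; last exact: row_mxKr.
have -> : ord0 = lshift n ord0 :> 'I_(1 + n) by apply/val_inj.
by rewrite [LHS]row_mxEl mxE.
Qed.

Lemma measurable_rV_cons : measurable_fun [set: measurableTypeR R * 'rV[R]_n] rV_cons.
Proof.
apply: measurable_fun_rVP => i.
case: (splitP (i : 'I_(1 + n))) => [j|j] ij.
- have -> : i = lshift n j by apply/val_inj.
  rewrite (_ : (fun _ => _) = fst); first exact: measurable_fst.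
  by apply/funext => xy; rewrite [LHS]row_mxEl mxE.
- have -> : i = rshift 1 j by apply/val_inj.
  rewrite (_ : (fun _ => _) = (fun x : 'rV[R]_n => x ord0 j) \o snd).
    by apply: (measurableT_comp (measurable_coord j)); exact: measurable_snd.
  by apply/funext => xy; rewrite [LHS]row_mxEr.
Qed.

Let measurable_rV_uncons : measurable_fun [set: 'rV[R]_n.+1] rV_uncons.
Proof.
apply/measurable_fun_pairP; split; first exact: measurable_coord.
apply: measurable_fun_rVP => i.
rewrite (_ : (fun _ => _) = fun x : 'rV[R]_n.+1 => x ord0 (rshift 1 i)).
  exact: measurable_coord.
by apply/funext => x; rewrite /= mxE.
Qed.

Definition lebesgue_cons : set 'rV[R]_n.+1 -> \bar R :=
  pushforward (@lebesgue_measure R \x mu)%E rV_cons.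

Let lebesgue_cons0 : lebesgue_cons set0 = 0%E.
Proof. by rewrite /lebesgue_cons /pushforward preimage_set0 measure0. Qed.

Let lebesgue_cons_ge0 A : (0 <= lebesgue_cons A)%E.
Proof.
exact: (@measure_ge0 _ _ _ (lebesgue_measure \x mu)%E). Qed.

Let lebesgue_cons_sigma_additive : semi_sigma_additive lebesgue_cons.
Proof.
apply: (@measure_semi_sigma_additive _ _ _
  (pushforward (@lebesgue_measure R \x mu)%E rV_cons)).
exact: measurable_rV_cons.
Qed.

HB.instance Definition _ := isMeasure.Build _ _ _ lebesgue_cons
  lebesgue_cons0 lebesgue_cons_ge0 lebesgue_cons_sigma_additive.

Let lebesgue_cons_sigma_finite : sigma_finite setT lebesgue_cons.
Proof.
have /sigma_finiteP[F [FT ndF mF]] := sigma_finiteT (@lebesgue_measure R).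
have /sigma_finiteP[G [GT ndG mG]] := sigma_finiteT mu.
exists (fun k => rV_uncons @^-1` (F k `*` G k)).
  rewrite -preimage_bigcup; apply/esym; rewrite -subTset => x _.
  have [k _ Fk] : (\bigcup_k F k) (rV_uncons x).1 by rewrite -FT.
  have [l _ Gl] : (\bigcup_k G k) (rV_uncons x).2 by rewrite -GT.
  exists (maxn k l) => //; split.
  - by move: Fk; apply/subsetPset/ndF; exact: leq_maxl.
  - by move: Gl; apply/subsetPset/ndG; exact: leq_maxr.
move=> k; have [mFk Fk] := mF k; have [mGk Gk] := mG k; split.
  rewrite -[X in measurable X]setTI; apply: measurable_rV_uncons => //.
  exact: measurableX.
rewrite /lebesgue_cons /pushforward -comp_preimage.
rewrite (_ : rV_uncons \o rV_cons = id); last first.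
  by apply/funext => x; exact: rV_consK.
by rewrite preimage_id product_measure1E// lte_mul_pinfty// ge0_fin_numE.
Qed.

HB.instance Definition _ :=
  @Measure_isSigmaFinite.Build _ _ _ lebesgue_cons lebesgue_cons_sigma_finite.

End lebesgue_measure_cons.

Fixpoint lebesgue_rV (R : realType) (n : nat) :
    {sigma_finite_measure set 'rV[R]_n -> \bar R} :=
  match n with
  | 0 => \d_(0 : 'rV[R]_0)
  | n'.+1 => lebesgue_cons (lebesgue_rV R n')
  end.

Lemma lebesgue_rV_box (R : realType) (n : nat) (A : 'I_n -> set R) :
  (forall i, measurable (A i)) ->
  measurable [set x : 'rV[R]_n | forall i, A i (x ord0 i)] /\
  lebesgue_rV R n [set x | forall i, A i (x ord0 i)] =
  (\prod_i lebesgue_measure (A i))%E.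
Proof.
have mbox k (B : 'I_k -> set R) : (forall i, measurable (B i)) ->
    measurable [set x : 'rV[R]_k | forall i, B i (x ord0 i)].
  move=> mB.
  rewrite (_ : mkset _ =
    \big[setI/setT]_(i < k) ((fun x : 'rV[R]_k => x ord0 i) @^-1` B i)).
    apply: bigsetI_measurable => i _; rewrite -[X in measurable X]setTI.
    exact: measurable_coord.
  rewrite -bigcap_seq; apply/seteqP; split => x /= Bx i; first by move=> _; exact: Bx.
  by apply: (Bx i); rewrite /= mem_index_enum.
move=> mA; split; first exact: mbox.
elim: n A mA => [A _|n ih A mA] /=.
  by rewrite big_ord0 diracE mem_set//= => -[].
rewrite big_ord_recl -(ih (fun i => A (lift ord0 i)))//.
rewrite -product_measure1E; last 2 first.
- exact: mA.
- exact: (mbox n (fun i => A (lift ord0 i)) (fun i => mA _)).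
rewrite /lebesgue_cons /pushforward; congr (product_measure1 _ _ _).
apply/seteqP; split => [xy /= Axy|xy /= [Ax Ay] i].
- split=> [|i].
    move: (Axy ord0); rewrite /rV_cons.
    have -> : ord0 = lshift n ord0 :> 'I_(1 + n) by apply/val_inj.
    by rewrite [X in A _ X](row_mxEl _ _ _ _) mxE.
  move: (Axy (lift ord0 i)); have -> : lift ord0 i = rshift 1 i by apply/val_inj.
  by rewrite [X in A _ X](row_mxEr _ _ _ _).
- case: (splitP (i : 'I_(1 + n))) => [j|j] ij.
    have E : i = lshift n j by apply/val_inj.
    rewrite E [X in A _ X](row_mxEl _ _ _ _) mxE.
    by have -> : lshift n j = ord0 by apply/val_inj => /=; rewrite ord1.
  have -> : i = lift ord0 j by apply/val_inj.
  move: (Ay j); have -> : lift ord0 j = rshift 1 j by apply/val_inj.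
  by rewrite [X in _ -> A _ X](row_mxEr _ _ _ _).
Qed.

Section smooth.
Context (R : realType) (d : nat).
Implicit Types (g h : 'rV[R]_d -> R) (s : seq 'I_d).

Definition partial (i : 'I_d) g : 'rV[R]_d -> R :=
  fun x => 'D_(delta_mx ord0 i) g x.

(* A word [s = [:: i_1; ...; i_k]] stands for the iterated partial derivative
   of [g] along [i_k], then ..., then [i_1]; words play the role of
   multi-indices throughout. *)
Definition iter_partial s g : 'rV[R]_d -> R := foldr partial g s.

Definition smooth g := forall s, continuous (iter_partial s g) /\
  forall i x, derivable (iter_partial s g) x (delta_mx ord0 i).

Lemma iter_partial_lin (a b : R) g h s : smooth g -> smooth h ->
  iter_partial s (fun x => a * g x + b * h x) =
  (fun x => a * iter_partial s g x + b * iter_partial s h x).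
Proof.
move=> sg sh; elim: s => //= i s ->; apply/funext => x; rewrite /partial.
have [_ /(_ i x) dg] := sg s; have [_ /(_ i x) dh] := sh s.
rewrite (_ : (fun _ => _) =
  (a \*: iter_partial s g) + (b \*: iter_partial s h))//.
by rewrite deriveD ?deriveZ//; exact: derivableZ.
Qed.

Lemma smooth_lin (a b : R) g h : smooth g -> smooth h ->
  smooth (fun x => a * g x + b * h x).
Proof.
move=> sg sh s; rewrite iter_partial_lin//.
have [cg dg] := sg s; have [ch dh] := sh s; split=> [|i] x.
  rewrite (_ : (fun _ => _) =
    (cst a \* iter_partial s g) + (cst b \* iter_partial s h))//.
  by apply: continuousD; apply: continuousM => //;
    try exact: cst_continuous; [exact: cg|exact: ch].
rewrite (_ : (fun _ => _) =
  (a \*: iter_partial s g) + (b \*: iter_partial s h))//.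
by apply: derivableD; exact: derivableZ.
Qed.

Lemma iter_partial_cst0 s : iter_partial s (fun=> 0) = (fun=> 0).
Proof.
by elim: s => //= i s ->; apply/funext => x; exact: derive_cst.
Qed.

Lemma smooth_cst0 : smooth (fun=> 0).
Proof.
move=> s; rewrite iter_partial_cst0; split; first exact: cst_continuous.
by move=> i x; exact: derivable_cst.
Qed.

End smooth.

Section schwartz.
Context (R : realType) (d : nat).
Local Notation Re := (@complex.Re R).
Local Notation Im := (@complex.Im R).
Implicit Types (f g : 'rV[R]_d -> R[i]) (s t : seq 'I_d).

Definition csmooth f := smooth (Re \o f) /\ smooth (Im \o f).

Definition citer_partial s f : 'rV[R]_d -> R[i] := fun x =>
  iter_partial s (Re \o f) x +i* iter_partial s (Im \o f) x.

Definition monomial t (x : 'rV[R]_d) : R := \prod_(i <- t) x ord0 i.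

(* [x |-> x^t (d^s f)(x)] *)
Definition weighted_partial (ts : seq 'I_d * seq 'I_d) f : 'rV[R]_d -> R[i] :=
  fun x => (monomial ts.1 x)%:C * citer_partial ts.2 f x.

Definition is_schwartz f := csmooth f /\
  forall ts, exists C : R[i], forall x, `|weighted_partial ts f x| <= C.

Definition schwartz_pred : {pred 'rV[R]_d -> R[i]} :=
  [pred f | `[< is_schwartz f >]].

Let Re_lin (a : R[i]) f g : Re \o (a *: f + g) =
  fun x => 1 * (Re a * (Re \o f) x + - Im a * (Im \o f) x) + 1 * (Re \o g) x.
Proof.
apply/funext => x /=; rewrite !mul1r mulNr.
by rewrite /GRing.add /GRing.scale /=; case: a (f x) (g x) => [? ?] [? ?] [? ?].
Qed.

Let Im_lin (a : R[i]) f g : Im \o (a *: f + g) =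
  fun x => 1 * (Re a * (Im \o f) x + Im a * (Re \o f) x) + 1 * (Im \o g) x.
Proof.
apply/funext => x /=; rewrite !mul1r.
by rewrite /GRing.add /GRing.scale /=; case: a (f x) (g x) => [? ?] [? ?] [? ?].
Qed.

Lemma csmooth_lin (a : R[i]) f g : csmooth f -> csmooth g ->
  csmooth (a *: f + g).
Proof.
move=> [Rf If] [Rg Ig]; rewrite /csmooth Re_lin Im_lin.
by split; apply: smooth_lin => //; exact: smooth_lin.
Qed.

Lemma citer_partial_lin s (a : R[i]) f g : csmooth f -> csmooth g ->
  citer_partial s (a *: f + g) =
  a *: citer_partial s f + citer_partial s g.
Proof.
move=> [Rf If] [Rg Ig]; apply/funext => x.
rewrite /citer_partial Re_lin Im_lin !iter_partial_lin//; try exact: smooth_lin.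
rewrite !mul1r mulNr.
by case: a.
Qed.

Lemma schwartz_submod_closed : submod_closed schwartz_pred.
Proof.
split=> [|a f g].
  apply/asboolP; split; first by split; exact: smooth_cst0.
  move=> [t s]; exists 0 => x; rewrite /weighted_partial /citer_partial.
  rewrite [Re \o _](_ : _ = fun=> 0)// [Im \o _](_ : _ = fun=> 0)//.
  by rewrite iter_partial_cst0 mulr0 normr0.
move=> /asboolP[sf bf] /asboolP[sg bg]; apply/asboolP.
split; first exact: csmooth_lin.
move=> ts; have [C fC] := bf ts; have [D gD] := bg ts.
exists (`|a| * C + D) => x; rewrite /weighted_partial citer_partial_lin//.
rewrite [(_ + _) x](_ : _ = a * citer_partial ts.2 f x + citer_partial ts.2 g x)//.
rewrite mulrDr mulrCA (le_trans (ler_normD _ _))// lerD//; last exact: gD.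
by rewrite normrM ler_wpM2l//; exact: fC.
Qed.

HB.instance Definition _ := GRing.isSubmodClosed.Build R[i] ('rV[R]_d -> R[i])
  schwartz_pred schwartz_submod_closed.

Record schwartz := Schwartz {
  schwartz_fun :> 'rV[R]_d -> R[i];
  schwartz_funP : schwartz_fun \in schwartz_pred }.

HB.instance Definition _ := [isSub for schwartz_fun].
HB.instance Definition _ := [Choice of schwartz by <:].
HB.instance Definition _ := [SubChoice_isSubLmodule of schwartz by <:].

Definition schwartz_jet (f : schwartz) :
    prod_topology (fun _ : seq 'I_d * seq 'I_d =>
      {uniform 'rV[R]_d -> R[i]^o}) :=
  fun ts => weighted_partial ts f.

(* The initial topology for this map is the one generated by the seminorms
   [f |-> sup_x |x^t (d^s f)(x)|]. *)
HB.instance Definition _ :=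
  Topological.copy schwartz (initial_topology schwartz_jet).

End schwartz.

Section fourier.
Context (R : realType) (d : nat).
Local Notation Re := (@complex.Re R).
Local Notation Im := (@complex.Im R).
Local Notation mu := (lebesgue_rV R d).
Implicit Types f g : 'rV[R]_d -> R[i].

Definition cintegral f : R[i] :=
  (\int[mu]_x Re (f x))%R +i* (\int[mu]_x Im (f x))%R.

Definition dotp (x y : 'rV[R]_d) : R := \sum_i x ord0 i * y ord0 i.

Definition expi (t : R) : R[i] := cos t +i* sin t.

Definition fourier f : 'rV[R]_d -> R[i] :=
  fun xi => cintegral (fun x => f x * expi (- dotp x xi)).

Definition cmeasurable f :=
  measurable_fun [set: 'rV[R]_d] (Re \o f) /\
  measurable_fun [set: 'rV[R]_d] (Im \o f).

Definition cLnorm (p : \bar R) f : \bar R :=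
  'N[mu]_p[EFin \o @Normc.normc R \o f]%E.

(* Functions are representatives of their classes modulo [aeeq]. *)
Definition in_Lp (p : \bar R) f := cmeasurable f /\ (cLnorm p f < +oo)%E.

Definition aeeq f g := f = g %[ae mu].

End fourier.

Section multiplier.
Context (R : realType) (d : nat).
Local Notation S := (schwartz R d).
Implicit Types (m : 'rV[R]_d -> R[i]) (Theta : S -> S).

Definition is_multiplier m Theta :=
  [/\ csmooth m, linear Theta, continuous Theta &
    forall (f : S) xi, fourier (Theta f) xi = m xi * fourier f xi].

(* The multiplier [Theta^*] with symbol [xi |-> m (- xi)]; it exists and is
   unique as soon as [Theta] is a multiplier with symbol [m], and [Theta] is
   only a default value. *)
Definition multiplier_adj m Theta : S -> S :=
  xget Theta [set Theta' | is_multiplier (fun xi => m (- xi)) Theta'].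

(* The extension of [Theta] by duality, given on arbitrary functionals on [S];
   it maps tempered distributions to tempered distributions. *)
Definition multiplier_ext m Theta (T : S -> R[i]) : S -> R[i] :=
  fun phi => T (multiplier_adj m Theta phi).

Definition regular_distribution (f : 'rV[R]_d -> R[i]) : S -> R[i] :=
  fun phi => cintegral (fun x => f x * phi x).

(* [Theta f = g] as distributions. *)
Definition multiplier_eq m Theta (f g : 'rV[R]_d -> R[i]) :=
  multiplier_ext m Theta (regular_distribution f) = regular_distribution g.

Definition eigen_decomposition m Theta (p : \bar R) (a : R[i])
    (f fp fm : 'rV[R]_d -> R[i]) :=
  [/\ in_Lp p fp, in_Lp p fm, aeeq f (fp + fm),
      multiplier_eq m Theta fp (a *: fp) &
      multiplier_eq m Theta fm (- a *: fm)].

End multiplier.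

(* Main.v *)
(* Testing against inverse transforms of smooth compactly supported functions [chi] turns
   the hypothesis into [T_k(u chi) = w T_(k+1)(chi)], where [u(xi) = m(-xi)/|A|], [|w| = 1] and
   [|T_k(chi)|] is bounded, uniformly in [k], by a Sobolev-type norm of [chi] with at most
   [2d] derivatives.  With [h_n = u^n/(1 + u^(2n))], the splitting
   [1 = u^(2n)/(1 + u^(2n)) + 1/(1 + u^(2n))] gives
   [|T_k(g)| <= |T_(k+n)(h_n g)| + |T_(k-n)(h_n g)|].  The functions [h_n] concentrate on
   [u^2 = 1] at scale [1/n] and each derivative costs a factor [n], so the right-hand side
   tends to [0] when [g] is a multiple of high powers of [u^2 - 1] and [u]; a factor [u^r] only
   shifts [k], so [T_k((u^2 - 1)^N chi) = 0].
   If [N >= 2], then [n |-> T_k(u^(2n) (u^2 - 1)^(N-2) chi)] is bounded with zero second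
   difference, hence constant, which lowers [N] down to [1].

   So [T_k = w^2 T_(k+2)]; if [m] omits the value [-s|A|] with [s = 1] or [s = -1], dividing by
   [u + s] gives [T_k = s w T_(k+1)].  The [T_k] determine [f_k] almost everywhere: for a bump
   [chi] near [0], [T_k] of its translates is the Fourier transform of the integrable function
   [f_k chi^], and [chi^] does not vanish on a large cube. *)

Require Import Defs.
From mathcomp Require Import all_boot all_order all_algebra complex.
From mathcomp Require Import all_classical all_reals all_analysis.
From mathcomp Require Import measurable_realfun ring lra.

Import Order.TTheory GRing.Theory Num.Theory.
Import numFieldNormedType.Exports.

Local Open Scope classical_set_scope.
Local Open Scope ring_scope.

(** * Real-valued integrals *)

(** All exponents [p] are treated at once: a bound in [L^p] gives a bound in [L^1] with weight
    [\prod_i (1 + x_i^2)^-1], depending only on [p] and the bound. Each factor of the weight costs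
    two derivatives of the test function, hence the [2d] derivatives. The exponents in the localized
    functions follow from this count: differentiating [u^n] produces [n u^(n-1)], so [2d] spare
    powers of [u] restore [n u^n], while [2d + 1] powers of [u^2 - 1] absorb [2d] factors [n] and
    leave a gain of [1/n]. The adjoint multiplier is specified only by its properties, so its
    existence has to be proved; this is where the topology of the Schwartz space enters. Real and
    imaginary parts of transforms, and of all their derivatives, are cosine integrals with a phase,
    which keeps the analysis real-valued. Fourier inversion is obtained by damping with
    [exp (- e |x_i|)]: the resulting Poisson kernels have arctangents as primitives, so their
    averages over boxes are explicit, and averages over boxes determine a function almost
    everywhere. *)

Section real_integral.
Context {dT : measure_display} {T : measurableType dT} {R : realType}.
Variable mu : {measure set T -> \bar R}.
Implicit Types f g : T -> R.

Definition Rintegrable f := mu.-integrable [set: T] (EFin \o f).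

Lemma Rintegrable_measurable f : Rintegrable f -> measurable_fun [set: T] f.
Proof. by move=> /measurable_int /measurable_EFinP. Qed.

Lemma Rintegrable_dom f g : measurable_fun [set: T] f -> Rintegrable g ->
  (forall x, `|f x| <= g x) -> Rintegrable f.
Proof.
move=> mf ig fg; apply: (le_integrable _ _ _ ig) => //; first exact/measurable_EFinP.
by move=> x _ /=; rewrite lee_fin (le_trans (fg x))// ler_norm.
Qed.

Lemma RintegrableD f g : Rintegrable f -> Rintegrable g ->
  Rintegrable (fun x => f x + g x).
Proof. by move=> itf ig; exact: (integrableD measurableT itf ig). Qed.

Lemma RintegrableB f g : Rintegrable f -> Rintegrable g ->
  Rintegrable (fun x => f x - g x).
Proof. by move=> itf ig; exact: (integrableB measurableT itf ig). Qed.

Lemma RintegrableZ (c : R) f : Rintegrable f -> Rintegrable (fun x => c * f x).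
Proof. exact: integrableZl. Qed.

Lemma RintegrableN f : Rintegrable f -> Rintegrable (fun x => - f x).
Proof. exact: integrableN. Qed.

Lemma Rintegrable_norm f : Rintegrable f -> Rintegrable (fun x => `|f x|).
Proof. exact: integrable_norm. Qed.

Lemma RintegrableM f g (C : R) : Rintegrable f -> measurable_fun [set: T] g ->
  (forall x, `|g x| <= C) -> Rintegrable (fun x => f x * g x).
Proof.
move=> itf mg gC; apply: (Rintegrable_dom _ (fun x => C * `|f x|)).
- by apply: measurable_funM => //; exact: Rintegrable_measurable.
- by apply: RintegrableZ; exact: Rintegrable_norm.
- by move=> x; rewrite normrM mulrC ler_wpM2r.
Qed.

Lemma RintZ (c : R) f : Rintegrable f ->
  \int[mu]_x (c * f x) = c * \int[mu]_x f x.
Proof. exact: RintegralZl. Qed.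

Lemma RintN f : Rintegrable f -> \int[mu]_x (- f x) = - \int[mu]_x f x.
Proof.
move=> itf; rewrite -mulN1r -RintZ//; by under eq_Rintegral do rewrite -mulN1r.
Qed.

Lemma RintD f g : Rintegrable f -> Rintegrable g ->
  \int[mu]_x (f x + g x) = \int[mu]_x f x + \int[mu]_x g x.
Proof. by move=> itf ig; rewrite RintegralD. Qed.

Lemma RintB f g : Rintegrable f -> Rintegrable g ->
  \int[mu]_x (f x - g x) = \int[mu]_x f x - \int[mu]_x g x.
Proof. by move=> itf ig; rewrite RintegralB. Qed.

Lemma Rint_norm_le f g : measurable_fun [set: T] f -> Rintegrable g ->
  (forall x, `|f x| <= g x) -> `|\int[mu]_x f x| <= \int[mu]_x g x.
Proof.
move=> mf ig fg; have itf := Rintegrable_dom _ _ mf ig fg.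
apply: le_trans (le_normr_Rintegral measurableT itf) _.
apply: le_Rintegral => //; first exact: Rintegrable_norm.
Qed.

Lemma Rint_ae_eq f g : measurable_fun [set: T] f -> measurable_fun [set: T] g ->
  {ae mu, forall x, f x = g x} -> \int[mu]_x f x = \int[mu]_x g x.
Proof.
move=> mf mg fg; rewrite /Rintegral; congr fine; apply: ae_eq_integral => //.
- exact/measurable_EFinP.
- exact/measurable_EFinP.
- by apply: filterS fg => x /= -> _.
Qed.

Lemma Rintegrable_ae_eq f g : Rintegrable f -> measurable_fun [set: T] g ->
  {ae mu, forall x, f x = g x} -> Rintegrable g.
Proof.
move=> itf mg fg; apply/integrableP; split; first exact/measurable_EFinP.
have [_] := integrableP _ _ _ itf; congr (_ < _)%E; apply: ae_eq_integral => //.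
- by do 2 apply: measurableT_comp => //; exact: Rintegrable_measurable.
- by do 2 apply: measurableT_comp => //.
- by apply: filterS fg => x /= -> _.
Qed.

Lemma Rint_dominated (F : nat -> T -> R) f g :
  (forall n, measurable_fun [set: T] (F n)) -> measurable_fun [set: T] f ->
  Rintegrable g -> (forall n x, `|F n x| <= g x) ->
  {ae mu, forall x, F n x @[n --> \oo] --> f x} ->
  \int[mu]_x F n x @[n --> \oo] --> \int[mu]_x f x.
Proof.
move=> mF mf ig Fg Ff.
have H := @dominated_convergence _ T R mu setT measurableT
  (fun n => EFin \o F n) (EFin \o f) (EFin \o g).
have [i1 _ i2] : [/\ mu.-integrable setT (EFin \o f),
  ((fun n => \int[mu]_x `|(F n x)%:E - (f x)%:E|)%E @ \oo --> 0%E) &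
  ((fun n => \int[mu]_x (F n x)%:E)%E @ \oo --> (\int[mu]_x (f x)%:E)%E)].
  apply: H => //.
  - by move=> n; exact/measurable_EFinP.
  - exact/measurable_EFinP.
  - by apply: filterS Ff => x Fx _; apply/fine_cvgP; split => //; exact: nearW.
  - by apply/nearW => x n _; rewrite lee_fin.
have ff : (\int[mu]_x (f x)%:E \is a fin_num)%E by exact: integrable_fin_num.
rewrite /Rintegral; apply: fine_cvg; by rewrite fineK.
Qed.

End real_integral.

(** * Fubini's theorem for real-valued integrals *)

Section real_fubini.
Context {d1 d2 : measure_display} {T1 : measurableType d1}
  {T2 : measurableType d2} {R : realType}.
Variables (m1 : {sigma_finite_measure set T1 -> \bar R})
  (m2 : {sigma_finite_measure set T2 -> \bar R}).
Implicit Types f : T1 * T2 -> R.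

Lemma Rintegrable_prod f (g : T1 -> R) (h : T2 -> R) :
  measurable_fun [set: T1 * T2] f -> Rintegrable m1 g -> Rintegrable m2 h ->
  (forall x y, `|f (x, y)| <= g x * h y) ->
  Rintegrable (m1 \x m2)%E f.
Proof.
move=> mf ig ih fgh; apply/integrable12ltyP; first exact/measurable_EFinP.
pose K := \int[m2]_y `|h y|.
have ih' := Rintegrable_norm _ _ ih.
apply: (@le_lt_trans _ _ (\int[m1]_x (`|g x| * K)%:E)%E).
  apply: ge0_le_integral => //.
  - by move=> *; exact: integral_ge0.
  - apply: (measurable_fun_fubini_tonelli_F (fun z => (`|f z|)%:E)) => //.
    by apply/measurable_EFinP; apply: measurableT_comp.
  - apply/measurable_EFinP; apply: measurable_funM => //.
    by apply: measurableT_comp => //; exact: Rintegrable_measurable ig.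
  move=> x _.
  have -> : (`|g x| * K)%:E = (\int[m2]_y ((`|g x| * `|h y|)%:E))%E.
    rewrite -RintZ// /Rintegral fineK//.
    by apply: integrable_fin_num => //; exact: RintegrableZ.
  apply: ge0_le_integral => //.
  - apply/measurable_EFinP; apply: measurableT_comp => //.
    exact: measurableT_comp mf (pair1_measurable x).
  - by apply/measurable_EFinP; apply: Rintegrable_measurable; exact: RintegrableZ ih'.
  - by move=> y _; rewrite lee_fin -normrM (le_trans (fgh _ _))// ler_norm.
have : Rintegrable m1 (fun x => `|g x| * K).
  under eq_fun do rewrite mulrC; apply: RintegrableZ; exact: Rintegrable_norm.
move=> /integrableP[_]; congr (_ < _)%E; apply: eq_integral => x _.
rewrite /= ger0_norm// mulr_ge0//; apply: Rintegral_ge0 => //.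
Qed.

Lemma Rint_fubini_F f : Rintegrable (m1 \x m2)%E f ->
  measurable_fun [set: T1] (fun x => \int[m2]_y f (x, y)) /\
  \int[m1]_x \int[m2]_y f (x, y) = fine (\int[m1 \x m2]_z (f z)%:E)%E.
Proof.
move=> itf; have mF := measurable_fubini_F itf.
have mF' : measurable_fun [set: T1] (fun x => \int[m2]_y f (x, y)).
  by rewrite /Rintegral; apply: measurableT_comp => //; exact: measurable_fine.
split => //; rewrite -integral12_prod_meas1// {1}/Rintegral; congr fine.
apply: ae_eq_integral => //; first exact/measurable_EFinP.
(* The inner integral is known to be finite only for almost every [x]; elsewhere [fine] may replace
   an infinite value by [0]. *)
apply: filterS (ae_integrable1 itf) => x ix _.
by rewrite /Rintegral /= fineK//; exact: integrable_fin_num ix.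
Qed.

Lemma Rint_fubini_G f : Rintegrable (m1 \x m2)%E f ->
  measurable_fun [set: T2] (fun y => \int[m1]_x f (x, y)) /\
  \int[m2]_y \int[m1]_x f (x, y) = fine (\int[m1 \x m2]_z (f z)%:E)%E.
Proof.
move=> itf; have mF := measurable_fubini_G itf.
have mF' : measurable_fun [set: T2] (fun y => \int[m1]_x f (x, y)).
  by rewrite /Rintegral; apply: measurableT_comp => //; exact: measurable_fine.
split => //; rewrite -integral21_prod_meas1// {1}/Rintegral; congr fine.
apply: ae_eq_integral => //; first exact/measurable_EFinP.
apply: filterS (ae_integrable2 itf) => x ix _.
by rewrite /Rintegral /= fineK//; exact: integrable_fin_num ix.
Qed.

Lemma Rint_fubini f : Rintegrable (m1 \x m2)%E f ->
  \int[m1]_x \int[m2]_y f (x, y) = \int[m2]_y \int[m1]_x f (x, y).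
Proof. by move=> itf; rewrite (Rint_fubini_F _ itf).2 (Rint_fubini_G _ itf).2. Qed.

End real_fubini.

(** * Integration on row vectors *)

Section lebesgue_rV_integral.
Context {R : realType}.
Local Notation leb := (@lebesgue_measure R).
Local Notation mu d := (lebesgue_rV R d).

Lemma rV_consE0 n (t : measurableTypeR R) (y : 'rV[R]_n) : rV_cons (t, y) ord0 ord0 = t.
Proof.
rewrite /rV_cons /=; have -> : ord0 = lshift n ord0 :> 'I_(1 + n) by apply/val_inj.
by rewrite [LHS]row_mxEl mxE.
Qed.

Lemma rV_consE n (t : measurableTypeR R) (y : 'rV[R]_n) j :
  rV_cons (t, y) ord0 (lift ord0 j) = y ord0 j.
Proof.
rewrite /rV_cons /=; have -> : lift ord0 j = rshift 1 j by apply/val_inj.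
by rewrite [LHS]row_mxEr.
Qed.

Lemma rV_eq n (x y : 'rV[R]_n) : (forall i, x ord0 i = y ord0 i) -> x = y.
Proof. by move=> xy; apply/matrixP => i j; rewrite ord1 xy. Qed.

Lemma Rintegrable_rV_cons n (f : 'rV[R]_n.+1 -> R) :
  measurable_fun [set: 'rV[R]_n.+1] f ->
  Rintegrable (leb \x mu n)%E (f \o @rV_cons R n) -> Rintegrable (mu n.+1) f.
Proof.
move=> mf itf; apply/integrableP; split; first exact/measurable_EFinP.
move/integrableP : itf => [_]; rewrite ge0_integral_pushforward//.
- exact: measurable_rV_cons.
- by apply: measurableT_comp => //; exact/measurable_EFinP.
Qed.

Lemma Rintegrable_rV_consP n (f : 'rV[R]_n.+1 -> R) :
  Rintegrable (mu n.+1) f -> Rintegrable (leb \x mu n)%E (f \o @rV_cons R n).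
Proof.
move=> itf; have mf := Rintegrable_measurable _ _ itf.
apply/integrableP; split.
  by apply/measurable_EFinP; apply: measurableT_comp => //; exact: measurable_rV_cons.
move/integrableP : itf => [_]; rewrite ge0_integral_pushforward//.
- exact: measurable_rV_cons.
- by apply: measurableT_comp => //; exact/measurable_EFinP.
Qed.

Lemma Rint_rV_cons n (f : 'rV[R]_n.+1 -> R) : Rintegrable (mu n.+1) f ->
  \int[mu n.+1]_x f x = \int[leb]_t \int[mu n]_y f (rV_cons (t, y)).
Proof.
move=> itf; have itf' := Rintegrable_rV_consP _ _ itf.
rewrite (Rint_fubini_F _ _ (f \o @rV_cons R n) itf').2 /Rintegral; congr fine.
rewrite (integral_pushforward (@measurable_rV_cons R n))//.
by apply/measurable_EFinP; exact: Rintegrable_measurable itf.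
Qed.

Lemma measurable_rV_comp d (h : R -> R) (i : 'I_d) : measurable_fun [set: R] h ->
  measurable_fun [set: 'rV[R]_d] (fun x => h (x ord0 i)).
Proof. by move=> mh; apply: measurableT_comp mh _; exact: measurable_coord. Qed.

Lemma measurable_prod_rV d (h : 'I_d -> R -> R) :
  (forall i, measurable_fun [set: R] (h i)) ->
  measurable_fun [set: 'rV[R]_d] (fun x => \prod_i h i (x ord0 i)).
Proof.
by move=> mh; apply: measurable_prod => i _; apply: measurable_rV_comp.
Qed.

Lemma Rint_prod d (h : 'I_d -> R -> R) : (forall i, Rintegrable leb (h i)) ->
  Rintegrable (mu d) (fun x => \prod_i h i (x ord0 i)) /\
  \int[mu d]_x \prod_i h i (x ord0 i) = \prod_i \int[leb]_t h i t.
Proof.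
elim: d h => [h _|n ih h ith].
  have -> : (fun x : 'rV[R]_0 => \prod_i h i (x ord0 i)) = cst 1.
    by apply/funext => x; rewrite big_ord0.
  have mu0 : mu 0 setT = 1%E by rewrite /= diracE mem_set.
  split.
    apply/integrableP; split.
      by apply/measurable_EFinP; exact: measurable_cst.
    under eq_integral do rewrite /= normr1.
    rewrite integral_cst// [X in (_ * X)%E](_ : _ = 1%E); last exact: mu0.
    by rewrite mule1 ltry.
  rewrite big_ord0 Rintegral_cst// [X in fine X](_ : _ = 1%E); last exact: mu0.
  by rewrite mulr1.
have [itp ip] := ih (fun i => h (lift ord0 i)) (fun i => ith _).
have E : (fun x : 'rV[R]_n.+1 => \prod_i h i (x ord0 i)) \o @rV_cons R n =
  (fun ty => h ord0 ty.1 * \prod_i h (lift ord0 i) (ty.2 ord0 i)).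
  apply/funext => -[t y] /=; rewrite big_ord_recl rV_consE0; congr *%R.
  by apply: eq_bigr => i _; rewrite rV_consE.
have mh i : measurable_fun [set: R] (h i) by exact: Rintegrable_measurable (ith i).
have itf : Rintegrable (mu n.+1) (fun x => \prod_i h i (x ord0 i)).
  apply: Rintegrable_rV_cons; first exact: measurable_prod_rV.
  rewrite E; apply: (Rintegrable_prod _ _ _ (fun t : measurableTypeR R => `|h ord0 t|)
    (fun y : 'rV[R]_n => `|\prod_i h (lift ord0 i) (y ord0 i)|)).
  - apply: measurable_funM; first exact: measurableT_comp (mh _) _.
    exact: (measurableT_comp (measurable_prod_rV _ _ (fun i => mh (lift ord0 i)))).
  - exact: Rintegrable_norm.
  - exact: Rintegrable_norm.
  - by move=> t y; rewrite normrM.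
split => //; rewrite Rint_rV_cons// big_ord_recl.
transitivity (\int[leb]_t (\prod_i \int[leb]_s h (lift ord0 i) s * h ord0 t)).
  apply: eq_Rintegral => t _; rewrite -ip mulrC -RintZ//.
  by apply: eq_Rintegral => y _; exact: (congr1 (@^~ (t, y)) E).
by rewrite RintZ// mulrC.
Qed.

Lemma measurable_boxA d (A : 'I_d -> set R) : (forall i, measurable (A i)) ->
  measurable [set x : 'rV[R]_d | forall i, A i (x ord0 i)].
Proof. by move=> mA; have [] := lebesgue_rV_box mA. Qed.

Lemma cvg_rV {T : Type} (F : set_system T) {FF : Filter F} d (u : T -> 'rV[R]_d)
    (x : 'rV[R]_d) :
  (forall i, u t ord0 i @[t --> F] --> x ord0 i) -> u t @[t --> F] --> x.
Proof.
move=> ux A [P xP PA].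
have : \forall t \near F, forall i, P ord0 i (u t ord0 i).
  by apply: filter_forall => i; apply: ux; exact: xP.
by apply: filterS => t Pt; apply: PA => i j; rewrite ord1; exact: Pt.
Qed.

Lemma continuous_rV {T : topologicalType} d (u : T -> 'rV[R]_d) :
  (forall i, continuous (fun t => u t ord0 i)) -> continuous u.
Proof. by move=> uc t; apply: cvg_rV => i; exact: uc. Qed.

(* [f] is the pointwise limit of the functions obtained by rounding the
   coordinates down to multiples of [1/(k+1)]. *)
Lemma continuous_measurable_rV d (f : 'rV[R]_d -> R) : continuous f ->
  measurable_fun [set: 'rV[R]_d] f.
Proof.
move=> cf.
pose rnd (k : nat) (x : 'rV[R]_d) : 'rV[R]_d :=
  \row_i ((Num.floor (k.+1%:R * x ord0 i))%:~R / k.+1%:R).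
have rndE k t : `|(Num.floor (k.+1%:R * t))%:~R / k.+1%:R - t| <= k.+1%:R^-1 :> R.
  have k0 : (0 : R) < k.+1%:R by [].
  have /andP[fl fu] := floor_itv (k.+1%:R * t).
  rewrite intrD in fu.
  rewrite -(ler_pM2l k0) divff ?gt_eqF// -{1}(ger0_norm (ltW k0)) -normrM mulrBr.
  rewrite mulrC divfK ?gt_eqF// distrC ger0_norm ?subr_ge0//.
  by rewrite lerBlDl ltW.
have rnd_cvg x : rnd k x @[k --> \oo] --> x.
  apply: cvg_rV => i; apply/cvgrPdist_le => e e0.
  near=> k; rewrite mxE distrC (le_trans (rndE _ _))//.
  by apply/ltW; near: k; exact: (near_infty_natSinv_lt (PosNum e0)).
(* [rnd k] takes countably many values, each on a half-open cell, so a preimage is a countable union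
   of cells indexed by integer vectors. *)
have mf k : measurable_fun [set: 'rV[R]_d] (f \o rnd k).
  move=> _ Y mY; rewrite setTI.
  rewrite [X in measurable X](_ : _ = \bigcup_(z : 'rV[int]_d)
     (if `[<Y (f (\row_i ((z ord0 i)%:~R / k.+1%:R)))>] then
       [set x : 'rV[R]_d | forall i,
          [set t : R | Num.floor (k.+1%:R * t) = z ord0 i] (x ord0 i)]
     else set0)); last first.
    apply/seteqP; split => [x /= Yx|x [z _]].
      exists (\row_i Num.floor (k.+1%:R * x ord0 i)) => //.
      case: asboolP => [_ i /=|]; first by rewrite mxE.
      case; move: Yx; rewrite /rnd; congr (Y (f _)).
      by apply: rV_eq => i; rewrite !mxE.
    case: asboolP => // + /= xz; congr (Y (f _)).
    by apply: rV_eq => i; rewrite !mxE xz.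
  apply: countable_bigcupT_measurable => // z.
  case: asboolP => // _.
  apply: (measurable_boxA _ (fun i => [set t : R | Num.floor (k.+1%:R * t) = z ord0 i])) => i.
  rewrite (_ : mkset _ = `[(z ord0 i)%:~R / k.+1%:R, (z ord0 i + 1)%:~R / k.+1%:R[%classic)//.
  apply/seteqP; split => t /=; rewrite in_itv /= ler_pdivrMr// ltr_pdivlMr//.
    by move=> /eqP; rewrite floor_eq ![_ * t]mulrC.
  by rewrite ![t * _]mulrC -floor_eq => /eqP.
apply: (@measurable_fun_cvg _ _ _ setT (fun k => f \o rnd k) f mf) => x _.
by apply: continuous_cvg; [exact: cf|exact: rnd_cvg].
Unshelve. all: by end_near. Qed.


(** The faces of a box are null; there the Poisson integrals of its indicator need not converge to
    the indicator. *)
Lemma null_hyperplane d (i : 'I_d) (a : R) :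
  {ae mu d, forall x : 'rV[R]_d, x ord0 i != a}.
Proof.
pose A j : set R := if j == i then [set a] else setT.
have mA j : measurable (A j) by rewrite /A; case: eqP.
have [mB B0] := lebesgue_rV_box mA.
exists [set x : 'rV[R]_d | forall j, A j (x ord0 j)]; split => //.
  by rewrite B0 (bigD1 i)//= {1}/A eqxx lebesgue_measure_set1 mul0e.
by move=> x /= /negP /negPn /eqP xa j; rewrite /A; case: eqP => // ->.
Qed.

(** Half-open like the intervals that generate the Borel sets of the line, so that the coordinate
    preimage of a generator is a countable union of boxes. *)
Definition obox d (a b : 'I_d -> R) : set 'rV[R]_d :=
  [set x | forall i, `]a i, b i]%classic (x ord0 i)].
Arguments obox {d}.

Lemma measurable_obox d (a b : 'I_d -> R) : measurable (obox a b).
Proof. exact: (measurable_boxA _ (fun i => `]a i, b i]%classic)). Qed.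

Lemma oboxI d (a b a' b' : 'I_d -> R) : obox a b `&` obox a' b' =
  obox (fun i => Num.max (a i) (a' i)) (fun i => Num.min (b i) (b' i)).
Proof.
apply/seteqP; split => [x [/= xab xab'] i|x /= xab].
  move: (xab i) (xab' i) => /=; rewrite !in_itv /= => /andP[? ?] /andP[? ?].
  by rewrite gt_max le_min; apply/andP; split; apply/andP.
split => i; move: (xab i) => /=; rewrite !in_itv /= gt_max le_min.
  by move=> /andP[/andP[-> _] /andP[-> _]].
by move=> /andP[/andP[_ ->] /andP[_ ->]].
Qed.

Definition oboxes d : set (set 'rV[R]_d) := [set obox ab.1 ab.2 | ab in setT].

Lemma measurable_oboxes d (X : set 'rV[R]_d) : measurable X -> <<s @oboxes d >> X.
Proof.
pose cube i (a b : R) (k : nat) := obox (fun j : 'I_d => if j == i then a else - k%:R)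
  (fun j => if j == i then b else k%:R).
suff H i (Y : set R) : measurable Y ->
    <<s @oboxes d >> ((fun x : 'rV[R]_d => x ord0 i) @^-1` Y).
  apply: smallest_sub; first exact: smallest_sigma_algebra.
  move=> Z; rewrite -bigcup_seq /= => -[i _] [Y mY]; rewrite setTI => <-.
  exact: H.
pose G := [set Y : set R | <<s @oboxes d >> ((fun x : 'rV[R]_d => x ord0 i) @^-1` Y)].
suff : measurable `<=` G by apply.
apply: smallest_sub.
  have [s0 sD sU] : sigma_algebra setT (<<s @oboxes d >>) by exact: smallest_sigma_algebra.
  split => [|Z GZ|F GF]; rewrite /G /=.
  - by rewrite preimage_set0.
  - by rewrite setTD preimage_setC -setTD; exact: sD.
  - by rewrite preimage_bigcup; exact: sU.
move=> _ [[a b] _ <-]; rewrite /G /=.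
rewrite (_ : _ @^-1` _ = \bigcup_k cube i a b k).
  have [s0 sD sU] : sigma_algebra setT (<<s @oboxes d >>) by exact: smallest_sigma_algebra.
  apply: sU => k; apply: sub_sigma_algebra.
  by exists (fun j : 'I_d => if j == i then a else - k%:R,
    fun j => if j == i then b else k%:R).
apply/seteqP; split => [x /= xab|x [k _] /= /(_ i)]; last by rewrite eqxx.
have [k xk] : exists k : nat, forall j, `|x ord0 j| < k%:R.
  exists (\sum_j (Num.truncn `|x ord0 j|).+1)%N => j.
  apply: lt_le_trans (truncnS_gt _) _.
  by rewrite ler_nat (bigD1 j)//= leq_addr.
exists k => // j /=; case: eqP => [->//|_].
by rewrite in_itv /=; move: (xk j); rewrite ltr_norml => /andP[-> /ltW].
Qed.

(** A pi-lambda argument: boxes are stable under intersection and generate the measurable sets, and,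
    inside a cube, the sets over which [g] has integral zero form a lambda-system. *)
Lemma box_uniqueness d (g : 'rV[R]_d -> R) : measurable_fun [set: 'rV[R]_d] g ->
  (forall n : nat, Rintegrable (mu d) (fun x => g x *
    \1_(obox (fun=> - n%:R) (fun=> n%:R)) x)) ->
  (forall a b, \int[mu d]_x (g x * \1_(obox a b) x) = 0) ->
  {ae mu d, forall x, g x = 0}.
Proof.
move=> mg ig g0.
pose B n := obox (fun _ : 'I_d => - n%:R) (fun=> n%:R).
suff H n : {ae mu d, forall x, g x * \1_(B n) x = 0}.
  apply: filterS (ae_foralln H) => x gB.
  have [n xn] : exists n : nat, forall j, `|x ord0 j| < n%:R.
    exists (\sum_j (Num.truncn `|x ord0 j|).+1)%N => j.
    apply: lt_le_trans (truncnS_gt _) _.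
    by rewrite ler_nat (bigD1 j)//= leq_addr.
  move: (gB n); rewrite indicE mem_set ?mulr1// => j /=; rewrite in_itv /=.
  by move: (xn j); rewrite ltr_norml => /andP[-> /ltW].
(* Cutting [g] down to a cube makes it integrable, which the differences and increasing unions of
   the lambda-system require. *)
pose h x := g x * \1_(B n) x; have ih : Rintegrable (mu d) h by exact: ig.
have ih' A : measurable A -> Rintegrable (mu d) (fun x => h x * \1_A x).
  move=> mA; apply: (RintegrableM _ _ _ 1) => //.
  by move=> x; rewrite indicE; case: (x \in A); rewrite ?normr1 ?normr0.
pose H := [set A : set 'rV[R]_d | measurable A /\ \int[mu d]_x (h x * \1_A x) = 0].
have LH : lambda_system setT H.
  split.
  - by move=> A [].
  - split => //; under eq_Rintegral do rewrite indicT mulr1; exact: g0.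
  - move=> C A AC [mC C0] [mA A0]; split; first exact: measurableD.
    have -> : (fun x => h x * \1_(C `\` A) x) =
        (fun x => h x * \1_C x - h x * \1_A x).
      apply/funext => x; rewrite -mulrBr; congr *%R; rewrite !indicE in_setD.
      have [xA|xA] := boolP (x \in A); last by rewrite andbT subr0.
      by rewrite andbF mem_set ?subrr//; apply: AC; move: xA; rewrite inE.
    by rewrite RintB ?C0 ?A0 ?subrr//; exact: ih'.
  - move=> F ndF HF.
    have mF k : measurable (F k) by have [] := HF k.
    split; first exact: bigcupT_measurable.
    have : \int[mu d]_x (h x * \1_(F k) x) @[k --> \oo] -->
        \int[mu d]_x (h x * \1_(\bigcup_k F k) x).
      apply: (Rint_dominated _ _ _ (fun x => `|h x|)).
      - by move=> k; exact: Rintegrable_measurable (ih' _ (mF k)).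
      - by apply: Rintegrable_measurable (ih' _ _); exact: bigcupT_measurable.
      - exact: Rintegrable_norm.
      - move=> k x; rewrite normrM indicE ler_piMr//.
        by case: (_ \in _); rewrite ?normr1 ?normr0.
      - apply: aeW => x; apply: cvgM; first exact: cvg_cst.
        have [[k _ Fk]|nF] := pselect ((\bigcup_k F k) x).
          apply: cvg_near_cst; exists k => // j /= kj.
          rewrite !indicE mem_set 1?mem_set//; first by exists k.
          by move: x Fk; apply/subsetPset; exact: ndF.
        apply: cvg_near_cst; apply: nearW => j.
        rewrite !indicE !memNset//; by apply: contra_not nF => Fj; exists j.
    under eq_fun do rewrite (HF _).2.
    by move=> /(cvg_unique _ (cvg_cst _)) <-.
have GH : @oboxes d `<=` H.
  move=> _ [[a b] _ <-] /=; split; first exact: measurable_obox.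
  rewrite -[RHS](g0 (fun i => Num.max (- n%:R) (a i)) (fun i => Num.min n%:R (b i))).
  by apply: eq_Rintegral => x _; rewrite -oboxI indicI mulrA.
have IG : setI_closed (@oboxes d).
  move=> _ _ [[a b] _ <-] [[a' b'] _ <-] /=; rewrite oboxI.
  by exists (fun i => Num.max (a i) (a' i), fun i => Num.min (b i) (b' i)).
have allH A : measurable A -> \int[mu d]_x (h x * \1_A x) = 0.
  move=> /measurable_oboxes.
  by move/(lambda_system_subset IG LH GH) => [].
have : ae_eq (mu d) setT (EFin \o h) (cst 0%E).
  apply: integral_ae_eq => // E _ mE; rewrite integral_cst// mul0e.
  rewrite integral_mkcond.
  have -> : (EFin \o h) \_ E = EFin \o (fun x => h x * \1_E x).
    apply/funext => x; rewrite /patch /= indicE.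
    by case: ifPn => _; rewrite ?mulr1 ?mulr0.
  rewrite -[LHS]fineK; first by congr EFin; exact: allH.
  by apply: integrable_fin_num => //; exact: ih'.
by apply: filterS => x /(_ I) [].
Qed.

End lebesgue_rV_integral.

Arguments obox {R d}.
Arguments oboxes {R}.

(** * Poisson kernel and Fourier inversion *)

Section is_derive_lambda.
Context {R : realType} {V : normedModType R}.
Implicit Types (f g : V -> R) (x v : V).

(** A directional derivative is a one-variable limit: one-variable rules carry over by restriction
    to lines, and coordinate derivatives pass to slices. *)
Lemma derive_line f x v : 'D_v f x = 'D_1 (fun h : R => f (h *: v + x)) 0.
Proof.
rewrite /derive; set g1 := fun h => h^-1 *: _; set g2 := fun h => h^-1 *: _.
suff -> : g1 = g2 by [].
apply/funext => h; rewrite /g1 /g2 /=.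
by rewrite addr0 scale0r add0r [_%:A]mulr1.
Qed.

Lemma is_derive_line f x v df : is_derive x v f df ->
  is_derive (0 : R) 1 (fun h : R => f (h *: v + x)) df.
Proof.
move=> [dfx fE]; apply: DeriveDef; first exact: (derivable1P _ _ _).1.
by rewrite -derive_line.
Qed.

Lemma is_derive_lineW f x v df :
  is_derive (0 : R) 1 (fun h : R => f (h *: v + x)) df -> is_derive x v f df.
Proof.
move=> [dfx fE]; apply: DeriveDef; first exact: (derivable1P _ _ _).2.
by rewrite derive_line.
Qed.

Lemma is_derive_const x v (c : R) : is_derive x v (fun=> c) 0.
Proof. exact: is_derive_cst. Qed.

Lemma is_derive_add {f g x v df dg} : is_derive x v f df -> is_derive x v g dg ->
  is_derive x v (fun y => f y + g y) (df + dg).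
Proof. exact: is_deriveD. Qed.

Lemma is_derive_opp {f x v df} : is_derive x v f df ->
  is_derive x v (fun y => - f y) (- df).
Proof. exact: is_deriveN. Qed.

Lemma is_derive_mul {f g x v df dg} : is_derive x v f df -> is_derive x v g dg ->
  is_derive x v (fun y => f y * g y) (df * g x + f x * dg).
Proof.
move=> fd gd; have := @is_deriveM _ _ f g x v df dg fd gd.
by rewrite /GRing.scale/= addrC [g x * _]mulrC.
Qed.

Lemma is_derive_scale (c : R) {f x v df} : is_derive x v f df ->
  is_derive x v (fun y => c * f y) (c * df).
Proof. exact: is_deriveZ. Qed.

Lemma is_derive_exp n {f x v df} : is_derive x v f df ->
  is_derive x v (fun y => f y ^+ n) (n%:R * f x ^+ n.-1 * df).
Proof.
elim: n => [|n ih] fd; first by rewrite !mul0r; exact: is_derive_cst.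
under eq_fun do rewrite exprS.
apply: (is_derive_eq (is_derive_mul fd (ih fd))).
by case: n {ih} => [|n] /=; rewrite ?exprS -?natr1; ring.
Qed.

Lemma is_derive_inv {f x v df} : is_derive x v f df -> f x != 0 ->
  is_derive x v (fun y => (f y)^-1) (- (f x) ^- 2 * df).
Proof.
move=> [fd <-] fx; apply: DeriveDef; first exact: derivableV.
by rewrite (deriveV fx fd).
Qed.

Lemma is_derive_comp1 (h : R -> R) f x v df dh : is_derive x v f df ->
  is_derive (f x) 1 h dh -> is_derive x v (fun y => h (f y)) (dh * df).
Proof.
move=> /is_derive_line fd hd; apply: is_derive_lineW.
apply: (@is_derive1_comp _ h (fun s => f (s *: v + x))) fd.
by rewrite scale0r add0r.
Qed.

End is_derive_lambda.

(** * Exponential and Poisson integrals on the line *)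

Section one_dimensional_integrals.
Context {R : realType}.
Local Notation leb := (@lebesgue_measure R).
Implicit Types (f g F : R -> R).

Lemma is_derive_continuous (F f : R -> R) : (forall t : R, is_derive t (1 : R) F (f t)) ->
  continuous F.
Proof.
move=> dF t; apply: differentiable_continuous; apply/derivable1_diffP.
by have [] := dF t.
Qed.

(** [g] continues the right half of [f] to the whole line: [exp (- e |t|)] has a corner at [0],
    whereas [exp (- e t)] has an elementary primitive everywhere. *)
Lemma Rint_even f g F l : (forall t, 0 <= f t) -> continuous f ->
  (forall t, f (- t) = f t) -> (forall t, 0 <= t -> f t = g t) -> continuous g ->
  (forall t : R, is_derive t (1 : R) F (g t)) -> F t @[t --> +oo] --> l ->
  Rintegrable leb f /\ \int[leb]_t f t = 2 * (l - F 0).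
Proof.
move=> f0 cf ef fg cg dF Fl.
have cF : continuous F := is_derive_continuous F g dF.
have E : (\int[leb]_t (f t)%:E = (2 * (l - F 0))%:E)%E.
  rewrite ge0_symfun_integralT//; last by move=> t /=; rewrite ef.
  rewrite EFinM; congr (_ * _)%E; rewrite -set_itvcy.
  transitivity (\int[leb]_(t in `[0%R, +oo[) (g t)%:E)%E.
    apply: eq_integral => t; rewrite inE /= in_itv /= andbT => t0.
    by rewrite fg.
  rewrite (ge0_continuous_FTC2y _ _ Fl)//.
  - by move=> t t0; rewrite -fg.
  - exact: continuous_subspaceT.
  - by apply: cvg_at_right_filter; exact: cF.
  - by move=> t _; rewrite derive1E; have [] := dF t.
split; last by rewrite /Rintegral E.
apply/integrableP; split.
  by apply/measurable_EFinP; exact: continuous_measurable_fun.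
by under eq_integral do rewrite /= ger0_norm//; rewrite E ltry.
Qed.

Lemma Rint_odd f : Rintegrable leb f -> continuous f ->
  (forall t, f (- t) = - f t) -> \int[leb]_t f t = 0.
Proof.
move=> itf cf of_.
(* On a symmetric interval the substitution of [- t] for [t] equates the integral with its opposite;
   dominated convergence then gives the whole line. *)
have H n : \int[leb]_t (f t * \1_(`[- n%:R, n%:R]%classic) t) = 0.
  have -> : \int[leb]_t (f t * \1_(`[- n%:R, n%:R]%classic) t) =
      \int[leb]_(t in `[- n%:R, n%:R]) f t.
    rewrite [RHS]Rintegral_mkcond; apply: eq_Rintegral => t _.
    by rewrite /patch /= indicE; case: ifPn; rewrite ?mulr1 ?mulr0.
  have n0 : - n%:R <= n%:R :> R by rewrite (@le_trans _ _ 0)// oppr_le0.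
  have itn : leb.-integrable `[- n%:R, n%:R] (EFin \o f) by exact: integrableS itf.
  have := @integration_by_substitution_oppr R f (- n%:R) n%:R.
  rewrite opprK => /(_ n0 (continuous_subspaceT cf)) H'.
  have H : (\int[leb]_(t in `[(- n%:R)%R, n%:R]) (f t)%:E =
      \int[leb]_(t in `[(- n%:R)%R, n%:R]) (- (f t)%:E))%E.
    by rewrite {1}H'; apply: eq_integral => t _; rewrite /= of_.
  have : \int[leb]_(t in `[- n%:R, n%:R]) f t = - \int[leb]_(t in `[- n%:R, n%:R]) f t.
    rewrite [LHS]/Rintegral H -fineN -integralN//=.
    exact: integrable_add_def.
  by move/eqP; rewrite -addr_eq0 -mulr2n mulrn_eq0/= => /eqP.
have : \int[leb]_t (f t * \1_(`[- n%:R, n%:R]%classic) t) @[n --> \oo] -->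
   \int[leb]_t f t.
  apply: (Rint_dominated _ _ _ (fun t : measurableTypeR R => `|f t|)).
  - move=> n; apply: measurable_funM; first exact: continuous_measurable_fun.
    exact: measurable_indic.
  - exact: continuous_measurable_fun.
  - exact: Rintegrable_norm.
  - move=> n t; rewrite normrM ler_piMr// indicE.
    by case: (_ \in _); rewrite ?normr1 ?normr0.
  - apply: aeW => t; apply: cvg_near_cst.
    exists (Num.truncn `|t|).+1 => // n /= tn; rewrite indicE mem_set ?mulr1//=.
    rewrite in_itv /= -ler_norml (le_trans (ltW (truncnS_gt _)))//.
    by rewrite ler_nat.
under eq_fun do rewrite H.
by move=> /(cvg_unique _ (cvg_cst _)) <-.
Qed.

Lemma cvg_expRN (e : R) : 0 < e -> expR (- (e * t)) @[t --> +oo] --> (0 : R).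
Proof.
move=> e0; apply: (@cvg_comp _ _ _ (fun t => e * t) (fun s => expR (- s)) _ +oo).
  by apply: gt0_cvgMry => //; exact: cvg_id.
exact: cvgr_expR.
Qed.

Lemma Rintegrable_oneDsqrV : Rintegrable leb (fun t => (1 + t ^+ 2)^-1).
Proof.
have [] := Rint_even (fun t => (1 + t ^+ 2)^-1) (fun t => (1 + t ^+ 2)^-1)
  atan (pi / 2) => //.
- by move=> t; rewrite invr_ge0 addr_ge0// sqr_ge0.
- exact: continuous_oneDsqrV.
- by move=> t; rewrite sqrrN.
- exact: continuous_oneDsqrV.
- exact: cvgy_atan.
Qed.

Let expRabs (e t : R) := expR (- (e * `|t|)).

Lemma continuous_expRabs e : continuous (expRabs e).
Proof.
move=> t; apply: continuous_comp; last exact: continuous_expR.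
apply: continuousN; apply: continuousM; first exact: cvg_cst.
exact: norm_continuous.
Qed.

Lemma Rint_expRabs e : 0 < e ->
  Rintegrable leb (expRabs e) /\ \int[leb]_t expRabs e t = 2 * e^-1.
Proof.
move=> e0.
pose F t := - e^-1 * expR (- (e * t)).
have dexp t : is_derive (t : R) (1 : R) (fun t => expR (- (e * t))) (- e * expR (- (e * t))).
  by apply: is_derive_eq; rewrite /GRing.scale/=; ring.
have cexp : continuous (fun t => expR (- (e * t))) by exact: is_derive_continuous dexp.
have dF t : is_derive (t : R) (1 : R) F (expR (- (e * t))).
  by apply: is_derive_eq; rewrite /GRing.scale/=; field; rewrite gt_eqF.
have H := Rint_even (expRabs e) (fun t => expR (- (e * t))) F 0.
have F0 : 2 * (0 - F 0) = 2 * e^-1 by rewrite /F mulr0 oppr0 expR0; ring.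
rewrite F0 in H; apply: H => //.
- by move=> t; exact: expR_ge0.
- exact: continuous_expRabs.
- by move=> t; rewrite /expRabs normrN.
- by move=> t t0; rewrite /expRabs ger0_norm.
- rewrite -(mulr0 (- e^-1)); apply: cvgM; first exact: cvg_cst.
  exact: cvg_expRN.
Qed.

Lemma Rint_expRabs_cos e z : 0 < e ->
  \int[leb]_t (expRabs e t * cos (z * t)) = 2 * (e / (e ^+ 2 + z ^+ 2)).
Proof.
move=> e0.
have ez : e ^+ 2 + z ^+ 2 != 0 by rewrite gt_eqF// ltr_wpDr ?sqr_ge0// exprn_gt0.
(* [F] is a primitive of [expR (- (e * t)) * (1 + cos (z * t))]. Adding [1] to the cosine makes the
   integrand nonnegative, as [Rint_even] demands; the integral of [expRabs e] is subtracted at the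
   end. *)
pose F t := - e^-1 * expR (- (e * t)) +
  (e ^+ 2 + z ^+ 2)^-1 * (expR (- (e * t)) * (z * sin (z * t) - e * cos (z * t))).
have dexp t : is_derive (t : R) (1 : R) (fun t => expR (- (e * t))) (- e * expR (- (e * t))).
  by apply: is_derive_eq; rewrite /GRing.scale/=; ring.
have dcos t : is_derive (t : R) (1 : R) (fun t => cos (z * t)) (- z * sin (z * t)).
  by apply: is_derive_eq; rewrite /GRing.scale/=; ring.
have dsin t : is_derive (t : R) (1 : R) (fun t => sin (z * t)) (z * cos (z * t)).
  by apply: is_derive_eq; rewrite /GRing.scale/=; ring.
pose g t := expR (- (e * t)) * (1 + cos (z * t)).
have dF t : is_derive (t : R) (1 : R) F (g t).
  by apply: is_derive_eq; rewrite /GRing.scale/= /g; field; rewrite ez gt_eqF.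
have cexp : continuous (fun t => expR (- (e * t))) by exact: is_derive_continuous dexp.
have ccos : continuous (fun t => cos (z * t)) by exact: is_derive_continuous dcos.
have cE := continuous_expRabs e.
have cos1 (t : R) : - 1 <= cos t <= 1 by rewrite cos_geN1 cos_le1.
have [iE IE] := Rint_expRabs _ e0.
have [] := Rint_even (fun t => expRabs e t * (1 + cos (z * t))) g F 0.
- move=> t; rewrite mulr_ge0 ?expR_ge0//.
- by move=> t; apply: cvgM; [exact: cE|apply: cvgD; [exact: cvg_cst|exact: ccos]].
- by move=> t; rewrite /expRabs normrN mulrN cosN.
- by move=> t t0; rewrite /expRabs ger0_norm.
- by move=> t; apply: cvgM; [exact: cexp|apply: cvgD; [exact: cvg_cst|exact: ccos]].
- rewrite -[X in _ --> X]addr0; apply: cvgD.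
    rewrite -(mulr0 (- e^-1)); apply: cvgM; first exact: cvg_cst.
    exact: cvg_expRN.
  rewrite -(mulr0 (e ^+ 2 + z ^+ 2)^-1); apply: cvgM; first exact: cvg_cst.
  apply: (@squeeze_cvgr _ _ _ _ (fun t => - ((`|z| + `|e|) * expR (- (e * t))))
    (fun t => (`|z| + `|e|) * expR (- (e * t)))).
  + apply: nearW => t; rewrite -ler_norml normrM mulrC.
    rewrite [`|expR _|]ger0_norm ?expR_ge0// ler_wpM2r ?expR_ge0//.
    rewrite (le_trans (ler_normB _ _))// !normrM lerD// ler_piMr// ler_norml.
      by rewrite sin_geN1 sin_le1.
    exact: cos1.
  + rewrite -oppr0 -(mulr0 (`|z| + `|e|)); apply: cvgN; apply: cvgM.
      exact: cvg_cst.
    exact: cvg_expRN.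
  + rewrite -(mulr0 (`|z| + `|e|)); apply: cvgM; first exact: cvg_cst.
    exact: cvg_expRN.
move=> ig Ig.
have icos : Rintegrable leb (fun t => expRabs e t * cos (z * t)).
  apply: (RintegrableM _ _ _ 1) => //; first exact: continuous_measurable_fun.
  by move=> t; rewrite ler_norml; exact: cos1.
have : \int[leb]_t (expRabs e t * (1 + cos (z * t))) =
   \int[leb]_t expRabs e t + \int[leb]_t (expRabs e t * cos (z * t)).
  by rewrite -RintD//; apply: eq_Rintegral => t _; rewrite mulrDr mulr1.
rewrite Ig IE {1}/F !mulr0 oppr0 expR0 sin0 cos0 => H.
apply: (addrI (2 * e^-1)); rewrite -H; field; by rewrite ez gt_eqF.
Qed.

Lemma Rint_expRabs_cosD e z th : 0 < e ->
  \int[leb]_t (expRabs e t * cos (z * t + th)) =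
  cos th * (2 * (e / (e ^+ 2 + z ^+ 2))).
Proof.
move=> e0; have [iE _] := Rint_expRabs _ e0; have cE := continuous_expRabs e.
have ccos : continuous (fun t : R => cos (z * t)).
  move=> t; apply: continuous_comp; last exact: continuous_cos.
  by apply: cvgM; [exact: cvg_cst|exact: cvg_id].
have csin : continuous (fun t : R => sin (z * t)).
  move=> t; apply: continuous_comp; last exact: continuous_sin.
  by apply: cvgM; [exact: cvg_cst|exact: cvg_id].
have icos : Rintegrable leb (fun t => expRabs e t * cos (z * t)).
  apply: (RintegrableM _ _ _ 1) => //; first exact: continuous_measurable_fun.
  by move=> t; rewrite ler_norml cos_geN1 cos_le1.
have isin : Rintegrable leb (fun t => expRabs e t * sin (z * t)).
  apply: (RintegrableM _ _ _ 1) => //; first exact: continuous_measurable_fun.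
  by move=> t; rewrite ler_norml sin_geN1 sin_le1.
transitivity (\int[leb]_t (cos th * (expRabs e t * cos (z * t)) -
    sin th * (expRabs e t * sin (z * t)))).
  by apply: eq_Rintegral => t _; rewrite cosD; ring.
rewrite RintB; [|exact: RintegrableZ..]; rewrite !RintZ//.
rewrite Rint_expRabs_cos// [X in _ - _ * X]Rint_odd ?mulr0 ?subr0//.
- by move=> t; apply: cvgM; [exact: cE|exact: csin].
- by move=> t; rewrite /expRabs normrN mulrN sinN mulrN.
Qed.

(* The Fourier transform of [exp (- e |t|)]. *)
Definition poisson (e t : R) := 2 * (e / (e ^+ 2 + t ^+ 2)).

Lemma poisson_ge0 e t : 0 < e -> 0 <= poisson e t.
Proof. by move=> e0; rewrite mulr_ge0// divr_ge0 ?addr_ge0 ?sqr_ge0// ltW. Qed.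

Lemma continuous_poisson e : 0 < e -> continuous (poisson e).
Proof.
move=> e0 t; apply: cvgM; first exact: cvg_cst.
apply: cvgM; first exact: cvg_cst.
apply: cvgV; first by rewrite gt_eqF// ltr_wpDr ?sqr_ge0// exprn_gt0.
by apply: cvgD; [exact: cvg_cst|exact: exprn_continuous].
Qed.

(** The Poisson integral of the indicator of []a, b]], from the primitive [2 * atan ((y - x) / e)];
    the case distinction covers empty intervals, which [obox] allows. *)
Definition poisson_itv (e a b x : R) :=
  if a < b then 2 * (atan ((b - x) / e) - atan ((a - x) / e)) else 0.

Lemma Rint_poisson e a b x : 0 < e ->
  Rintegrable leb (fun y => \1_(`]a, b]%classic) y * poisson e (x - y)) /\
  \int[leb]_y (\1_(`]a, b]%classic) y * poisson e (x - y)) = poisson_itv e a b x.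
Proof.
move=> e0; pose F y := 2 * atan ((y - x) / e).
have dF y : is_derive (y : R) (1 : R) F (poisson e (x - y)).
  apply: is_derive_eq; rewrite /GRing.scale/= /poisson.
  have D0 : e ^+ 2 + (x - y) ^+ 2 != 0.
    by rewrite gt_eqF// ltr_wpDr ?sqr_ge0// exprn_gt0.
  have -> : 1 + ((y - x) / e) ^+ 2 = (e ^+ 2 + (x - y) ^+ 2) / e ^+ 2.
    by field; rewrite gt_eqF.
  move: D0; set D := e ^+ 2 + _ => D0; rewrite invf_div.
  by field; do ?(apply/andP; split); rewrite ?D0 ?gt_eqF.
have cP : continuous (fun y => poisson e (x - y)).
  move=> y; apply: (@continuous_comp _ _ _ (fun y => x - y) (poisson e)); last first.
    exact: continuous_poisson.
  by apply: cvgB; [exact: cvg_cst|exact: cvg_id].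
have cF := is_derive_continuous _ _ dF.
have E : (\int[leb]_y ((\1_(`]a, b]%classic) y * poisson e (x - y)))%:E =
   (poisson_itv e a b x)%:E)%E.
  transitivity (\int[leb]_(y in `]a, b]) (poisson e (x - y))%:E)%E.
    rewrite [RHS]integral_mkcond; apply: eq_integral => y _.
    by rewrite /patch /= indicE; case: ifPn; rewrite ?mul1r ?mul0r.
  rewrite /poisson_itv; case: ltP => ab.
    rewrite integral_itv_obnd_cbnd; last first.
      apply/measurable_EFinP; apply: measurable_funTS.
      exact: continuous_measurable_fun.
    rewrite (@continuous_FTC2 _ _ F)//.
    - by rewrite -EFinB /F mulrBr.
    - exact: continuous_subspaceT.
    - split.
      + by move=> y _; have [] := dF y.
      + by apply: cvg_at_right_filter; exact: cF.
      + by apply: cvg_at_left_filter; exact: cF.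
    - by move=> y _; rewrite derive1E; have [] := dF y.
  by rewrite set_itv_ge ?integral_set0// bnd_simp -leNgt.
split; last by rewrite /Rintegral E.
apply/integrableP; split.
  apply/measurable_EFinP; apply: measurable_funM; first exact: measurable_indic.
  exact: continuous_measurable_fun.
apply: (@le_lt_trans _ _ (poisson_itv e a b x)%:E); last by rewrite ltry.
rewrite -E le_eqVlt; apply/orP; left; apply/eqP; apply: eq_integral => y _.
by rewrite /= ger0_norm// mulr_ge0 ?poisson_ge0// indicE ler0n.
Qed.

Lemma poisson_itv_bound e a b x : `|poisson_itv e a b x| <= 2 * pi.
Proof.
rewrite /poisson_itv; case: ltP => _; last first.
  by rewrite normr0 mulr_ge0// pi_ge0.
rewrite normrM ger0_norm// ler_wpM2l// ler_norml.
have := atan_gtNpi2 ((b - x) / e); have := atan_ltpi2 ((b - x) / e).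
have := atan_gtNpi2 ((a - x) / e); have := atan_ltpi2 ((a - x) / e).
lra.
Qed.

Lemma cvg_atan_natmul (c : R) : 0 < c ->
  atan (c / n.+1%:R^-1) @[n --> \oo] --> pi / 2.
Proof.
move=> c0; have : atan (c * n%:R) @[n --> \oo] --> pi / 2.
  apply: (@cvg_comp _ _ _ (fun n : nat => n%:R : R) (fun t => atan (c * t)) _ +oo).
    exact: cvgr_idn.
  apply: (@cvg_comp _ _ _ (fun t => c * t) atan _ +oo); last exact: cvgy_atan.
  by apply: gt0_cvgMry => //; exact: cvg_id.
rewrite -cvg_shiftS.
suff -> : (fun n : nat => atan (c / n.+1%:R^-1)) = (fun n => atan (c * n.+1%:R)) by [].
by apply/funext => n; rewrite invrK.
Qed.

(** The Poisson kernel has total mass [2 * pi] and concentrates at the origin. The endpoints are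
    excluded because, for [a < b], the limit there is [pi]. *)
Lemma cvg_poisson_itv a b x : x != a -> x != b ->
  poisson_itv n.+1%:R^-1 a b x @[n --> \oo] --> 2 * pi * \1_(`]a, b]%classic) x.
Proof.
move=> xa xb; rewrite /poisson_itv indicE; case: ltP => ab; last first.
  rewrite memNset ?mulr0; first exact: cvg_cst.
  by rewrite /= in_itv /= => /andP[ax xb']; move: (lt_le_trans ax xb'); rewrite ltNge ab.
rewrite -mulrA; apply: cvgM; first exact: cvg_cst.
have cn (c : R) : c < 0 -> atan (c / n.+1%:R^-1) @[n --> \oo] --> - (pi / 2).
  move=> c0; rewrite (_ : (fun n => _) = (fun n : nat => - atan (- c / n.+1%:R^-1))).
    by apply: cvgN; apply: cvg_atan_natmul; rewrite oppr_gt0.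
  by apply/funext => n; rewrite mulNr atanN opprK.
have [ax|ax|/eqP] := ltgtP a x; last by rewrite eq_sym (negbTE xa).
  have [bx|bx|/eqP] := ltgtP b x; last by rewrite eq_sym (negbTE xb).
    rewrite memNset ?mulr0; last by rewrite /= in_itv /= ax leNgt bx.
    rewrite -(subrr (- (pi / 2))); apply: cvgB; apply: cn; lra.
  rewrite mem_set ?mulr1; last by rewrite /= in_itv /= ax ltW.
  have -> : pi = pi / 2 - - (pi / 2) :> R by lra.
  by apply: cvgB; [apply: cvg_atan_natmul|apply: cn]; lra.
rewrite memNset ?mulr0; last by rewrite /= in_itv /= ltNge (ltW ax).
rewrite -(subrr (pi / 2)); apply: cvgB; apply: cvg_atan_natmul; lra.
Qed.

End one_dimensional_integrals.

(** * Fourier inversion for integrable functions with integrable transform *)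

Section fourier_inversion.
Context {R : realType}.
Local Notation leb := (@lebesgue_measure R).
Local Notation mu d := (lebesgue_rV R d).

Lemma dotpC d (x y : 'rV[R]_d) : dotp x y = dotp y x.
Proof. by apply: eq_bigr => i _; rewrite mulrC. Qed.

Lemma dotpDl d (x y z : 'rV[R]_d) : dotp (x + y) z = dotp x z + dotp y z.
Proof. by rewrite -big_split; apply: eq_bigr => i _; rewrite mxE mulrDl. Qed.

Lemma dotpNl d (x z : 'rV[R]_d) : dotp (- x) z = - dotp x z.
Proof. by rewrite -sumrN; apply: eq_bigr => i _; rewrite mxE mulNr. Qed.

Lemma dotp_cons d (z : 'rV[R]_d.+1) t (y : 'rV[R]_d) :
  dotp z (rV_cons (t, y)) =
  z ord0 ord0 * t + dotp (\row_j z ord0 (lift ord0 j)) y.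
Proof.
rewrite /dotp big_ord_recl rV_consE0; congr +%R.
by apply: eq_bigr => i _; rewrite rV_consE mxE.
Qed.

Lemma measurable_dotp2 d : measurable_fun [set: 'rV[R]_d * 'rV[R]_d]
  (fun z => dotp z.1 z.2).
Proof.
apply: measurable_sum => i; apply: measurable_funM.
  by apply: (measurableT_comp (measurable_coord i)); exact: measurable_fst.
by apply: (measurableT_comp (measurable_coord i)); exact: measurable_snd.
Qed.

Lemma measurable_dotp d (y : 'rV[R]_d) :
  measurable_fun [set: 'rV[R]_d] (fun x => dotp x y).
Proof.
by apply: measurable_sum => i; apply: measurable_funM => //; exact: measurable_coord.
Qed.

Lemma measurable_dotpr d (y : 'rV[R]_d) :
  measurable_fun [set: 'rV[R]_d] (fun x => dotp y x).
Proof.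
by apply: measurable_sum => i; apply: measurable_funM => //; exact: measurable_coord.
Qed.

Lemma cos_norm_le1 (t : R) : `|cos t| <= 1.
Proof. by rewrite ler_norml cos_geN1 cos_le1. Qed.

Lemma sin_norm_le1 (t : R) : `|sin t| <= 1.
Proof. by rewrite ler_norml sin_geN1 sin_le1. Qed.

Lemma measurable_cosr : measurable_fun [set: R] (@cos R).
Proof. by apply: continuous_measurable_fun; exact: continuous_cos. Qed.

Lemma measurable_sinr : measurable_fun [set: R] (@sin R).
Proof. by apply: continuous_measurable_fun; exact: continuous_sin. Qed.

Definition rho d (e : R) (x : 'rV[R]_d) : R := \prod_i expR (- (e * `|x ord0 i|)).
Arguments rho {d}.

Lemma Rintegrable_rho d e : 0 < e -> Rintegrable (mu d) (rho e).
Proof.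
by move=> e0; have [] := Rint_prod d (fun=> fun t => expR (- (e * `|t|)))
  (fun=> (Rint_expRabs _ e0).1).
Qed.

Lemma rho_ge0 d e (x : 'rV[R]_d) : 0 <= rho e x.
Proof. by apply: prodr_ge0 => i _; exact: expR_ge0. Qed.

Lemma rho_le1 d e (x : 'rV[R]_d) : 0 <= e -> rho e x <= 1.
Proof.
move=> e0; apply: prodr_ile1 => i _.
by rewrite expR_ge0/= -expR0 ler_expR oppr_le0 mulr_ge0.
Qed.

Lemma measurable_rho d e : measurable_fun [set: 'rV[R]_d] (rho e).
Proof.
apply: (measurable_prod_rV d (fun=> fun t => expR (- (e * `|t|)))) => i.
exact: continuous_measurable_fun (continuous_expRabs e).
Qed.

(** The phase [th] lets the induction close: when the first coordinate [t] is split off,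
    [z ord0 ord0 * t] joins the phase of the remaining integral. *)
Lemma Rint_rho_cos d e (z : 'rV[R]_d) th : 0 < e ->
  \int[mu d]_x (rho e x * cos (dotp z x + th)) =
  cos th * \prod_i poisson e (z ord0 i).
Proof.
move=> e0; elim: d z th => [|d ih] z th.
  rewrite big_ord0 mulr1.
  (* In dimension [0], [Rint_prod] evaluates the integral of an empty product, that is, the mass of
     a point; its integrability hypothesis ranges over an empty type. *)
  have [ip Ip] := Rint_prod 0 (fun=> fun=> 0 : R)
    (fun i => match i with Ordinal _ p => match notF p with end end).
  transitivity (\int[mu 0]_x (cos th * \prod_(i < 0) (0 : R))).
    by apply: eq_Rintegral => x _; rewrite /rho /dotp !big_ord0 add0r mulrC.
  by rewrite RintZ// Ip big_ord0 mulr1.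
have irc n (w : 'rV[R]_n) s : Rintegrable (mu n) (fun x => rho e x * cos (dotp w x + s)).
  apply: (RintegrableM _ _ _ 1); first exact: Rintegrable_rho.
    apply: measurableT_comp; first exact: measurable_cosr.
    apply: measurable_funD; last exact: measurable_cst.
    exact: measurable_dotpr.
  by move=> x; exact: cos_norm_le1.
rewrite Rint_rV_cons//; set z' := \row_j z ord0 (lift ord0 j).
transitivity (\int[leb]_t ((\prod_i poisson e (z' ord0 i)) *
    (expR (- (e * `|t|)) * cos (z ord0 ord0 * t + th)))).
  apply: eq_Rintegral => t _.
  transitivity (\int[mu d]_y (expR (- (e * `|t|)) *
      (rho e y * cos (dotp z' y + (z ord0 ord0 * t + th))))).
    apply: eq_Rintegral => y _.
    rewrite mulrA dotp_cons /rho big_ord_recl rV_consE0; congr (_ * _ * cos _).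
      by apply: eq_bigr => i _; rewrite rV_consE.
    by rewrite -/z'; ring.
  by rewrite RintZ// ih; ring.
rewrite RintZ; last first.
  apply: (RintegrableM _ _ _ 1); first exact: (Rint_expRabs _ e0).1.
    apply: measurableT_comp; first exact: measurable_cosr.
    by apply: measurable_funD => //; exact: measurable_funM.
  by move=> t; exact: cos_norm_le1.
rewrite Rint_expRabs_cosD// big_ord_recl /poisson mulrCA; congr *%R.
by rewrite mulrC; congr *%R; apply: eq_bigr => i _; rewrite mxE.
Qed.

Lemma indic_obox d (a b : 'I_d -> R) (y : 'rV[R]_d) :
  \1_(obox a b) y = \prod_i \1_(`]a i, b i]%classic) (y ord0 i) :> R.
Proof.
rewrite indicE; have [yab|yab] := boolP (y \in obox a b).
  rewrite big1// => i _; rewrite indicE mem_set//.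
  by move: yab; rewrite inE => /(_ i).
apply/esym/eqP; rewrite prodf_seq_eq0; apply/hasP.
move: yab; rewrite notin_setE => /existsNP[i yi].
by exists i; rewrite ?mem_index_enum//= indicE memNset.
Qed.

Lemma Rintegrable_obox d (a b : 'I_d -> R) : Rintegrable (mu d) \1_(obox a b).
Proof.
rewrite (_ : \1_ _ = fun y : 'rV[R]_d => \prod_i \1_(`]a i, b i]%classic) (y ord0 i)).
  apply: (Rint_prod d (fun i => \1_(`]a i, b i]%classic) ) _).1 => i.
  exact: integrable_indic_itv.
by apply/funext => y; rewrite indic_obox.
Qed.

(** The real part of the integral of [(A + i B) exp (i <x, y>)]. Exchanging and negating the
    arguments yields imaginary parts and the transform with the opposite sign. *)
Definition trigint d (A B : 'rV[R]_d -> R) (y : 'rV[R]_d) : R :=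
  \int[mu d]_x (A x * cos (dotp x y) - B x * sin (dotp x y)).
Arguments trigint {d}.

Lemma measurable_cos_dotp d (y : 'rV[R]_d) :
  measurable_fun [set: 'rV[R]_d] (fun x => cos (dotp x y)).
Proof. by apply: measurableT_comp; [exact: measurable_cosr|exact: measurable_dotp]. Qed.

Lemma measurable_sin_dotp d (y : 'rV[R]_d) :
  measurable_fun [set: 'rV[R]_d] (fun x => sin (dotp x y)).
Proof. by apply: measurableT_comp; [exact: measurable_sinr|exact: measurable_dotp]. Qed.

Lemma Rintegrable_cos d (A : 'rV[R]_d -> R) y : Rintegrable (mu d) A ->
  Rintegrable (mu d) (fun x => A x * cos (dotp x y)).
Proof.
move=> iA; apply: (RintegrableM _ _ _ 1) => //; first exact: measurable_cos_dotp.
by move=> x; exact: cos_norm_le1.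
Qed.

Lemma Rintegrable_sin d (A : 'rV[R]_d -> R) y : Rintegrable (mu d) A ->
  Rintegrable (mu d) (fun x => A x * sin (dotp x y)).
Proof.
move=> iA; apply: (RintegrableM _ _ _ 1) => //; first exact: measurable_sin_dotp.
by move=> x; exact: sin_norm_le1.
Qed.

Lemma Rintegrable_trig d (A B : 'rV[R]_d -> R) y :
  Rintegrable (mu d) A -> Rintegrable (mu d) B ->
  Rintegrable (mu d) (fun x => A x * cos (dotp x y) - B x * sin (dotp x y)).
Proof.
by move=> iA iB; apply: RintegrableB; [exact: Rintegrable_cos|exact: Rintegrable_sin].
Qed.

Lemma trig_bound d (A B : 'rV[R]_d -> R) x y :
  `|A x * cos (dotp x y) - B x * sin (dotp x y)| <= `|A x| + `|B x|.
Proof.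
rewrite (le_trans (ler_normB _ _))// !normrM lerD// ler_piMr//.
  exact: cos_norm_le1.
exact: sin_norm_le1.
Qed.

Lemma Rintegrable_trig_prod d (w : 'rV[R]_d -> R) (A B : 'rV[R]_d -> R) :
  Rintegrable (mu d) w -> Rintegrable (mu d) A -> Rintegrable (mu d) B ->
  Rintegrable (mu d \x mu d)%E (fun z => w z.1 *
    (A z.2 * cos (dotp z.2 z.1) - B z.2 * sin (dotp z.2 z.1))).
Proof.
move=> iw iA iB.
have mA := Rintegrable_measurable _ _ iA; have mB := Rintegrable_measurable _ _ iB.
have mw := Rintegrable_measurable _ _ iw.
have md : measurable_fun [set: 'rV[R]_d * 'rV[R]_d] (fun z => dotp z.2 z.1).
  by under eq_fun do rewrite dotpC; exact: measurable_dotp2.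
apply: (Rintegrable_prod _ _ _ (fun y => `|w y|) (fun x => `|A x| + `|B x|)).
- apply: measurable_funM; first exact: measurableT_comp mw measurable_fst.
  apply: measurable_funB; apply: measurable_funM.
  + exact: measurableT_comp mA measurable_snd.
  + exact: measurableT_comp measurable_cosr md.
  + exact: measurableT_comp mB measurable_snd.
  + exact: measurableT_comp measurable_sinr md.
- exact: Rintegrable_norm.
- by apply: RintegrableD; exact: Rintegrable_norm.
- by move=> y x /=; rewrite normrM ler_wpM2l//; exact: trig_bound.
Qed.

Lemma measurable_trigint d (A B : 'rV[R]_d -> R) :
  Rintegrable (mu d) A -> Rintegrable (mu d) B ->
  measurable_fun [set: 'rV[R]_d] (trigint A B).
Proof.
move=> iA iB.
(* Fubini asks for an integrable weight in [y]; [rho 1] provides one and, being positive, is divided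
   out afterwards. *)
have /Rint_fubini_F[mf _] := Rintegrable_trig_prod _ _ _ _
  (Rintegrable_rho d _ (@ltr01 R)) iA iB.
have -> : trigint A B = (fun y => (\prod_i expR `|y ord0 i|) *
  \int[mu d]_x (rho 1 y * (A x * cos (dotp x y) - B x * sin (dotp x y)))).
  apply/funext => y; rewrite RintZ; last exact: Rintegrable_trig.
  rewrite mulrA /rho -big_split big1 ?mul1r// => i _ /=.
  by rewrite mul1r expRN mulfV// gt_eqF// expR_gt0.
apply: measurable_funM => //; apply: (measurable_prod_rV d (fun=> fun t => expR `|t|)) => i.
by apply: measurableT_comp => //; exact: measurable_expR.
Qed.

Lemma trigint_bound d (A B : 'rV[R]_d -> R) y :
  Rintegrable (mu d) A -> Rintegrable (mu d) B ->
  `|trigint A B y| <= \int[mu d]_x (`|A x| + `|B x|).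
Proof.
move=> iA iB; apply: Rint_norm_le.
- exact: Rintegrable_measurable (Rintegrable_trig _ _ _ _ iA iB).
- by apply: RintegrableD; exact: Rintegrable_norm.
- by move=> x; exact: trig_bound.
Qed.


Lemma Rint_box_poisson d e (a b : 'I_d -> R) (x : 'rV[R]_d) : 0 < e ->
  \int[mu d]_y (\1_(obox a b) y * \prod_i poisson e ((x - y) ord0 i)) =
  \prod_i poisson_itv e (a i) (b i) (x ord0 i).
Proof.
move=> e0.
rewrite -(eq_bigr _ (fun i _ => (Rint_poisson e (a i) (b i) (x ord0 i) e0).2)).
rewrite -(Rint_prod d _ (fun i => (Rint_poisson e (a i) (b i) (x ord0 i) e0).1)).2.
apply: eq_Rintegral => y _; rewrite indic_obox -big_split; apply: eq_bigr => i _.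
by rewrite !mxE.
Qed.

Lemma continuous_prod_poisson_measurable d e : 0 < e ->
  measurable_fun [set: 'rV[R]_d] (fun x => \prod_i poisson e (x ord0 i)).
Proof.
move=> e0; apply: (measurable_prod_rV d (fun=> poisson e)) => i.
by apply: continuous_measurable_fun; exact: continuous_poisson.
Qed.

(* Inserting the weight [rho e] in the inverse transform of
   [A + i B = \int (Gr + i Gi) e^{- i x xi}] turns it into a Poisson integral. *)
Lemma trigint_rho d e (Gr Gi : 'rV[R]_d -> R) y : 0 < e ->
  Rintegrable (mu d) Gr -> Rintegrable (mu d) Gi ->
  \int[mu d]_x (rho e x * (trigint Gr (fun z => - Gi z) x * cos (dotp x y) -
     trigint Gi Gr x * sin (dotp x y))) =
  \int[mu d]_x (Gr x * \prod_i poisson e ((x - y) ord0 i)).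
Proof.
move=> e0 ir ii.
have iN := RintegrableN _ _ ii.
have mr := Rintegrable_measurable _ _ ir; have mi := Rintegrable_measurable _ _ ii.
have irho := Rintegrable_rho d _ e0.
(* The phase [- pi / 2] writes a sine as a cosine, so that [Rint_rho_cos] evaluates both terms; its
   factor [cos th] then removes the term with [Gi]. *)
pose f (z : 'rV[R]_d * 'rV[R]_d) := rho e z.1 *
  (Gr z.2 * cos (dotp (z.2 - y) z.1 + 0) + Gi z.2 * cos (dotp (z.2 - y) z.1 - pi / 2)).
have itf : Rintegrable (mu d \x mu d)%E f.
  have md (s : R) : measurable_fun [set: 'rV[R]_d * 'rV[R]_d]
      (fun z => dotp (z.2 - y) z.1 + s).
    apply: measurable_funD; last exact: measurable_cst.
    have -> : (fun z : 'rV[R]_d * 'rV[R]_d => dotp (z.2 - y) z.1) =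
        (fun z => dotp z.1 z.2 - dotp z.1 y).
      by apply/funext => z; rewrite dotpDl dotpNl ![dotp z.1 _]dotpC.
    apply: measurable_funB; first exact: measurable_dotp2.
    exact: (measurableT_comp (measurable_dotp d y) measurable_fst).
  apply: (Rintegrable_prod _ _ _ (rho e) (fun x => `|Gr x| + `|Gi x|)) => //.
  - apply: measurable_funM; first exact: measurableT_comp (measurable_rho d e) measurable_fst.
    apply: measurable_funD; apply: measurable_funM.
    + exact: measurableT_comp mr measurable_snd.
    + exact: measurableT_comp measurable_cosr (md _).
    + exact: measurableT_comp mi measurable_snd.
    + exact: measurableT_comp measurable_cosr (md _).
  - by apply: RintegrableD; exact: Rintegrable_norm.
  - move=> x z; rewrite /f /= normrM ger0_norm ?rho_ge0// ler_wpM2l ?rho_ge0//.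
    rewrite (le_trans (ler_normD _ _))// !normrM lerD// ler_piMr//;
      exact: cos_norm_le1.
have -> : \int[mu d]_x (rho e x * (trigint Gr (fun z => - Gi z) x * cos (dotp x y) -
     trigint Gi Gr x * sin (dotp x y))) = \int[mu d]_x \int[mu d]_z f (x, z).
  apply: eq_Rintegral => x _.
  have i1 := Rintegrable_trig _ _ _ x ir iN.
  have i2 := Rintegrable_trig _ _ _ x ii ir.
  rewrite [X in _ * (X - _)]mulrC [X in _ * (_ - X)]mulrC /trigint.
  rewrite -(RintZ _ (cos (dotp x y)) _ i1) -(RintZ _ (sin (dotp x y)) _ i2).
  rewrite -RintB; [|exact: RintegrableZ..].
  rewrite -RintZ; last by apply: RintegrableB; exact: RintegrableZ.
  apply: eq_Rintegral => z _; rewrite /f /=; congr *%R.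
  rewrite addr0 dotpDl dotpNl [dotp x y]dotpC !cosB sinB cos_pihalf sin_pihalf.
  by ring.
rewrite Rint_fubini//; apply: eq_Rintegral => z _.
have irc s w : Rintegrable (mu d) (fun x => rho e x * cos (dotp w x + s)).
  apply: (RintegrableM _ _ _ 1) => //.
    apply: measurableT_comp; first exact: measurable_cosr.
    by apply: measurable_funD; [exact: measurable_dotpr|exact: measurable_cst].
  by move=> x; exact: cos_norm_le1.
transitivity (\int[mu d]_x (Gr z * (rho e x * cos (dotp (z - y) x + 0)) +
    Gi z * (rho e x * cos (dotp (z - y) x + - (pi / 2))))).
  by apply: eq_Rintegral => x _; rewrite /f /=; ring.
rewrite RintD; [|exact: RintegrableZ..]; rewrite !RintZ// !Rint_rho_cos//.
by rewrite cos0 cosN cos_pihalf; ring.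
Qed.

(** Averaging over a box turns the Poisson kernels into differences of arctangents, which are
    bounded uniformly in [e] and converge pointwise off the faces. *)
Lemma trigint_rho_box d e (Gr Gi : 'rV[R]_d -> R) (a b : 'I_d -> R) : 0 < e ->
  Rintegrable (mu d) Gr -> Rintegrable (mu d) Gi ->
  \int[mu d]_y (\1_(obox a b) y *
    \int[mu d]_x (rho e x * (trigint Gr (fun z => - Gi z) x * cos (dotp x y) -
     trigint Gi Gr x * sin (dotp x y)))) =
  \int[mu d]_x (Gr x * \prod_i poisson_itv e (a i) (b i) (x ord0 i)).
Proof.
move=> e0 ir ii; have mr := Rintegrable_measurable _ _ ir.
pose P (x : 'rV[R]_d) := \prod_i poisson e (x ord0 i).
have P_bound x : `|P x| <= (2 * e^-1) ^+ d.
  rewrite -[X in _ ^+ X](card_ord d) -prodr_const normr_prod; apply: ler_prod => i _.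
  rewrite normr_ge0 ger0_norm ?poisson_ge0// /poisson ler_wpM2l//.
  rewrite ler_pdivrMr; last by rewrite ltr_wpDr ?sqr_ge0// exprn_gt0.
  by rewrite mulrDr expr2 mulKf ?gt_eqF// lerDl mulr_ge0 ?sqr_ge0// invr_ge0 ltW.
have mP : measurable_fun setT P by exact: continuous_prod_poisson_measurable.
pose f (z : 'rV[R]_d * 'rV[R]_d) := \1_(obox a b) z.1 * (Gr z.2 * P (z.2 - z.1)).
have itf : Rintegrable (mu d \x mu d)%E f.
  apply: (Rintegrable_prod _ _ _ (\1_(obox a b)) (fun x => `|Gr x| * (2 * e^-1) ^+ d)).
  - apply: measurable_funM.
      apply: (measurableT_comp _ measurable_fst); apply: measurable_indic.
      exact: measurable_obox.
    apply: measurable_funM; first exact: measurableT_comp mr measurable_snd.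
    apply: (measurableT_comp mP); apply: measurable_fun_rVP => i.
    under eq_fun do rewrite !mxE.
    apply: measurable_funB.
      by apply: (measurableT_comp (measurable_coord i)); exact: measurable_snd.
    by apply: (measurableT_comp (measurable_coord i)); exact: measurable_fst.
  - exact: Rintegrable_obox.
  - under eq_fun do rewrite mulrC.
    by apply: RintegrableZ; exact: Rintegrable_norm.
  - move=> y x; rewrite /f /= normrM ger0_norm ?indicE ?ler0n// ler_wpM2l ?ler0n//.
    by rewrite normrM ler_wpM2l.
transitivity (\int[mu d]_y \int[mu d]_x f (y, x)).
  apply: eq_Rintegral => y _; rewrite trigint_rho// -RintZ//.
  apply: (RintegrableM _ _ _ ((2 * e^-1) ^+ d)) => //.
    apply: (measurableT_comp mP); apply: measurable_fun_rVP => i.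
    by under eq_fun do rewrite !mxE; apply: measurable_funD => //; exact: measurable_coord.
  by move=> x; exact: P_bound.
rewrite Rint_fubini//; apply: eq_Rintegral => x _.
rewrite -Rint_box_poisson// -RintZ.
  by apply: eq_Rintegral => y _; rewrite /f /= mulrCA.
apply: (RintegrableM _ _ _ ((2 * e^-1) ^+ d)).
- exact: Rintegrable_obox.
- apply: (measurableT_comp mP); apply: measurable_fun_rVP => i.
  by under eq_fun do rewrite !mxE; apply: measurable_funB => //; exact: measurable_coord.
- by move=> y; exact: P_bound.
Qed.

Lemma cvg_bigprod (I : finType) (P : pred I) (f : I -> nat -> R) (l : I -> R) :
  (forall i, P i -> f i n @[n --> \oo] --> l i) ->
  \prod_(i | P i) f i n @[n --> \oo] --> \prod_(i | P i) l i.
Proof.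
move=> fl; elim: (index_enum I) => [|i s ih].
  by rewrite big_nil; under eq_fun do rewrite big_nil; exact: cvg_cst.
rewrite big_cons; have [Pi|nPi] := boolP (P i); last first.
  by rewrite (_ : (fun n => _) = fun n => \prod_(j <- s | P j) f j n)//;
    apply/funext => n; rewrite big_cons (negbTE nPi).
rewrite (_ : (fun n => _) = fun n => f i n * \prod_(j <- s | P j) f j n).
  by apply: cvgM => //; exact: fl.
by apply/funext => n; rewrite big_cons Pi.
Qed.

Lemma cvg_rho d (x : 'rV[R]_d) : rho n.+1%:R^-1 x @[n --> \oo] --> (1 : R).
Proof.
rewrite /rho -[X in _ --> X](_ : \prod_(i < d) 1 = 1 :> R); last by rewrite big1.
apply: cvg_bigprod => i _.
rewrite -[X in _ --> X]expR0; apply: continuous_cvg; first exact: continuous_expR.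
rewrite -oppr0; apply: cvgN; rewrite -(mul0r `|x ord0 i|).
by apply: cvgM; [exact: cvg_harmonic|exact: cvg_cst].
Qed.

(** The two sides are compared through their integrals over boxes. Only the real part is stated; the
    imaginary part is the same statement for [- i (Gr + i Gi)]. *)
Theorem fourier_inversion d (Gr Gi A B : 'rV[R]_d -> R) :
  Rintegrable (mu d) Gr -> Rintegrable (mu d) Gi ->
  Rintegrable (mu d) A -> Rintegrable (mu d) B ->
  {ae mu d, forall x, trigint Gr (fun z => - Gi z) x = A x} ->
  {ae mu d, forall x, trigint Gi Gr x = B x} ->
  {ae mu d, forall x, (2 * pi) ^+ d * Gr x = trigint A B x}.
Proof.
move=> ir ii iA iB GA GB.
have iN := RintegrableN _ _ ii.
have mr := Rintegrable_measurable _ _ ir.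
have mA := Rintegrable_measurable _ _ iA; have mB := Rintegrable_measurable _ _ iB.
have mt := measurable_trigint _ _ _ iA iB.
pose M := \int[mu d]_x (`|A x| + `|B x|).
have itb a b : Rintegrable (mu d) (fun y => \1_(obox a b) y * trigint A B y).
  apply: (RintegrableM _ _ _ M) => //; first exact: Rintegrable_obox.
  by move=> y; exact: trigint_bound.
have irb a b : Rintegrable (mu d) (fun y => (2 * pi) ^+ d * (Gr y * \1_(obox a b) y)).
  apply: RintegrableZ; apply: (RintegrableM _ _ _ 1) => //.
    by apply: measurable_indic; exact: measurable_obox.
  by move=> x; rewrite indicE; case: (_ \in _); rewrite ?normr1 ?normr0.
suff H : {ae mu d, forall x, (2 * pi) ^+ d * Gr x - trigint A B x = 0}.
  by apply: filterS H => x /eqP; rewrite subr_eq0 => /eqP.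
have E a b : (fun x => ((2 * pi) ^+ d * Gr x - trigint A B x) * \1_(obox a b) x) =
   (fun x => (2 * pi) ^+ d * (Gr x * \1_(obox a b) x) - \1_(obox a b) x * trigint A B x).
  by apply/funext => x; ring.
apply: box_uniqueness.
- by apply: measurable_funB => //; exact: measurable_funM.
- by move=> n; rewrite E; exact: RintegrableB.
move=> a b; rewrite E RintB//; apply/eqP; rewrite subr_eq0; apply/eqP.
rewrite RintZ; last first.
  apply: (RintegrableM _ _ _ 1) => //; first by apply: measurable_indic; exact: measurable_obox.
  by move=> x; rewrite indicE; case: (_ \in _); rewrite ?normr1 ?normr0.
have e0 n : (0 : R) < n.+1%:R^-1 by rewrite invr_gt0.
(* Both sides are the limit of the same sequence of Poisson integrals. *)
have lim1 : \int[mu d]_x (Gr x * \prod_i poisson_itv n.+1%:R^-1 (a i) (b i) (x ord0 i))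
    @[n --> \oo] --> (2 * pi) ^+ d * \int[mu d]_x (Gr x * \1_(obox a b) x).
  rewrite -RintZ; last first.
    apply: (RintegrableM _ _ _ 1) => //; first by apply: measurable_indic; exact: measurable_obox.
    by move=> x; rewrite indicE; case: (_ \in _); rewrite ?normr1 ?normr0.
  have mpi e : measurable_fun [set: 'rV[R]_d]
      (fun x => \prod_i poisson_itv e (a i) (b i) (x ord0 i)).
    apply: (measurable_prod_rV d (fun i => poisson_itv e (a i) (b i))) => i.
    rewrite /poisson_itv; case: ltP => _ //.
    have matan : measurable_fun [set: R] (@atan R).
      by apply: continuous_measurable_fun => t; exact: continuous_atan.
    apply: measurable_funM => //; apply: measurable_funB;
      by apply: (measurableT_comp matan); apply: measurable_funM => //;
         exact: measurable_funB.
  apply: (Rint_dominated _ _ _ (fun x => `|Gr x| * (2 * pi) ^+ d)).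
  - by move=> n; apply: measurable_funM => //; exact: mpi.
  - by apply: (Rintegrable_measurable (mu d)); exact: irb.
  - by under eq_fun do rewrite mulrC; apply: RintegrableZ; exact: Rintegrable_norm.
  - move=> n x; rewrite normrM ler_wpM2l// normr_prod.
    rewrite -[X in _ ^+ X](card_ord d) -prodr_const; apply: ler_prod => i _.
    by rewrite normr_ge0 poisson_itv_bound.
  - have : {ae mu d, forall x : 'rV[R]_d, forall i, x ord0 i != a i /\ x ord0 i != b i}.
      apply: filter_forall => i; near=> x; split; near: x; exact: null_hyperplane.
    apply: filterS => x xab.
    rewrite mulrCA; apply: cvgM; first exact: cvg_cst.
    rewrite indic_obox -[X in _ ^+ X](card_ord d) -prodr_const -big_split /=.
    by apply: cvg_bigprod => i _; apply: cvg_poisson_itv; have [] := xab i.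
have lim2 : \int[mu d]_x (Gr x * \prod_i poisson_itv n.+1%:R^-1 (a i) (b i) (x ord0 i))
    @[n --> \oo] --> \int[mu d]_y (\1_(obox a b) y * trigint A B y).
  pose F n y := trigint (fun x => rho n.+1%:R^-1 x * A x) (fun x => rho n.+1%:R^-1 x * B x) y.
  have irA n (C : 'rV[R]_d -> R) : Rintegrable (mu d) C ->
      Rintegrable (mu d) (fun x => rho n.+1%:R^-1 x * C x).
    move=> iC; under eq_fun do rewrite mulrC.
    apply: (RintegrableM _ _ _ 1) => //; first exact: measurable_rho.
    by move=> x; rewrite ger0_norm ?rho_ge0// rho_le1// ltW.
  have -> : (fun n => \int[mu d]_x (Gr x * \prod_i poisson_itv n.+1%:R^-1 (a i) (b i) (x ord0 i))) =
      (fun n => \int[mu d]_y (\1_(obox a b) y * F n y)).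
    apply/funext => n; rewrite -(trigint_rho_box _ _ _ _ _ _ (e0 n) ir ii).
    apply: eq_Rintegral => y _; congr *%R; apply: Rint_ae_eq.
    - apply: measurable_funM; first exact: measurable_rho.
      apply: measurable_funB; apply: measurable_funM.
      + exact: measurable_trigint.
      + exact: measurable_cos_dotp.
      + exact: measurable_trigint.
      + exact: measurable_sin_dotp.
    - by apply: Rintegrable_measurable; apply: Rintegrable_trig; exact: irA.
    - near=> x.
      have -> : trigint Gr (fun z => - Gi z) x = A x by near: x.
      have -> : trigint Gi Gr x = B x by near: x.
      by ring.
  have F_bound n y : `|F n y| <= M.
    rewrite (le_trans (trigint_bound _ _ _ _ (irA _ _ iA) (irA _ _ iB)))//.
    apply: le_Rintegral => //.
    - by apply: RintegrableD; apply: Rintegrable_norm; exact: irA.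
    - by apply: RintegrableD; exact: Rintegrable_norm.
    - move=> x _; rewrite !normrM (ger0_norm (rho_ge0 _ _ _)).
      by rewrite lerD// ler_piMl// rho_le1// ltW.
  apply: (Rint_dominated _ _ _ (fun y => \1_(obox a b) y * M)).
  - move=> n; apply: measurable_funM; first by apply: measurable_indic; exact: measurable_obox.
    by apply: measurable_trigint; exact: irA.
  - by apply: (Rintegrable_measurable (mu d)); exact: itb.
  - by under eq_fun do rewrite mulrC; apply: RintegrableZ; exact: Rintegrable_obox.
  - move=> n y; rewrite normrM ger0_norm ?indicE ?ler0n// ler_wpM2l ?ler0n//.
  - apply: aeW => y; apply: cvgM; first exact: cvg_cst.
    apply: (Rint_dominated _ _ _ (fun x => `|A x| + `|B x|)).
    + move=> n; apply: (Rintegrable_measurable (mu d)).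
      by apply: Rintegrable_trig; exact: irA.
    + by apply: (Rintegrable_measurable (mu d)); exact: Rintegrable_trig.
    + by apply: RintegrableD; exact: Rintegrable_norm.
    + move=> n x; rewrite (le_trans (trig_bound d (fun x => rho n.+1%:R^-1 x * A x)
        (fun x => rho n.+1%:R^-1 x * B x) x y))// !normrM.
      rewrite (ger0_norm (rho_ge0 _ _ _)).
      by rewrite lerD// ler_piMl// rho_le1// ltW.
    + apply: aeW => x; apply: cvgB; apply: cvgM; try exact: cvg_cst.
        rewrite -[X in _ --> X]mul1r; apply: cvgM; [exact: cvg_rho|exact: cvg_cst].
      rewrite -[X in _ --> X]mul1r; apply: cvgM; [exact: cvg_rho|exact: cvg_cst].
exact: cvg_unique lim1 lim2.
Unshelve. all: by end_near. Qed.

End fourier_inversion.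
Arguments rho {R d}.
Arguments trigint {R d}.

(** * Smooth and compactly supported functions *)

Section smooth_toolkit.
Context {R : realType} {d : nat}.
Implicit Types (f g h : 'rV[R]_d -> R) (x y : 'rV[R]_d) (i j : 'I_d).
Local Notation e_ i := (delta_mx ord0 i : 'rV[R]_d).
Local Notation mu := (lebesgue_rV R d).

Lemma iter_partial_rcons s i g :
  iter_partial (rcons s i) g = iter_partial s (partial i g).
Proof. by rewrite /iter_partial foldr_rcons. Qed.

Lemma smooth_continuous g : smooth g -> continuous g.
Proof. by move=> /(_ [::])[]. Qed.

Lemma smooth_is_derive g i x : smooth g -> is_derive x (e_ i) g (partial i g x).
Proof. by move=> /(_ [::])[_ /(_ i x) dg]; exact: derivableP. Qed.

Lemma smooth_partial i g : smooth g -> smooth (partial i g).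
Proof. by move=> sg s; rewrite -iter_partial_rcons; exact: sg. Qed.

(** [smooth] quantifies over all words of derivatives. This principle asks instead for a class of
    continuous functions whose first partial derivatives exist and stay in the class. *)
Lemma smooth_coind (P : ('rV[R]_d -> R) -> Prop) :
  (forall g, P g -> continuous g /\
    forall i, exists2 g', P g' & forall x, is_derive x (e_ i) g (g' x)) ->
  forall g, P g -> smooth g.
Proof.
move=> HP g Pg s; suff Ps : P (iter_partial s g).
  have [cg dg] := HP _ Ps; split => // i x.
  by have [g' _ /(_ x) []] := dg i.
elim: s => //= i s /HP[_ /(_ i)[g' Pg' dg']].
suff -> : partial i (iter_partial s g) = g' by [].
by apply/funext => x; have [_ <-] := dg' x.
Qed.

Lemma partialE i g g' : (forall x, is_derive x (e_ i) g (g' x)) -> partial i g = g'.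
Proof. by move=> dg; apply/funext => x; have [_] := dg x. Qed.

(** Inverses are generated only from functions already known to be smooth: the derivative of [1 / g]
    is [- g' / g ^ 2], a product of generated functions. *)
Inductive smooth_gen : ('rV[R]_d -> R) -> Prop :=
| SmoothBase g : smooth g -> smooth_gen g
| SmoothAdd g h : smooth_gen g -> smooth_gen h -> smooth_gen (fun x => g x + h x)
| SmoothMul g h : smooth_gen g -> smooth_gen h -> smooth_gen (fun x => g x * h x)
| SmoothInv g : smooth g -> (forall x, g x != 0) -> smooth_gen (fun x => (g x)^-1).

Lemma smooth_gen_smooth g : smooth_gen g -> smooth g.
Proof.
move: g; apply: smooth_coind => g; elim => {g} [g sg|g h _ [cg dg] _ [ch dh]|
  g h Pg [cg dg] Ph [ch dh]|g sg g0].
- split; first exact: smooth_continuous.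
  move=> i; exists (partial i g) => [|x]; last exact: smooth_is_derive.
  by apply: SmoothBase; exact: smooth_partial.
- split=> [x|i]; first exact: (cvgD (cg x) (ch x)).
  have [g' Pg' dg'] := dg i; have [h' Ph' dh'] := dh i.
  by exists (fun x => g' x + h' x) => [|x]; [exact: SmoothAdd|exact: is_derive_add].
- split=> [x|i]; first exact: (cvgM (cg x) (ch x)).
  have [g' Pg' dg'] := dg i; have [h' Ph' dh'] := dh i.
  exists (fun x => g' x * h x + g x * h' x) => [|x]; last exact: is_derive_mul.
  by apply: SmoothAdd; exact: SmoothMul.
- split=> [x|i]; first exact: (cvgV (g0 x) (smooth_continuous _ sg x)).
  exists (fun x => (- partial i g x) * ((g x)^-1 * (g x)^-1)) => [|x].
    apply: SmoothMul; last by apply: SmoothMul; exact: SmoothInv.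
    apply: SmoothBase; have := smooth_lin (-1) 0 (smooth_partial i _ sg) (smooth_partial i _ sg).
    by congr smooth; apply/funext => x; rewrite mulN1r mul0r addr0.
  apply: (is_derive_eq (is_derive_inv (smooth_is_derive _ i x sg) (g0 x))).
  by rewrite expr2 invfM; ring.
Qed.

Lemma smoothD g h : smooth g -> smooth h -> smooth (fun x => g x + h x).
Proof.
by move=> sg sh; apply: smooth_gen_smooth; apply: SmoothAdd; exact: SmoothBase.
Qed.

Lemma smoothM g h : smooth g -> smooth h -> smooth (fun x => g x * h x).
Proof.
by move=> sg sh; apply: smooth_gen_smooth; apply: SmoothMul; exact: SmoothBase.
Qed.

Lemma smoothV g : smooth g -> (forall x, g x != 0) -> smooth (fun x => (g x)^-1).
Proof. by move=> sg g0; apply: smooth_gen_smooth; exact: SmoothInv. Qed.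

Lemma smooth_cst (c : R) : smooth (fun _ : 'rV[R]_d => c).
Proof.
apply: (smooth_coind (fun g => exists c, g = fun=> c)) => [_ [b ->]|]; last by exists c.
split=> [|i]; first exact: cst_continuous.
by exists (fun=> 0) => [|x]; [exists 0|exact: is_derive_const].
Qed.

Lemma smoothN g : smooth g -> smooth (fun x => - g x).
Proof.
move=> sg; under eq_fun do rewrite -mulN1r.
exact: (smoothM (fun=> -1) g (smooth_cst _) sg).
Qed.

Lemma smoothB g h : smooth g -> smooth h -> smooth (fun x => g x - h x).
Proof. by move=> sg sh; exact: (smoothD g (fun x => - h x) sg (smoothN _ sh)). Qed.

Lemma smoothX g n : smooth g -> smooth (fun x => g x ^+ n).
Proof.
move=> sg; elim: n => [|n ih]; first exact: smooth_cst.
by under eq_fun do rewrite exprS; exact: (smoothM g _ sg ih).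
Qed.

Lemma smooth_prod (I : Type) (s : seq I) (F : I -> 'rV[R]_d -> R) :
  (forall k, smooth (F k)) -> smooth (fun x => \prod_(k <- s) F k x).
Proof.
move=> sF; elim: s => [|i s ih].
  by under eq_fun do rewrite big_nil; exact: smooth_cst.
by under eq_fun do rewrite big_cons; exact: (smoothM (F i) _ (sF i) ih).
Qed.

Lemma is_derive_coord i j x :
  is_derive x (e_ i) (fun y : 'rV[R]_d => y ord0 j) (i == j)%:R.
Proof.
apply: is_derive_lineW.
rewrite (_ : (fun r => _) = fun r : R => r * (i == j)%:R + x ord0 j); last first.
  by apply/funext => h; rewrite !mxE eqxx [j == i]eq_sym.
by apply: is_derive_eq; rewrite /GRing.scale /=; ring.
Qed.

Lemma continuous_coord j : continuous (fun y : 'rV[R]_d => y ord0 j).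
Proof. exact: coord_continuous. Qed.

Lemma smooth_coord j : smooth (fun y : 'rV[R]_d => y ord0 j).
Proof.
apply: (smooth_coind (fun g => g = (fun y => y ord0 j) \/ exists c, g = fun=> c));
  last by left.
move=> _ [->|[c ->]].
- split=> [|i]; first exact: continuous_coord.
  exists (fun=> (i == j)%:R) => [|x]; last exact: is_derive_coord.
  by right; exists (i == j)%:R.
- split=> [|i]; first exact: cst_continuous.
  by exists (fun=> 0) => [|x]; [right; exists 0|exact: is_derive_const].
Qed.

Lemma smooth_monomial t : smooth (@monomial R d t).
Proof. by apply: smooth_prod => i; exact: smooth_coord. Qed.

Definition supported (L : R) g := forall x i, L < `|x ord0 i| -> g x = 0.

Lemma supportedMr (L : R) g h : supported L g -> supported L (fun x => g x * h x).
Proof. by move=> sg x i xi; rewrite (sg _ i)// mul0r. Qed.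

Lemma supportedMl (L : R) g h : supported L g -> supported L (fun x => h x * g x).
Proof. by move=> sg x i xi; rewrite (sg _ i)// mulr0. Qed.

(** Derivatives are local: the condition [L < |x_j|] persists on a short piece of the line through
    [x], where [g] therefore vanishes. *)
Lemma supported_is_derive (L : R) g g' i : supported L g ->
  (forall x, is_derive x (e_ i) g (g' x)) -> supported L g'.
Proof.
move=> sg dg x j xj; have [_ <-] := dg x; rewrite derive_line.
rewrite -[RHS](derive_cst (0 : R) (0 : R) (1 : R)); apply: near_eq_derive => //.
have : (fun r : R => `|(r *: e_ i + x) ord0 j|) @ (0 : R) --> `|x ord0 j|.
  apply: cvg_norm; rewrite -[X in _ --> X]add0r -[X in _ --> X + _](mul0r ((e_ i) ord0 j)).
  rewrite (_ : (fun r => _) = (fun r : R => r * e_ i ord0 j + x ord0 j)); last first.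
    by apply/funext => h; rewrite !mxE.
  by apply: cvgD; [apply: cvgM; [exact: cvg_id|exact: cvg_cst]|exact: cvg_cst].
move=> /cvgr_gt /(_ _ xj); apply: filterS => r /= hx.
exact: sg hx.
Qed.

Lemma supported_partial (L : R) g i : smooth g -> supported L g -> supported L (partial i g).
Proof. by move=> sg; move/supported_is_derive; apply => x; exact: smooth_is_derive. Qed.

Lemma supported_dichotomy (L : R) g x : supported L g ->
  (forall i, `|x ord0 i| <= L) \/ g x = 0.
Proof.
move=> sg; have [/forallP xL|] := boolP [forall i, `|x ord0 i| <= L]; first by left.
rewrite negb_forall => xL; right.
have [k] := existsP xL; rewrite -ltNge; exact: sg.
Qed.

Lemma supported_bounded (L : R) g : continuous g -> supported L g ->
  exists2 C, 0 <= C & forall x, `|g x| <= C.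
Proof.
move=> cg sg.
pose K := [set v : 'rV[R]_d | forall i, `[(- L), L]%classic (v ord0 i)].
have cK : compact K.
  by apply: (@rV_compact _ _ (fun=> `[(- L), L]%classic)) => i; exact: segment_compact.
have inK x : (forall i, `|x ord0 i| <= L) -> K x.
  by move=> xL i; rewrite /= in_itv /= -ler_norml.
have [K0|/set0P K0] := eqVneq K set0.
  exists 0 => // x; have [/inK|->] := supported_dichotomy _ _ x sg.
    by rewrite K0.
  by rewrite normr0.
have [c _ cmax] := EVT_max_rV (f := fun x => `|g x|) K0 cK
   (continuous_subspaceT (fun x => cvg_norm (cg x))).
exists `|g c| => // x; have [/inK Kx|->] := supported_dichotomy _ _ x sg.
  by apply: cmax; rewrite inE.
by rewrite normr0.
Qed.

(** The margin [1] places the closed cube of half-side [L] inside a half-open box. *)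
Definition cube (L : R) := obox (fun _ : 'I_d => - (L + 1)) (fun=> L + 1).

Lemma supported_cube (L : R) g (C : R) : 0 <= C -> supported L g ->
  (forall x, (forall i, `|x ord0 i| <= L) -> `|g x| <= C) ->
  forall x, `|g x| <= C * \1_(cube L) x.
Proof.
move=> C0 sg gC x; have [xL|->] := supported_dichotomy _ _ x sg; last first.
  by rewrite normr0 mulr_ge0// indicE.
rewrite indicE mem_set ?mulr1//; first exact: gC.
move=> i /=; rewrite in_itv /=; move: (xL i); rewrite ler_norml => /andP[? ?].
by apply/andP; split; lra.
Qed.

Lemma Rintegrable_cube (L C : R) : Rintegrable mu (fun x => C * \1_(cube L) x).
Proof. by apply: RintegrableZ; exact: Rintegrable_obox. Qed.

Lemma Rintegrable_supported (L : R) g : continuous g -> supported L g -> Rintegrable mu g.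
Proof.
move=> cg sg; have [C C0 gC] := supported_bounded _ _ cg sg.
apply: (Rintegrable_dom _ _ (fun x => C * \1_(cube L) x)).
- exact: continuous_measurable_rV.
- exact: Rintegrable_cube.
- by apply: supported_cube => // x _.
Qed.

End smooth_toolkit.

Lemma Rint_zero {dT} {T : measurableType dT} {R : realType} (mu : {measure set T -> \bar R}) :
  \int[mu]_x 0 = 0 :> R.
Proof. by rewrite /Rintegral integral0. Qed.

(** * Integration by parts *)

Section integration_by_parts.
Context {R : realType}.
Local Notation leb := (@lebesgue_measure R).

Lemma Rint_derive0 (f f' : R -> R) (L : R) : (forall t, is_derive (t : R) (1 : R) f (f' t)) ->
  continuous f' -> (forall t, L < `|t| -> f t = 0) -> (forall t, L < `|t| -> f' t = 0) ->
  \int[leb]_t f' t = 0.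
Proof.
(* [K] exceeds both [L] and [0], so [f] vanishes at the two ends of [[-K, K]]. *)
move=> df cf' fL f'L; pose K := `|L| + 1.
have LK : L < K by rewrite /K (le_lt_trans (ler_norm _))// ltrDl.
have K0 : 0 < K by rewrite /K ltr_wpDl.
have cf := is_derive_continuous _ _ df.
have E : (\int[leb]_t (f' t)%:E = 0)%E.
  transitivity (\int[leb]_(t in `[(- K)%R, K]) (f' t)%:E)%E.
    rewrite [RHS]integral_mkcond; apply: eq_integral => t _.
    rewrite /patch /=; case: ifPn => //; rewrite notin_setE /= in_itv /= -ler_norml => /negP.
    by rewrite -ltNge => Kt; rewrite f'L// (lt_trans LK).
  rewrite (@continuous_FTC2 _ _ f)//.
  - rewrite !fL ?subee// ?normrN ger0_norm// ltW//.
  - by rewrite gtrN.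
  - exact: continuous_subspaceT.
  - split.
    + by move=> t _; have [] := df t.
    + by apply: cvg_at_right_filter; exact: cf.
    + by apply: cvg_at_left_filter; exact: cf.
  - by move=> t _; rewrite derive1E; have [] := df t.
by rewrite /Rintegral E.
Qed.

Lemma rV_cons_line0 d (t h : R) (y : 'rV[R]_d) :
  rV_cons ((h *: 1 + t : R) : measurableTypeR R, y) =
  h *: delta_mx ord0 ord0 + rV_cons (t : measurableTypeR R, y).
Proof.
apply: rV_eq => i.
rewrite [RHS]mxE [X in _ = X + _]mxE [X in _ = _ * X + _]mxE; case: (unliftP ord0 i) => [j ->|->].
  by rewrite !rV_consE /= mulr0 add0r.
by rewrite !rV_consE0 /=.
Qed.

Lemma rV_cons_line d (t h : R) (y : 'rV[R]_d) j :
  rV_cons (t : measurableTypeR R, h *: delta_mx ord0 j + y) =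
  h *: delta_mx ord0 (lift ord0 j) + rV_cons (t : measurableTypeR R, y).
Proof.
apply: rV_eq => i.
rewrite [RHS]mxE [X in _ = X + _]mxE [X in _ = _ * X + _]mxE; case: (unliftP ord0 i) => [k ->|->].
  by rewrite !rV_consE !mxE /= (inj_eq lift_inj).
by rewrite !rV_consE0 /= mulr0 add0r.
Qed.

(** Induction on slices: for a later coordinate the inner integrals vanish by induction, and for the
    first one Fubini moves its integral inside, where the fundamental theorem of calculus
    applies. *)
Lemma Rint_partial0 d (f f' : 'rV[R]_d -> R) (L : R) i :
  (forall x, is_derive x (delta_mx ord0 i) f (f' x)) ->
  continuous f -> continuous f' -> supported L f ->
  \int[lebesgue_rV R d]_x f' x = 0.
Proof.
elim: d f f' i => [? ? []//|d ih] f f' i df cf cf' sf.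
have sf' := supported_is_derive _ _ _ _ sf df.
have if' := Rintegrable_supported _ _ cf' sf'.
have cc1 (y : 'rV[R]_d) : continuous (fun t : R => rV_cons (t : measurableTypeR R, y)).
  apply: continuous_rV => k; case: (unliftP ord0 k) => [j ->|->] t.
    by under eq_fun do rewrite rV_consE; exact: cvg_cst.
  by under eq_fun do rewrite rV_consE0; exact: cvg_id.
have cc2 (t : R) : continuous (fun y : 'rV[R]_d => rV_cons (t : measurableTypeR R, y)).
  apply: continuous_rV => k; case: (unliftP ord0 k) => [j ->|->].
    by under eq_fun do rewrite rV_consE; exact: continuous_coord.
  rewrite (_ : (fun y => _) = fun=> t); first exact: cst_continuous.
  by apply/funext => y; rewrite rV_consE0.
rewrite Rint_rV_cons//; case: (unliftP ord0 i) => [j ij|i0].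
  rewrite -[RHS](Rint_zero (lebesgue_measure : {measure set (measurableTypeR R) -> \bar R})).
  apply: eq_Rintegral => t _.
  apply: (ih (fun y => f (rV_cons (t, y))) _ j).
  - move=> y; apply: is_derive_lineW; under eq_fun do rewrite rV_cons_line -ij.
    by apply: is_derive_line; exact: df.
  - by move=> y; apply: continuous_comp; [exact: cc2|exact: cf].
  - by move=> y; apply: continuous_comp; [exact: cc2|exact: cf'].
  - by move=> y k yk; apply: (sf _ (lift ord0 k)); rewrite rV_consE.
rewrite (Rint_fubini _ _ _ (Rintegrable_rV_consP _ _ if')).
rewrite -[RHS](Rint_zero (lebesgue_rV R d)); apply: eq_Rintegral => y _.
apply: (Rint_derive0 (fun t => f (rV_cons (t, y))) _ L).
- move=> t; apply: is_derive_lineW; under eq_fun do rewrite rV_cons_line0 -i0.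
  by apply: is_derive_line; exact: df.
- move=> t; exact: (@continuous_comp _ _ _
    (fun t : R => rV_cons (t : measurableTypeR R, y)) f' t (cc1 y t) (cf' _)).
- by move=> t tL; apply: (sf _ ord0); rewrite rV_consE0.
- by move=> t tL; apply: (sf' _ ord0); rewrite rV_consE0.
Qed.

End integration_by_parts.

(** * Transforms of test functions *)

Section cosine_transform.
Context {R : realType} {d : nat}.
Implicit Types (chi g : 'rV[R]_d -> R) (x y z : 'rV[R]_d) (th : R).
Local Notation e_ i := (delta_mx ord0 i : 'rV[R]_d).
Local Notation mu := (lebesgue_rV R d).

Definition test_fun chi := smooth chi /\ exists L, supported L chi.

Lemma test_smoothM g chi : smooth g -> test_fun chi -> test_fun (fun x => g x * chi x).
Proof.
move=> sg [sc [L cL]]; split; first exact: (smoothM g chi sg sc).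
by exists L; exact: supportedMl.
Qed.

Lemma test_partial i chi : test_fun chi -> test_fun (partial i chi).
Proof.
move=> [sc [L cL]]; split; first exact: smooth_partial.
by exists L; exact: supported_partial.
Qed.

Lemma test_iter_partial s chi : test_fun chi -> test_fun (iter_partial s chi).
Proof. by move=> tc; elim: s => //= i s; exact: test_partial. Qed.

Lemma testB chi1 chi2 : test_fun chi1 -> test_fun chi2 ->
  test_fun (fun x => chi1 x - chi2 x).
Proof.
move=> [s1 [L1 c1]] [s2 [L2 c2]]; split; first exact: (smoothB chi1 chi2 s1 s2).
exists (Num.max L1 L2) => x i; rewrite gt_max => /andP[x1 x2].
by rewrite (c1 _ i)// (c2 _ i)// subrr.
Qed.

Lemma test_integrable chi : test_fun chi -> Rintegrable mu chi.
Proof.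
by move=> [sc [L cL]]; apply: Rintegrable_supported cL; exact: smooth_continuous.
Qed.

(* The real and imaginary parts of the transform of a real function, and of all its
   derivatives, are of this form with [th] a multiple of [pi / 2]. *)
Definition costr th chi x : R := \int[mu]_z (chi z * cos (dotp z x + th)).

Lemma measurable_cos_dotpD th x :
  measurable_fun [set: 'rV[R]_d] (fun z => cos (dotp z x + th)).
Proof.
apply: measurableT_comp; first exact: measurable_cosr.
by apply: measurable_funD; [exact: measurable_dotp|exact: measurable_cst].
Qed.

Lemma Rintegrable_costr th chi x : Rintegrable mu chi ->
  Rintegrable mu (fun z => chi z * cos (dotp z x + th)).
Proof.
move=> ic; apply: (RintegrableM _ _ _ 1) => //; first exact: measurable_cos_dotpD.
by move=> z; exact: cos_norm_le1.
Qed.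

Lemma costr_bound th chi x : Rintegrable mu chi ->
  `|costr th chi x| <= \int[mu]_z `|chi z|.
Proof.
move=> ic; apply: Rint_norm_le.
- exact: Rintegrable_measurable (Rintegrable_costr _ _ _ ic).
- exact: Rintegrable_norm.
- by move=> z; rewrite normrM ler_piMr//; exact: cos_norm_le1.
Qed.

Lemma costrB th chi1 chi2 x : Rintegrable mu chi1 -> Rintegrable mu chi2 ->
  costr th (fun z => chi1 z - chi2 z) x = costr th chi1 x - costr th chi2 x.
Proof.
move=> i1 i2; rewrite /costr -RintB; try exact: Rintegrable_costr.
by apply: eq_Rintegral => z _; rewrite mulrBl.
Qed.

Lemma cosDpihalf t : cos (t + pi / 2) = - sin t :> R.
Proof. by rewrite cosD cos_pihalf sin_pihalf mulr0 mulr1 sub0r. Qed.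

Lemma sinDpihalf t : sin (t + pi / 2) = cos t :> R.
Proof. by rewrite sinD cos_pihalf sin_pihalf mulr0 mulr1 add0r. Qed.

Lemma cosBpihalf t : cos (t - pi / 2) = sin t :> R.
Proof. by rewrite cosB cos_pihalf sin_pihalf mulr0 mulr1 add0r. Qed.

Lemma dotp_line z (r : R) j x :
  dotp z (r *: e_ j + x) = z ord0 j * r + dotp z x.
Proof.
rewrite dotpC dotpDl [dotp x z]dotpC; congr (_ + _).
rewrite /dotp (bigD1 j)//= big1 ?addr0 => [|i ij]; rewrite !mxE ?eqxx ?mulr1 1?mulrC//.
by rewrite (negbTE ij) !mulr0.
Qed.

(** Differentiation under the integral sign along a line, with [|z_j chi z|] dominating the
    derivative of the integrand uniformly in the line parameter. *)
Lemma costr_is_derive th chi j x : test_fun chi ->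
  is_derive x (e_ j) (costr th chi) (costr (th + pi / 2) (fun z => z ord0 j * chi z) x).
Proof.
move=> tc; apply: is_derive_lineW.
pose f (r : R) z := chi z * cos (z ord0 j * r + (dotp z x + th)).
have E : (fun r => costr th chi (r *: e_ j + x)) = (fun r => \int[mu]_z f r z).
  apply/funext => r; apply: eq_Rintegral => z _.
  by rewrite /f dotp_line addrA.
rewrite E.
have ic := test_integrable _ tc.
have icj := test_integrable _ (test_smoothM _ _ (smooth_coord j) tc).
have df z r : is_derive (r : R) (1 : R) (f ^~ z)
    (z ord0 j * chi z * cos (z ord0 j * r + (dotp z x + th) + pi / 2)).
  apply: is_derive_eq; rewrite /GRing.scale/= cosDpihalf; ring.
have intf r : `](-1)%R, 1%R[%classic r -> mu.-integrable setT (EFin \o f r).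
  move=> _; have := Rintegrable_costr th chi (r *: e_ j + x) ic.
  by rewrite /Rintegrable; congr (_.-integrable _ _); apply/funext => z;
    rewrite /f /= dotp_line addrA.
have I0 : `](-1)%R, 1%R[%classic (0 : R) by rewrite /= in_itv /= ltrN10 ltr01.
have derf r z : `](-1)%R, 1%R[%classic r -> setT z -> derivable (f ^~ z) r 1.
  by move=> _ _; have [] := df z r.
have bnd r z : `](-1)%R, 1%R[%classic r -> setT z ->
    `|partial1of2 f r z| <= `|z ord0 j * chi z|.
  move=> _ _; rewrite partial1of2E; have [_ ->] := df z r.
  by rewrite normrM ler_piMr//; exact: cos_norm_le1.
have D := derivable_under_integral measurableT I0 intf derf
  (fun z => normr_ge0 _) (Rintegrable_norm _ _ icj) bnd.
have V := differentiation_under_integral measurableT I0 intf derf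
  (fun z => normr_ge0 _) (Rintegrable_norm _ _ icj) bnd.
apply: DeriveDef => //; rewrite -derive1E V; apply: eq_Rintegral => z _.
rewrite partial1of2E; have [_ ->] := df z 0.
by rewrite mulr0 add0r addrA.
Qed.

Lemma continuous_dotp x : continuous (fun z => dotp z x).
Proof.
rewrite /dotp; elim: (index_enum _) => [|i s ih].
  by under eq_fun do rewrite big_nil; exact: cst_continuous.
under eq_fun do rewrite big_cons; move=> z.
exact: (cvgD (cvgM (continuous_coord i z) (cvg_cst _)) (ih z)).
Qed.

(** The integral of the [j]-th derivative of [chi z * sin (dotp z x + th)] vanishes; the minus sign
    of the integration by parts is absorbed by the phase [pi / 2]. *)
Lemma costr_coord th chi j x : test_fun chi ->
  x ord0 j * costr th chi x = costr (th + pi / 2) (partial j chi) x.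
Proof.
move=> tc; have [sc [L cL]] := tc.
have ic := test_integrable _ tc; have ip := test_integrable _ (test_partial j _ tc).
have cc := smooth_continuous _ sc; have cp := smooth_continuous _ (smooth_partial j _ sc).
have cdot s : continuous (fun z => dotp z x + s).
  by move=> z; exact: (cvgD (continuous_dotp x z) (cvg_cst _)).
have csin : continuous (fun z => sin (dotp z x + th)).
  move=> z; apply: (@continuous_comp _ _ _ (fun z => dotp z x + th) (@sin R) z (cdot th z)).
  exact: continuous_sin.
have ccos s : continuous (fun z => cos (dotp z x + s)).
  move=> z; apply: (@continuous_comp _ _ _ (fun z => dotp z x + s) (@cos R) z (cdot s z)).
  exact: continuous_cos.
have dsin z : is_derive z (e_ j) (fun z => chi z * sin (dotp z x + th))
   (partial j chi z * sin (dotp z x + th) + chi z * (cos (dotp z x + th) * x ord0 j)).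
  apply: is_derive_mul; first exact: smooth_is_derive.
  have dd : is_derive z (e_ j) (fun z => dotp z x + th) (x ord0 j).
    apply: is_derive_lineW.
    rewrite (_ : (fun r => _) = (fun r : R => x ord0 j * r + (dotp x z + th))); last first.
      by apply/funext => r; rewrite dotpC dotp_line addrA.
    by apply: is_derive_eq; rewrite /GRing.scale /=; ring.
  exact: (is_derive_comp1 (@sin R) _ _ _ _ _ dd (is_derive_sin _)).
have := Rint_partial0 d _ _ L j dsin.
have -> : (fun z => partial j chi z * sin (dotp z x + th) +
    chi z * (cos (dotp z x + th) * x ord0 j)) =
   (fun z => x ord0 j * (chi z * cos (dotp z x + th)) -
     partial j chi z * cos (dotp z x + (th + pi / 2))).
  by apply/funext => z; rewrite addrA cosDpihalf; ring.
rewrite RintB; [|apply: RintegrableZ; exact: Rintegrable_costr|exact: Rintegrable_costr].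
rewrite RintZ; last exact: Rintegrable_costr.
move=> H; apply/eqP; rewrite -subr_eq0; apply/eqP; apply: H.
- by move=> z; exact: (cvgM (cc z) (csin z)).
- move=> z; exact: (cvgB (cvgM (cvg_cst _) (cvgM (cc z) (ccos th z)))
    (cvgM (cp z) (ccos (th + pi / 2) z))).
- exact: supportedMr.
Qed.

Lemma cos_lipschitz (a b : R) : `|cos a - cos b| <= `|a - b|.
Proof.
wlog ab : a b / a <= b.
  move=> H; have [|/ltW] := leP a b; first exact: H.
  by move/H; rewrite distrC [X in _ <= X]distrC.
have [c _ E] : exists2 c, c \in `[a, b]%R & cos b - cos a = - sin c * (b - a).
  apply: (MVT_segment ab).
  by apply: continuous_subspaceT => t; exact: continuous_cos.
rewrite distrC E distrC normrM normrN ler_piMl//; exact: sin_norm_le1.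
Qed.

Lemma dotp_norm z x : `|dotp z x| <= (\sum_i `|z ord0 i|) * `|x|.
Proof.
rewrite /dotp (le_trans (ler_norm_sum _ _ _))// mulr_suml ler_sum// => i _.
rewrite normrM ler_wpM2l//.
rewrite [X in _ <= X]/Num.norm /= mx_normrE.
exact: (le_bigmax 0 (fun ij : 'I_1 * 'I_d => `|x ij.1 ij.2|) (ord0, i)).
Qed.

Lemma continuous_costr th chi : test_fun chi -> continuous (costr th chi).
Proof.
move=> tc x; have ic := test_integrable _ tc.
(* Since the cosine is 1-Lipschitz, the integral of [w] is a Lipschitz constant for the
   transform. *)
pose w z := \sum_i `|z ord0 i * chi z|.
have iw : Rintegrable mu w.
  rewrite /w; elim: (index_enum _) => [|i s ih].
    under eq_fun do rewrite big_nil.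
    by have := RintegrableZ mu 0 _ ic; congr Rintegrable; apply/funext => z; rewrite mul0r.
  under eq_fun do rewrite big_cons; apply: RintegrableD => //; apply: Rintegrable_norm.
  by apply: test_integrable; exact: (test_smoothM _ _ (smooth_coord i) tc).
pose K := \int[mu]_z w z.
have lip y : `|costr th chi x - costr th chi y| <= K * `|x - y|.
  rewrite /costr -RintB; try exact: Rintegrable_costr.
  rewrite mulrC -RintZ//; apply: Rint_norm_le.
  - apply: (Rintegrable_measurable mu); apply: RintegrableB; exact: Rintegrable_costr.
  - exact: RintegrableZ.
  - move=> z; rewrite -mulrBr normrM.
    rewrite (le_trans (ler_wpM2l (normr_ge0 _) (cos_lipschitz _ _)))//.
    have -> : dotp z x + th - (dotp z y + th) = dotp z (x - y).
      by rewrite [RHS]dotpC dotpDl dotpNl ![dotp _ z]dotpC; ring.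
    rewrite (le_trans (ler_wpM2l (normr_ge0 _) (dotp_norm _ _)))//.
    rewrite mulrA mulrC ler_wpM2l// /w mulr_sumr ler_sum// => i _.
    by rewrite normrM mulrC.
have K0 : 0 <= K by apply: Rintegral_ge0 => z _; apply: sumr_ge0.
apply: (@cvg_trans _ (costr th chi @ nbhs (x : 'rV[R]_d))) => //.
apply/cvgrPdist_lt => e e0.
have e'0 : 0 < e / (K + 1) by rewrite divr_gt0// ltr_wpDl.
near=> y; apply: le_lt_trans (lip y) _.
have : `|x - y| < e / (K + 1).
  by near: y; have := nbhsx_ballx x _ e'0; rewrite -ball_normE.
rewrite ltr_pdivlMr ?ltr_wpDl// mulrDr mulr1 => H.
by apply: le_lt_trans H; rewrite mulrC lerDl.
Unshelve. all: by end_near. Qed.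

Lemma costr_smooth th chi : test_fun chi -> smooth (costr th chi).
Proof.
move=> tc; apply: (smooth_coind (fun g => exists th chi, test_fun chi /\ g = costr th chi));
  last by exists th, chi.
move=> _ [th' [chi' [tc' ->]]]; split=> [|j]; first exact: continuous_costr.
exists (costr (th' + pi / 2) (fun z => z ord0 j * chi' z)) => [|x]; last exact: costr_is_derive.
exists (th' + pi / 2), (fun z => z ord0 j * chi' z); split => //.
exact: (test_smoothM _ _ (smooth_coord j) tc').
Qed.

Lemma iter_partial_costr s th chi : test_fun chi ->
  iter_partial s (costr th chi) =
  costr (th + (size s)%:R * (pi / 2)) (fun z => monomial s z * chi z).
Proof.
move=> tc; elim: s => [|i s ih] /=.
  by rewrite mul0r addr0; congr costr; apply/funext => z; rewrite /monomial big_nil mul1r.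
rewrite ih; apply: partialE => x.
have := costr_is_derive (th + (size s)%:R * (pi / 2)) _ i x
  (test_smoothM _ _ (smooth_monomial s) tc).
congr is_derive; congr (costr _ _ x).
  by rewrite -natr1; ring.
by apply/funext => z; rewrite /monomial big_cons mulrA.
Qed.

Lemma monomial_costr t th chi x : test_fun chi ->
  monomial t x * costr th chi x =
  costr (th + (size t)%:R * (pi / 2)) (iter_partial t chi) x.
Proof.
move=> tc; elim: t => [|i t ih] /=.
  by rewrite mul0r addr0 /monomial big_nil mul1r.
rewrite /monomial big_cons -mulrA ih costr_coord; last exact: test_iter_partial.
by congr (costr _ _ x); rewrite -natr1; ring.
Qed.

(** Two integrations by parts add [pi] to the phase, hence the sign of the second derivative. *)
Lemma costr_sqr_coord th chi i x : test_fun chi ->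
  (1 + x ord0 i ^+ 2) * costr th chi x =
  costr th (fun z => chi z - partial i (partial i chi) z) x.
Proof.
move=> tc; have tp := test_partial i _ tc; have tpp := test_partial i _ tp.
rewrite mulrDl mul1r expr2 -mulrA !costr_coord// costrB; try exact: test_integrable.
congr +%R; rewrite /costr -RintN; last exact: Rintegrable_costr (test_integrable _ tpp).
by apply: eq_Rintegral => z _; rewrite 2!addrA cosDpihalf sinDpihalf mulrN.
Qed.

(* [\prod_(i <- s) (1 - d_i^2) chi], whose cosine transform is that of [chi] times
   [\prod_(i <- s) (1 + x_i^2)]. *)
Definition one_sub_sqr_partials (s : seq 'I_d) chi :=
  foldr (fun i g => fun z => g z - partial i (partial i g) z) chi s.

Lemma test_one_sub_sqr_partials s chi : test_fun chi ->
  test_fun (one_sub_sqr_partials s chi).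
Proof.
move=> tc; elim: s => //= i s tcs; apply: testB => //.
by do 2 apply: test_partial.
Qed.

Lemma costr_one_sub_sqr s th chi x : test_fun chi ->
  \prod_(i <- s) (1 + x ord0 i ^+ 2) * costr th chi x =
  costr th (one_sub_sqr_partials s chi) x.
Proof.
move=> tc; elim: s => [|i s ih] /=; first by rewrite big_nil mul1r.
rewrite big_cons -mulrA ih costr_sqr_coord//; exact: test_one_sub_sqr_partials.
Qed.

(** The exponent [2] makes every factor integrable on the line while staying polynomial, so that
    multiplication by [1 / weight] is a differential operator on the transform side. *)
Definition weight x : R := \prod_i (1 + x ord0 i ^+ 2)^-1.

Lemma Rintegrable_weight : Rintegrable mu weight.
Proof.
by have [] := Rint_prod d (fun=> fun t : R => (1 + t ^+ 2)^-1) (fun=> Rintegrable_oneDsqrV).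
Qed.

Lemma prod_sqr_gt0 x : 0 < \prod_i (1 + x ord0 i ^+ 2).
Proof. by apply: prodr_gt0 => i _; rewrite ltr_wpDr// sqr_ge0. Qed.

Lemma weightE x : weight x = (\prod_i (1 + x ord0 i ^+ 2))^-1.
Proof. by rewrite /weight prodfV. Qed.

Lemma weight_gt0 x : 0 < weight x.
Proof. by rewrite weightE invr_gt0 prod_sqr_gt0. Qed.

Lemma weight_le1 x : weight x <= 1.
Proof.
apply: prodr_ile1 => i _; rewrite invr_ge0 addr_ge0 ?sqr_ge0//=.
by rewrite invf_le1 ?ltr_wpDr ?sqr_ge0// lerDl sqr_ge0.
Qed.

Definition test_norm chi : R := \int[mu]_z `|one_sub_sqr_partials (index_enum 'I_d) chi z|.

Lemma costr_weight_bound th chi x : test_fun chi ->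
  `|costr th chi x| <= test_norm chi * weight x.
Proof.
move=> tc; rewrite weightE ler_pdivlMr ?prod_sqr_gt0//.
rewrite -[X in _ * X](gtr0_norm (prod_sqr_gt0 x)) -normrM mulrC costr_one_sub_sqr//.
by apply: costr_bound; apply: test_integrable; exact: test_one_sub_sqr_partials.
Qed.

Lemma Rintegrable_costr_fun th chi : test_fun chi -> Rintegrable mu (costr th chi).
Proof.
move=> tc; apply: (Rintegrable_dom _ _ (fun x => test_norm chi * weight x)).
- by apply: continuous_measurable_rV; exact: continuous_costr.
- by apply: RintegrableZ; exact: Rintegrable_weight.
- by move=> x; exact: costr_weight_bound.
Qed.

End cosine_transform.

Local Open Scope complex_scope.

(** * Schwartz functions and multipliers *)

Section complex_norm.
Context {R : realType}.
Implicit Types z w : R[i].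
Local Notation normc := (@Normc.normc R).

Lemma norm_normc z : `|z| = (normc z)%:C.
Proof. by rewrite normc_def; case: z. Qed.

Lemma normc_ge0 z : 0 <= normc z.
Proof. by case: z => a b; exact: sqrtr_ge0. Qed.

Lemma Re_normc z : `|complex.Re z| <= normc z.
Proof. by rewrite -lecR -norm_normc; exact: normc_ge_Re. Qed.

Lemma Im_normc z : `|complex.Im z| <= normc z.
Proof.
case: z => a b /=; rewrite -(sqrtr_sqr b) ler_wsqrtr// lerDr sqr_ge0//.
Qed.

Lemma normc_le_Re_Im z : normc z <= `|complex.Re z| + `|complex.Im z|.
Proof.
case: z => a b /=; rewrite -[X in _ <= X]ger0_norm ?addr_ge0// -sqrtr_sqr.
by rewrite ler_wsqrtr// sqrrD !real_normK ?num_real// addrAC lerDl mulrn_wge0// mulr_ge0.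
Qed.

Lemma complexReM z w : complex.Re (z * w) =
  complex.Re z * complex.Re w - complex.Im z * complex.Im w.
Proof. by case: z w => [? ?] [? ?]. Qed.

Lemma complexImM z w : complex.Im (z * w) =
  complex.Re z * complex.Im w + complex.Im z * complex.Re w.
Proof. by case: z w => [? ?] [? ?]. Qed.

Lemma complexReD z w : complex.Re (z + w) = complex.Re z + complex.Re w.
Proof. by case: z w => [? ?] [? ?]. Qed.

Lemma complexImD z w : complex.Im (z + w) = complex.Im z + complex.Im w.
Proof. by case: z w => [? ?] [? ?]. Qed.

Lemma complex_eq z w : complex.Re z = complex.Re w ->
  complex.Im z = complex.Im w -> z = w.
Proof. by case: z w => [? ?] [? ?] /= -> ->. Qed.

End complex_norm.

Section schwartz_functions.
Context {R : realType} {d : nat}.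
Local Notation Re := (@complex.Re R).
Local Notation Im := (@complex.Im R).
Local Notation mu := (lebesgue_rV R d).
Local Notation S := (schwartz R d).
Local Notation normc := (@Normc.normc R).
Implicit Types (chi : 'rV[R]_d -> R) (x y xi : 'rV[R]_d) (phi psi : S)
  (f : 'rV[R]_d -> R[i]).

(** This is [(2 * pi) ^+ d] times the inverse transform; the phase [- (pi / 2)] turns the cosine
    into a sine. *)
Definition ifourier chi : 'rV[R]_d -> R[i] :=
  fun x => costr 0 chi x +i* costr (- (pi / 2)) chi x.

Lemma ifourier_schwartz chi : test_fun chi -> ifourier chi \in @schwartz_pred R d.
Proof.
move=> tc; apply/asboolP; split; first by split; exact: costr_smooth.
move=> [t s]; pose g := iter_partial t (fun z => monomial s z * chi z).
have tg : test_fun g.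
  by apply: test_iter_partial; exact: (test_smoothM _ _ (smooth_monomial s) tc).
have tsc : test_fun (fun z => monomial s z * chi z).
  exact: (test_smoothM _ _ (smooth_monomial s) tc).
pose K := \int[mu]_z `|g z|.
exists (K + K)%:C => x.
rewrite /weighted_partial /citer_partial /= norm_normc lecR.
rewrite (_ : Re \o ifourier chi = costr 0 chi)//.
rewrite (_ : Im \o ifourier chi = costr (- (pi / 2)) chi)//.
rewrite !iter_partial_costr// (le_trans (normc_le_Re_Im _))//.
rewrite complexReM complexImM /= !mul0r subr0 addr0 !monomial_costr//.
by rewrite lerD//; apply: costr_bound; exact: test_integrable.
Qed.

Definition schwartz_ifourier chi (tc : test_fun chi) : S := Schwartz (ifourier_schwartz chi tc).

Lemma schwartz_is_schwartz phi : is_schwartz phi.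
Proof. by apply/asboolP; exact: schwartz_funP phi. Qed.

Lemma schwartz_decay phi : exists2 K, 0 <= K & forall x, normc (phi x) <= K * weight x.
Proof.
have [_ bnd] := schwartz_is_schwartz phi.
(* Expanding one factor [1 + x_i ^ 2] replaces the monomial [t] by the two monomials [t] and
   [i :: i :: t]; when [s] is used up, each term is controlled by a single seminorm. *)
have H (s : seq 'I_d) t : exists2 K, 0 <= K & forall x,
    (\prod_(i <- s) (1 + x ord0 i ^+ 2)) * `|monomial t x| * normc (phi x) <= K.
  elim: s t => [|i s ih] t.
    have [C phiC] := bnd (t, [::]); exists `|Re C| => // x; rewrite big_nil mul1r.
    have := phiC x; rewrite /weighted_partial /citer_partial /=.
    rewrite (_ : _ +i* _ = phi x); last by case: (phi x).
    rewrite norm_normc lecE /= => /andP[_]; rewrite Normc.normcM /=.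
    rewrite expr0n/= addr0 sqrtr_sqr => H; apply: le_trans H _.
    exact: ler_norm.
  have [K1 K10 H1] := ih t; have [K2 K20 H2] := ih [:: i, i & t].
  exists (K1 + K2); first exact: addr_ge0.
  move=> x; apply: le_trans (lerD (H1 x) (H2 x)).
  rewrite big_cons /monomial !big_cons mulrA -expr2 normrM ger0_norm ?sqr_ge0//.
  rewrite le_eqVlt; apply/orP; left; apply/eqP; ring.
have [K K0 HK] := H (index_enum 'I_d) [::]; exists K => // x.
have := HK x; rewrite /monomial big_nil normr1 mulr1 weightE.
by rewrite ler_pdivlMr ?prod_sqr_gt0// mulrC.
Qed.

Lemma schwartz_continuous phi : continuous (Re \o phi) /\ continuous (Im \o phi).
Proof.
by have [[sr si] _] := schwartz_is_schwartz phi; split; exact: smooth_continuous.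
Qed.

Lemma schwartz_integrable phi :
  Rintegrable mu (fun x => Re (phi x)) /\ Rintegrable mu (fun x => Im (phi x)).
Proof.
have [K K0 phiK] := schwartz_decay phi; have [cr ci] := schwartz_continuous phi.
have iW := RintegrableZ _ K _ (@Rintegrable_weight R d).
split; apply: (Rintegrable_dom _ _ _ _ iW).
- exact: continuous_measurable_rV cr.
- by move=> x; rewrite (le_trans (Re_normc _)).
- exact: continuous_measurable_rV ci.
- by move=> x; rewrite (le_trans (Im_normc _)).
Qed.

Lemma fourierE f xi : fourier f xi =
  trigint (fun x => Re (f x)) (fun x => - Im (f x)) xi +i*
  trigint (fun x => Im (f x)) (fun x => Re (f x)) xi.
Proof.
rewrite /fourier /cintegral; congr (_ +i* _); apply: eq_Rintegral => x _.
  by rewrite complexReM /= cosN sinN; ring.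
by rewrite complexImM /= cosN sinN; ring.
Qed.

Lemma fourier_uniqueness f : Rintegrable mu (fun x => Re (f x)) ->
  Rintegrable mu (fun x => Im (f x)) ->
  {ae mu, forall xi, fourier f xi = 0} -> {ae mu, forall x, f x = 0}.
Proof.
move=> ir ii f0.
have i0 : Rintegrable mu (fun=> 0 : R).
  by have := RintegrableZ _ 0 _ ir; congr Rintegrable; apply/funext => z; rewrite mul0r.
have t0 x : trigint (fun=> 0) (fun=> 0) x = 0 :> R.
  rewrite /trigint -[RHS](Rint_zero mu); apply: eq_Rintegral => z _.
  by rewrite !mul0r subrr.
have pi0 : (2 * pi) ^+ d != 0 :> R by rewrite expf_neq0// mulf_neq0// gt_eqF// pi_gt0.
have r0 : {ae mu, forall x, Re (f x) = 0}.
  have := fourier_inversion d _ _ (fun=> 0) (fun=> 0) ir ii i0 i0.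
  move=> H; have : {ae mu, forall x, (2 * pi) ^+ d * Re (f x) = 0}.
    have : {ae mu, forall x, (2 * pi) ^+ d * Re (f x) = trigint (fun=> 0) (fun=> 0) x}.
      apply: H; apply: filterS f0 => x; rewrite fourierE => /eqP.
        by rewrite eq_complex /= => /andP[/eqP].
      by rewrite eq_complex /= => /andP[_ /eqP].
    by apply: filterS => x; rewrite t0.
  by apply: filterS => x /eqP; rewrite mulf_eq0 (negbTE pi0) => /eqP.
(* The imaginary part is obtained from the inversion of [- i f]. *)
have iN := RintegrableN _ _ ir.
have i1 : {ae mu, forall x, Im (f x) = 0}.
  have := fourier_inversion d _ _ (fun=> 0) (fun=> 0) ii iN i0 i0.
  move=> H; have : {ae mu, forall x, (2 * pi) ^+ d * Im (f x) = 0}.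
    have : {ae mu, forall x, (2 * pi) ^+ d * Im (f x) = trigint (fun=> 0) (fun=> 0) x}.
      apply: H; apply: filterS f0 => x; rewrite fourierE => /eqP.
        rewrite eq_complex /= => /andP[_ /eqP <-]; apply: eq_Rintegral => z _.
        by rewrite opprK.
      rewrite eq_complex /= => /andP[/eqP + _] => E.
      rewrite -[RHS]oppr0 -[in RHS]E -RintN; last first.
        exact: (Rintegrable_trig _ _ _ _ ir (RintegrableN _ _ ii)).
      by apply: eq_Rintegral => z _; ring.
    by apply: filterS => x; rewrite t0.
  by apply: filterS => x /eqP; rewrite mulf_eq0 (negbTE pi0) => /eqP.
near=> x; apply: complex_eq => /=; first by near: x.
by near: x.
Unshelve. all: by end_near. Qed.

(** The transform of [chi] is the conjugate of [ifourier chi], integrable by the weight bound;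
    inversion applied to [chi] and to [i chi] yields the two components. *)
Lemma fourier_ifourier chi : test_fun chi ->
  {ae mu, forall xi, fourier (ifourier chi) xi = ((2 * pi) ^+ d * chi xi)%:C}.
Proof.
move=> tc; have ic := test_integrable _ tc; have iN := RintegrableN _ _ ic.
have i0 : Rintegrable mu (fun=> 0 : R).
  by have := RintegrableZ _ 0 _ ic; congr Rintegrable; apply/funext => z; rewrite mul0r.
have iC := Rintegrable_costr_fun 0 _ tc.
have iS := Rintegrable_costr_fun (- (pi / 2)) _ tc.
have CE x : trigint chi (fun=> - 0) x = costr 0 chi x.
  by apply: eq_Rintegral => z _; rewrite addr0 oppr0 mul0r subr0.
have SE x : trigint (fun=> 0) (fun z => - chi z) x = costr (- (pi / 2)) chi x.
  by apply: eq_Rintegral => z _; rewrite cosBpihalf mul0r sub0r mulNr opprK.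
have SE' x : trigint (fun=> 0) chi x = - costr (- (pi / 2)) chi x.
  rewrite -RintN; last exact: Rintegrable_costr.
  by apply: eq_Rintegral => z _; rewrite cosBpihalf mul0r sub0r.
have CE' x : trigint chi (fun=> 0) x = costr 0 chi x.
  by apply: eq_Rintegral => z _; rewrite addr0 mul0r subr0.
have h1 := fourier_inversion d chi (fun=> 0) (costr 0 chi)
  (fun x => - costr (- (pi / 2)) chi x) ic i0 iC (RintegrableN _ _ iS)
  (aeW _ CE) (aeW _ SE').
have h2 := fourier_inversion d (fun=> 0) chi (costr (- (pi / 2)) chi) (costr 0 chi)
  i0 ic iS iC (aeW _ SE) (aeW _ CE').
near=> xi; rewrite fourierE; apply: complex_eq => /=.
  by apply/esym; near: xi.
by rewrite -[RHS](mulr0 ((2 * pi) ^+ d)); apply/esym; near: xi.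
Unshelve. all: by end_near. Qed.

End schwartz_functions.

(** * Existence of the adjoint multiplier *)

Section adjoint_multiplier.
Context {R : realType} {d : nat}.
Local Notation Re := (@complex.Re R).
Local Notation Im := (@complex.Im R).
Local Notation mu := (lebesgue_rV R d).
Local Notation S := (schwartz R d).
Implicit Types (x y xi : 'rV[R]_d) (phi psi : S) (f : 'rV[R]_d -> R[i])
  (g : 'rV[R]_d -> R).

Lemma smooth_reflect g : smooth g -> smooth (fun x => g (- x)).
Proof.
move=> sg; apply: (smooth_coind (fun h => exists2 g, smooth g & h = fun x => g (- x)));
  last by exists g.
move=> _ [h sh ->]; split=> [x|j].
  exact: (@continuous_comp _ _ _ (fun x : 'rV[R]_d => - x) h x (opp_continuous x)
    (smooth_continuous _ sh _)).
exists (fun x => - partial j h (- x)).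
  by exists (fun x => - partial j h x); [exact: smoothN _ (smooth_partial j _ sh)|].
move=> x; apply: is_derive_lineW.
have := is_derive_line _ _ _ _ (smooth_is_derive _ j (- x) sh) => dh.
rewrite (_ : (fun r => _) = (fun r : R => h ((- r) *: delta_mx ord0 j + - x))); last first.
  by apply/funext => r; rewrite opprD scaleNr.
rewrite -mulrN1.
apply: (is_derive_comp1 (fun r : R => h (r *: delta_mx ord0 j + - x)) (fun r => - r)).
by rewrite oppr0.
Qed.

Lemma iter_partialN s g : smooth g -> iter_partial s (fun x => - g x) =
  (fun x => - iter_partial s g x).
Proof.
move=> sg; have := iter_partial_lin (-1) 0 s sg sg.
rewrite (_ : (fun x => -1 * g x + 0 * g x) = (fun x => - g x)); last first.
  by apply/funext => x; ring.
by move=> ->; apply/funext => x; ring.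
Qed.

Lemma weighted_partial_conj ts f : csmooth f ->
  weighted_partial ts (fun x => conjc (f x)) = fun x => conjc (weighted_partial ts f x).
Proof.
move=> [sr si]; apply/funext => x; rewrite /weighted_partial /citer_partial.
rewrite (_ : Re \o (fun x => conjc (f x)) = Re \o f); last first.
  by apply/funext => y /=; case: (f y).
rewrite (_ : Im \o (fun x => conjc (f x)) = fun y => - (Im \o f) y); last first.
  by apply/funext => y /=; case: (f y).
by rewrite iter_partialN//; apply: complex_eq => /=; ring.
Qed.

Lemma conj_schwartz_subproof phi : (fun x => conjc (phi x)) \in @schwartz_pred R d.
Proof.
have [[sr si] bnd] := schwartz_is_schwartz phi; apply/asboolP; split.
  split.
    by rewrite (_ : Re \o _ = Re \o phi)//; apply/funext => y /=; case: (phi y).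
  rewrite (_ : Im \o _ = fun y => - (Im \o phi) y); last first.
    by apply/funext => y /=; case: (phi y).
  exact: smoothN.
move=> ts; have [C phiC] := bnd ts; exists C => x.
by rewrite weighted_partial_conj// normcJ.
Qed.

Definition conj_schwartz phi : S := Schwartz (conj_schwartz_subproof phi).

Lemma schwartz_eq phi psi : (forall x, phi x = psi x) -> phi = psi.
Proof. by move=> E; apply/val_inj/funext. Qed.

(** Continuity into the initial topology is checked one seminorm at a time; conjugation commutes
    with weighted partial derivatives and preserves moduli, so it is an isometry for each
    seminorm. *)
Lemma conj_schwartz_continuous : continuous conj_schwartz.
Proof.
have cproj ts : continuous (fun psi : S =>
    (weighted_partial ts psi : {uniform 'rV[R]_d -> R[i]^o})).
  move=> psi; apply: (@continuous_comp _ _ _ (@schwartz_jet R d)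
    (fun J : prod_topology (fun=> {uniform 'rV[R]_d -> R[i]^o}) => J ts)).
    exact: initial_continuous.
  exact: proj_continuous.
apply: continuous_comp_initial => phi.
have FF : Filter ((@schwartz_jet R d \o conj_schwartz) psi @[psi --> phi]).
  by apply: fmap_filter; exact: nbhs_filter.
apply/cvg_sup => ts U [? /= [[W oW <-]]] /= Wphi /filterS; apply.
have /uniform_nbhs[E [entE EW]] : nbhs
    (weighted_partial ts (conj_schwartz phi) : {uniform 'rV[R]_d -> R[i]^o}) W.
  exact: open_nbhs_nbhs.
move: entE; rewrite -entourage_ballE => -[e /= e0 eE].
pose B := [set h : {uniform 'rV[R]_d -> R[i]^o} |
  forall y, [set: 'rV[R]_d] y -> ball (weighted_partial ts phi y : R[i]^o) e (h y)].
have : nbhs (weighted_partial ts phi : {uniform 'rV[R]_d -> R[i]^o}) B.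
  apply/uniform_nbhs; exists [set ab | ball ab.1 e ab.2]; split => //.
  by rewrite -entourage_ballE; exists e.
move=> /(cproj ts phi) Bphi.
change (nbhs phi [set psi : S | W (weighted_partial ts (conj_schwartz psi))]).
apply: (@filterS S (nbhs phi) (nbhs_filter phi)
  [set psi : S | B (weighted_partial ts psi)] _ _ Bphi) => psi /= Bpsi; apply: EW => y _.
apply: eE; have := Bpsi y I; rewrite /= -!ball_normE /=.
have [sf _] := schwartz_is_schwartz phi; have [sp _] := schwartz_is_schwartz psi.
rewrite /schwartz_jet /conj_schwartz /= !weighted_partial_conj//.
by rewrite -rmorphB normcJ.
Qed.

Lemma fourier_conj phi xi :
  fourier (conj_schwartz phi) xi = conjc (fourier phi (- xi)).
Proof.
have [ir ii] := schwartz_integrable phi.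
rewrite !fourierE /=; congr (_ +i* _).
  apply: eq_Rintegral => x _; rewrite [dotp x (- xi)]dotpC dotpNl dotpC cosN sinN.
  by case: (phi x) => a b /=; ring.
rewrite -RintN; last exact: Rintegrable_trig.
apply: eq_Rintegral => x _; rewrite [dotp x (- xi)]dotpC dotpNl dotpC cosN sinN.
by case: (phi x) => a b /=; ring.
Qed.

(* For a real symbol the adjoint is the conjugate of [Theta] by complex
   conjugation. *)
Lemma multiplier_adjP m (Theta : S -> S) : is_multiplier m Theta ->
  (forall xi, m xi \is Num.real) ->
  is_multiplier (fun xi => m (- xi)) (multiplier_adj m Theta).
Proof.
move=> [[smr smi] lT cT FT] mreal.
(* [multiplier_adj] is a choice with default value [Theta], so it meets its specification as soon as
   some operator does. *)
suff E : exists Theta', is_multiplier (fun xi => m (- xi)) Theta'.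
  exact: (@xgetPex _ Theta [set Theta' | is_multiplier (fun xi => m (- xi)) Theta'] E).
exists (conj_schwartz \o Theta \o conj_schwartz); split.
- by split; [exact: (smooth_reflect _ smr)|exact: (smooth_reflect _ smi)].
- move=> a phi psi; apply: schwartz_eq => x /=.
  have -> : conj_schwartz (a *: phi + psi) =
      (conjc a *: conj_schwartz phi + conj_schwartz psi : S).
    by apply: schwartz_eq => y /=; rewrite rmorphD rmorphM.
  rewrite lT.
  rewrite [LHS](_ : _ = conjc (conjc a * Theta (conj_schwartz phi) x +
    Theta (conj_schwartz psi) x))//.
  rewrite [RHS](_ : _ = a * conjc (Theta (conj_schwartz phi) x) +
    conjc (Theta (conj_schwartz psi) x))//.
  move: (Theta (conj_schwartz phi) x) (Theta (conj_schwartz psi) x) => [u v] [w z].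
  by case: {lT} a => ar ai; apply: complex_eq => /=; ring.
- move=> phi; apply: (@continuous_comp _ _ _ (Theta \o conj_schwartz) conj_schwartz phi).
    apply: (@continuous_comp _ _ _ conj_schwartz Theta phi).
      exact: conj_schwartz_continuous.
    exact: cT.
  exact: conj_schwartz_continuous.
- move=> phi xi /=; rewrite fourier_conj FT fourier_conj opprK.
  (* The outer conjugation would produce the conjugate of [m (- xi)]; the symbol being real, this is
     [m (- xi)] itself. *)
  have := RRe_real (mreal (- xi)).
  move: (m (- xi)) (fourier phi xi) => [a b] [u v] /= [<-].
  by apply: complex_eq => /=; ring.
Qed.

End adjoint_multiplier.

(** * Bump functions *)

Section translation.
Context {R : realType}.
Local Notation leb := (@lebesgue_measure R).

(** The image of Lebesgue measure under a translation agrees with it on half-open intervals, hence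
    on all measurable sets; the integrand is split into positive and negative parts. *)
Lemma Rint_shift1 (h : R -> R) (c : R) : measurable_fun [set: R] h ->
  \int[leb]_t h (t + c) = \int[leb]_t h t.
Proof.
move=> mh; pose phi (t : measurableTypeR R) : measurableTypeR R := t + c.
have mphi : measurable_fun [set: measurableTypeR R] phi.
  by apply: measurable_funD; [exact: measurable_id|exact: measurable_cst].
have E A : measurable A -> leb A = pushforward leb phi A.
  apply: lebesgue_measure_unique => _ [[a b] _ <-] /=.
  rewrite /pushforward (_ : phi @^-1` _ = `]a - c, b - c]%classic); last first.
    by apply/seteqP; split => t; rewrite /= !in_itv /= /phi ltrBlDr lerBrDr.
  by rewrite !lebesgue_measure_itv /= !lte_fin ltrD2r -!EFinD; case: ifP => // _;
    congr EFin; ring.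
have ge0 (k : R -> \bar R) : measurable_fun [set: R] k -> (forall t, 0 <= k t)%E ->
    (\int[leb]_t k (t + c)%R = \int[leb]_t k t)%E.
  move=> mk k0.
  have -> : (\int[leb]_t k t = \int[pushforward leb phi]_t k t)%E.
    by apply: eq_measure_integral => A mA _; exact: E.
  by rewrite ge0_integral_pushforward.
rewrite /Rintegral; congr fine; rewrite [LHS]integralE [RHS]integralE; congr (_ - _)%E.
  have mp : measurable_fun [set: R] (EFin \o h)^\+%E.
    by apply: measurable_funepos; exact/measurable_EFinP.
  transitivity (\int[leb]_t (EFin \o h)^\+ (t + c)%R)%E.
    by apply: eq_integral => t _; exact: (congr1 (@^~ t) (funepos_comp (EFin \o h) phi)).
  exact: (ge0 (EFin \o h)^\+%E mp (funepos_ge0 _)).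
have mn : measurable_fun [set: R] (EFin \o h)^\-%E.
  by apply: measurable_funeneg; exact/measurable_EFinP.
transitivity (\int[leb]_t (EFin \o h)^\- (t + c)%R)%E.
    by apply: eq_integral => t _; exact: (congr1 (@^~ t) (funeneg_comp (EFin \o h) phi)).
  exact: (ge0 (EFin \o h)^\-%E mn (funeneg_ge0 _)).
Qed.

Lemma rV_consD d (t : R) (y : 'rV[R]_d) (z : 'rV[R]_d.+1) :
  rV_cons (t : measurableTypeR R, y) + z =
  rV_cons ((t + z ord0 ord0 : R) : measurableTypeR R, y + \row_j z ord0 (lift ord0 j)).
Proof.
apply: rV_eq => i; rewrite [LHS]mxE; case: (unliftP ord0 i) => [j ->|->].
  by rewrite !rV_consE [RHS]mxE [X in _ = _ + X]mxE.
by rewrite !rV_consE0.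
Qed.

(** Slicing reduces this to translation on the line. Its use is to turn translates of a bump into
    modulations of its transform. *)
Lemma Rint_shift d (f : 'rV[R]_d -> R) (L : R) (z : 'rV[R]_d) :
  continuous f -> supported L f ->
  \int[lebesgue_rV R d]_x f (x + z) = \int[lebesgue_rV R d]_x f x.
Proof.
elim: d f z => [|d ih] f z cf sf.
  by apply: eq_Rintegral => x _; congr f; apply: rV_eq => -[].
have if_ := Rintegrable_supported _ _ cf sf.
have cfz : continuous (fun x : 'rV[R]_d.+1 => f (x + z)).
  have cz : continuous (fun x : 'rV[R]_d.+1 => x + z).
    apply: continuous_rV => i x.
    rewrite (_ : (fun t : 'rV[R]_d.+1 => _) = fun t : 'rV[R]_d.+1 => t ord0 i + z ord0 i).
      exact: (cvgD (continuous_coord i x) (cvg_cst _)).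
    by apply/funext => t; rewrite mxE.
  by move=> x; apply: (@continuous_comp _ _ _ (fun x : 'rV[R]_d.+1 => x + z) f x);
    [exact: cz|exact: cf].
have sfz : supported (L + `|z|) (fun x => f (x + z)).
  move=> x i xi; apply: (sf _ i); rewrite mxE.
  have : `|x ord0 i| <= `|x ord0 i + z ord0 i| + `|z ord0 i|.
    by rewrite -{1}(addrK (z ord0 i) (x ord0 i)); exact: ler_normB.
  have : `|z ord0 i| <= `|z|.
    rewrite [X in _ <= X]/Num.norm /= mx_normrE.
    exact: (le_bigmax 0 (fun ij : 'I_1 * 'I_d.+1 => `|z ij.1 ij.2|) (ord0, i)).
  by lra.
have ifz := Rintegrable_supported _ _ cfz sfz.
have cc2 (t : R) : continuous (fun y : 'rV[R]_d => rV_cons (t : measurableTypeR R, y)).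
  apply: continuous_rV => k; case: (unliftP ord0 k) => [j ->|->].
    by under eq_fun do rewrite rV_consE; exact: continuous_coord.
  rewrite (_ : (fun y => _) = fun=> t); first exact: cst_continuous.
  by apply/funext => y; rewrite rV_consE0.
rewrite (Rint_rV_cons _ _ ifz) (Rint_rV_cons _ _ if_).
have mF : measurable_fun [set: measurableTypeR R]
    (fun t => \int[lebesgue_rV R d]_y f (rV_cons (t, y))).
  by have [] := Rint_fubini_F _ _ _ (Rintegrable_rV_consP _ _ if_).
rewrite -[RHS](Rint_shift1 _ (z ord0 ord0) mF); apply: eq_Rintegral => t _.
under eq_Rintegral do rewrite rV_consD.
apply: (ih (fun y => f (rV_cons ((t + z ord0 ord0 : R) : measurableTypeR R, y)))).
  by move=> y; apply: continuous_comp; [exact: cc2|exact: cf].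
by move=> y k yk; apply: (sf _ (lift ord0 k)); rewrite rV_consE.
Qed.

End translation.

(** * Bumps built from the flat function [exp (- 1 / t)] *)

Section flat_bump.
Context {R : realType}.

(** The power of [t^-1] is carried along because each derivative of [exp (- 1 / t)] brings in
    further factors [t^-1]. *)
Definition flat (n : nat) (t : R) : R := if 0 < t then t^-1 ^+ n * expR (- t^-1) else 0.

Lemma flat_ge0 n t : 0 <= flat n t.
Proof.
by rewrite /flat; case: ifP => // t0; rewrite mulr_ge0 ?expR_ge0// exprn_ge0// invr_ge0 ltW.
Qed.

(** The term of order [n + 2] in the series of [exp (1 / t)] suffices. Quadratic vanishing gives
    derivative zero at the junction point [0]. *)
Lemma flat_bound n t : `|flat n t| <= n.+2`!%:R * t ^+ 2.
Proof.
rewrite ger0_norm ?flat_ge0// /flat; case: ifP => [t0|_]; last first.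
  by rewrite mulr_ge0// sqr_ge0.
have F0 : 0 < n.+2`!%:R :> R by rewrite ltr0n fact_gt0.
have ti0 : 0 < t^-1 by rewrite invr_gt0.
have H : t^-1 ^+ n.+2 / n.+2`!%:R <= expR t^-1.
  by apply: le_trans (expR_ge1Dxn n.+1 (ltW ti0)); rewrite lerDr.
rewrite expRN ler_pdivrMr ?expR_gt0//.
apply: le_trans (ler_wpM2l _ H); last by rewrite mulr_ge0 ?sqr_ge0// ltW.
have -> : n.+2`!%:R * t ^+ 2 * (t^-1 ^+ n.+2 / n.+2`!%:R) = t^-1 ^+ n.
  by rewrite !exprSr; field; rewrite !gt_eqF.
by [].
Qed.

Lemma is_derive_quadratic_bound (f : R -> R) (K : R) : (forall t, `|f t| <= K * t ^+ 2) ->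
  is_derive (0 : R) (1 : R) f 0.
Proof.
move=> fK.
have f0 : f 0 = 0 by apply/eqP; rewrite -normr_le0 (le_trans (fK 0))// expr0n mulr0.
have C : (fun h : R => h^-1 *: ((f \o shift 0) (h *: (1 : R)) - f 0)) @ 0^' --> (0 : R).
  apply: (cvg_to_0_linear (K := K) ltr01) => h /andP[h0 _].
  rewrite f0 subr0 /= addr0 /GRing.scale /= mulr1 normrM normfV ler_pdivrMl//.
  by rewrite (le_trans (fK h))// -real_normK ?num_real// expr2; lra.
apply: DeriveDef; first by apply/cvg_ex; exists 0.
by rewrite /derive; exact: cvg_lim.
Qed.

Lemma is_derive_flat n (t : R) :
  is_derive t (1 : R) (flat n) (flat n.+2 t - n%:R * flat n.+1 t).
Proof.
have [t0|t0|/esym t0] := ltgtP 0 t.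
- apply: (@near_eq_is_derive R R R (fun t : R => t^-1 ^+ n * expR (- t^-1))).
    near=> s; rewrite /flat ifT//; near: s; exact: lt_nbhsr.
  have tn0 : t != 0 by rewrite gt_eqF.
  have d1 : is_derive t (1 : R) (fun s : R => s^-1) (- t ^- 2 * 1).
    by apply: is_derive_inv => //; exact: is_derive_id.
  have d2 := is_derive_exp n d1.
  have d3 : is_derive t (1 : R) (fun s : R => expR (- s^-1)) (expR (- t^-1) * - (- t ^- 2 * 1)).
    exact: (is_derive_comp1 expR _ _ _ _ _ (is_derive_opp d1) (is_derive_expR _)).
  apply: (is_derive_eq (is_derive_mul d2 d3)); rewrite /flat t0.
  case: n {d2} => [|n] /=; first by rewrite !expr0 !expr2; field.
  by rewrite !exprS -?natr1; field.
- apply: (@near_eq_is_derive R R R (fun=> 0)).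
    near=> s; rewrite /flat ifF//; apply/negbTE; rewrite -leNgt; apply: ltW.
    near: s; exact: lt_nbhsl.
  by rewrite /flat ltNge (ltW t0)/= mulr0 subrr; exact: is_derive_const.
- rewrite t0 [flat n.+2 0]/flat [flat n.+1 0]/flat ltxx mulr0 subrr.
  exact: (is_derive_quadratic_bound _ _ (flat_bound n)).
Unshelve. all: by end_near. Qed.

Lemma continuous_flat n : continuous (flat n).
Proof. exact: is_derive_continuous (is_derive_flat n). Qed.

Context {d : nat}.
Implicit Types (x eta : 'rV[R]_d) (i : 'I_d) (N : R).

(* Closed under partial derivatives because [flat n]' = [flat (n + 2) - n flat (n + 1)]. *)
Inductive flat_gen (i : 'I_d) (s c : R) : ('rV[R]_d -> R) -> Prop :=
| FlatBase n : flat_gen i s c (fun x => flat n (s * x ord0 i + c))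
| FlatLin a b g h : flat_gen i s c g -> flat_gen i s c h ->
    flat_gen i s c (fun x => a * g x + b * h x).

Lemma smooth_flat i s c n : smooth (fun x => flat n (s * x ord0 i + c)).
Proof.
apply: (smooth_coind (flat_gen i s c)); last exact: FlatBase.
move=> g; elim => {g} [k|a b g h _ [cg dg] _ [ch dh]].
  have dl j x : is_derive x (delta_mx ord0 j : 'rV[R]_d)
      (fun y : 'rV[R]_d => s * y ord0 i + c) (s * (j == i)%:R + 0).
    exact: (is_derive_add (is_derive_scale s (is_derive_coord j i x)) (is_derive_const _ _ _)).
  split=> [x|j].
    apply: (@continuous_comp _ _ _ (fun y : 'rV[R]_d => s * y ord0 i + c) (flat k) x);
      last exact: continuous_flat.
    exact: (cvgD (cvgM (cvg_cst _) (continuous_coord i x)) (cvg_cst _)).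
  exists (fun x => (s * (j == i)%:R) * flat k.+2 (s * x ord0 i + c) +
     (- (k%:R * (s * (j == i)%:R))) * flat k.+1 (s * x ord0 i + c)) => [|x].
    by apply: FlatLin; exact: FlatBase.
  apply: (is_derive_eq (is_derive_comp1 (flat k) _ _ _ _ _ (dl j x) (is_derive_flat k _))).
  by ring.
split=> [x|j].
  exact: (cvgD (cvgM (cvg_cst _) (cg x)) (cvgM (cvg_cst _) (ch x))).
have [g' Pg' dg'] := dg j; have [h' Ph' dh'] := dh j.
exists (fun x => a * g' x + b * h' x) => [|x]; first exact: FlatLin.
exact: (is_derive_add (is_derive_scale a (dg' x)) (is_derive_scale b (dh' x))).
Qed.

(** Two factors per coordinate, one for each face of the cube of centre [eta] and half-side [1 / N].
    A large [N] makes the transform of the centred bump positive on a large set. *)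
Definition flat_bump (N : R) (eta x : 'rV[R]_d) : R :=
  \prod_i (flat 0 (- N * x ord0 i + (1 + N * eta ord0 i)) *
           flat 0 (N * x ord0 i + (1 - N * eta ord0 i))).

Lemma flat_bump_ge0 N eta x : 0 <= flat_bump N eta x.
Proof. by apply: prodr_ge0 => i _; rewrite mulr_ge0// flat_ge0. Qed.

Lemma test_flat_bump N eta : 0 < N -> test_fun (flat_bump N eta).
Proof.
move=> N0; split.
  apply: (smooth_prod _ _ (fun i x => flat 0 (- N * x ord0 i + (1 + N * eta ord0 i)) *
           flat 0 (N * x ord0 i + (1 - N * eta ord0 i)))) => i.
  apply: (smoothM (fun x : 'rV[R]_d => flat 0 (- N * x ord0 i + (1 + N * eta ord0 i)))
    (fun x : 'rV[R]_d => flat 0 (N * x ord0 i + (1 - N * eta ord0 i))));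
    exact: smooth_flat.
(* [supported] uses one radius for all coordinates, so the sum of the [|eta_i|] serves as a common
   bound. *)
exists (\sum_i `|eta ord0 i| + N^-1) => x i xi.
rewrite /flat_bump (bigD1 i)//=.
suff -> : flat 0 (- N * x ord0 i + (1 + N * eta ord0 i)) *
           flat 0 (N * x ord0 i + (1 - N * eta ord0 i)) = 0 by rewrite mul0r.
have : `|eta ord0 i| + N^-1 < `|x ord0 i|.
  by apply: le_lt_trans xi; rewrite lerD2r (bigD1 i)//= lerDl sumr_ge0.
have [x0|x0] := leP 0 (x ord0 i).
  rewrite [`|x ord0 i|]ger0_norm// => H; rewrite {1}/flat ifF ?mul0r//.
  apply/negbTE; rewrite -leNgt.
  have : N * (eta ord0 i + N^-1) <= N * x ord0 i.
    by rewrite ler_pM2l// (le_trans _ (ltW H))// lerD2r ler_norm.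
  by rewrite mulrDr divff ?gt_eqF//; lra.
rewrite [`|x ord0 i|]ltr0_norm// => H; rewrite {2}/flat ifF ?mulr0//; apply/negbTE; rewrite -leNgt.
have : N * (- eta ord0 i + N^-1) <= N * - x ord0 i.
  by rewrite ler_pM2l// (le_trans _ (ltW H))// lerD2r -normrN ler_norm.
by rewrite mulrDr divff ?gt_eqF//; lra.
Qed.

Lemma flat_bump_shift N eta x : flat_bump N eta (x + eta) = flat_bump N 0 x.
Proof.
apply: eq_bigr => i _; rewrite !mxE; congr (flat 0 _ * flat 0 _); ring.
Qed.

End flat_bump.

(** * Transforms of bumps *)

Section bump_transform.
Context {R : realType} {d : nat}.
Local Notation mu := (lebesgue_rV R d).
Implicit Types (x eta : 'rV[R]_d) (N : R).

Lemma costr_bump_shift N eta th x : 0 < N ->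
  costr th (flat_bump N eta) x = costr (th + dotp eta x) (flat_bump N (0 : 'rV[R]_d)) x.
Proof.
move=> N0; have [sb [L bL]] := test_flat_bump N eta N0.
rewrite /costr -(Rint_shift _ (fun z => flat_bump N eta z * cos (dotp z x + th)) L eta).
- by apply: eq_Rintegral => z _; rewrite flat_bump_shift dotpDl; congr (_ * cos _); ring.
- move=> z; apply: (cvgM (smooth_continuous _ sb z)).
  apply: (@continuous_comp _ _ _ (fun z => dotp z x + th) cos z); last exact: continuous_cos.
  exact: (cvgD (continuous_dotp x z) (cvg_cst _)).
- exact: supportedMr.
Qed.

Lemma flat_bump_supp N x i : 0 < N -> N^-1 < `|x ord0 i| -> flat_bump N (0 : 'rV[R]_d) x = 0.
Proof.
move=> N0 xi; rewrite /flat_bump (bigD1 i)//= !mxE.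
suff -> : flat 0 (- N * x ord0 i + (1 + N * 0)) *
           flat 0 (N * x ord0 i + (1 - N * 0)) = 0 :> R by rewrite mul0r.
have H : 1 < N * `|x ord0 i| by rewrite -ltr_pdivrMl// mulr1.
have [x0|x0] := leP 0 (x ord0 i).
  rewrite {1}/flat ifF ?mul0r//; apply/negbTE; rewrite -leNgt.
  by move: H; rewrite ger0_norm//; lra.
rewrite {2}/flat ifF ?mulr0//; apply/negbTE; rewrite -leNgt.
by move: H; rewrite ltr0_norm//; lra.
Qed.

Lemma flat_bump_mass N : 0 < N -> 0 < \int[mu]_z flat_bump N (0 : 'rV[R]_d) z.
Proof.
(* In this box of half-side [1 / (2 N)] the arguments of [flat 0] are at least [1 / 2], so each of
   its values is at least [expR (-2)]. *)
move=> N0; pose a (i : 'I_d) : R := - (2 * N)^-1; pose b (i : 'I_d) : R := (2 * N)^-1.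
pose c : R := \prod_(i < d) (expR (-2) * expR (-2)).
have c0 : 0 < c by apply: prodr_gt0 => i _; rewrite mulr_gt0 ?expR_gt0.
have ib := test_integrable _ (test_flat_bump N (0 : 'rV[R]_d) N0).
have ibox : Rintegrable mu (fun z => c * \1_(obox a b) z).
  by apply: RintegrableZ; exact: Rintegrable_obox.
have le z : c * \1_(obox a b) z <= flat_bump N (0 : 'rV[R]_d) z.
  rewrite indicE; have [|_] := boolP (z \in obox a b); last by rewrite mulr0 flat_bump_ge0.
  rewrite inE => zab; rewrite mulr1; apply: ler_prod => i _.
  have N2 : 0 < (2 * N)^-1 by rewrite invr_gt0 mulr_gt0.
  have fl (t : R) : 2^-1 <= t -> expR (- 2) <= flat 0 t.
    move=> t2; have t0 : 0 < t by apply: lt_le_trans t2; rewrite invr_gt0.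
    by rewrite /flat t0 expr0 mul1r ler_expR lerN2 -[X in _ <= X]invrK lef_pV2 ?posrE// invr_gt0.
  have := zab i; rewrite /= in_itv /= /a /b => /andP[z1 z2]; rewrite mxE mulr0.
  have NN : N * (2 * N)^-1 = 2^-1 by field; rewrite gt_eqF.
  have z3 : - 2^-1 <= N * z ord0 i by rewrite -NN -mulrN ler_pM2l// ltW.
  have z4 : N * z ord0 i <= 2^-1 by rewrite -NN ler_pM2l.
  rewrite mulr_ge0 ?expR_ge0//= ler_pM ?expR_ge0//; apply: fl; first lra.
  by lra.
apply: (@lt_le_trans _ _ (\int[mu]_z (c * \1_(obox a b) z))); last first.
  by apply: le_Rintegral => // z _; exact: le.
rewrite RintZ; last exact: Rintegrable_obox.
rewrite mulr_gt0//.
rewrite (_ : \1_ _ = fun y : 'rV[R]_d => \prod_i \1_(`]a i, b i]%classic) (y ord0 i)); last first.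
  by apply/funext => y; exact: indic_obox.
rewrite (Rint_prod d (fun i => \1_(`]a i, b i]%classic) ) _).2; last first.
  by move=> i; exact: integrable_indic_itv.
apply: prodr_gt0 => i _; rewrite /Rintegral integral_indic// setIT.
rewrite /= lebesgue_measure_itv /= lte_fin /a /b.
have N2 : 0 < (2 * N)^-1 by rewrite invr_gt0 mulr_gt0.
by rewrite ifT /=; lra.
Qed.

(** Where the bump is nonzero, [|z_i| <= 1 / N], so [|dotp z x| <= 1 / 2] and the cosine is at least
    [1 / 2]: the transform is at least half the mass of the bump. *)
Lemma costr_bump_gt0 N x : 0 < N -> \sum_i `|x ord0 i| <= N / 2 ->
  0 < costr 0 (flat_bump N (0 : 'rV[R]_d)) x.
Proof.
move=> N0 xN; have tb := test_flat_bump N (0 : 'rV[R]_d) N0; have ib := test_integrable _ tb.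
have := flat_bump_mass N N0; rewrite -(pmulr_rgt0 _ (_ : 0 < 2^-1)) ?invr_gt0// -RintZ//.
move=> /lt_le_trans; apply; apply: le_Rintegral => //.
- exact: RintegrableZ.
- exact: Rintegrable_costr.
move=> z _; have [zN|->] := supported_dichotomy N^-1 _ z
    (fun x i => flat_bump_supp N x i N0); last by rewrite mulr0 mul0r.
rewrite mulrC ler_wpM2l ?flat_bump_ge0// addr0.
have : `|dotp z x| <= 2^-1.
  rewrite (_ : 2^-1 = N^-1 * (N / 2)); last by field; rewrite gt_eqF.
  apply: (@le_trans _ _ (N^-1 * \sum_i `|x ord0 i|)); last by rewrite ler_pM2l ?invr_gt0.
  rewrite /dotp (le_trans (ler_norm_sum _ _ _))// mulr_sumr ler_sum// => i _.
  by rewrite normrM ler_wpM2r.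
have := cos_lipschitz (dotp z x) 0; rewrite cos0 subr0 => H1 H2.
by have := ler_norm (1 - cos (dotp z x)); rewrite distrC; lra.
Qed.

End bump_transform.

(** * Derivatives of localized powers *)

Section power_estimates.
Context {R : realType}.
Implicit Types (t v w : R).

Lemma one_add_le_sqr v : 1 + v <= 2 * (1 + v ^+ 2) /\ v * (v + 1) <= 2 * (1 + v ^+ 2).
Proof. by have := sqr_ge0 (v - 1); have := sqr_ge0 v; rewrite !expr2; split; nra. Qed.

(** Combines [v ^ n <= exp (- y)] with [y ^ l <= l! exp y] for [y = n (1 - v)]. *)
Lemma pow_one_sub_bound v (n l : nat) : 0 <= v <= 1 ->
  v ^+ n * (n%:R * (1 - v)) ^+ l <= l`!%:R.
Proof.
move=> /andP[v0 v1]; set y := n%:R * (1 - v).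
have y0 : 0 <= y by rewrite mulr_ge0// subr_ge0.
have H1 : v ^+ n <= expR (- y).
  rewrite /y -mulrN expRM_natl lerXn2r ?nnegrE ?expR_ge0//.
  by have := expR_ge1Dx (- (1 - v)); lra.
have H2 : y ^+ l <= l`!%:R * expR y.
  rewrite -ler_pdivrMl ?ltr0n ?fact_gt0// mulrC.
  case: l => [|l]; first by rewrite expr0 divr1 -expR0 ler_expR.
  by apply: le_trans (expR_ge1Dxn l y0); rewrite lerDr.
apply: (@le_trans _ _ (expR (- y) * (l`!%:R * expR y))).
  by rewrite ler_pM// exprn_ge0.
by rewrite mulrCA -expRD addNr expR0 mulr1.
Qed.

(** The numerator has degree between [1] and [2b + 1], the denominator degree [2b + 2]: hence a
    bound by [w] near zero and by [1 / w] at infinity. *)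
Lemma pow_div_bound w (p b : nat) : 0 <= w -> (p <= 2 * b)%N ->
  w ^+ p.+1 * (1 + w ^+ 2)^-1 ^+ b.+1 <= w /\
  w * (w ^+ p.+1 * (1 + w ^+ 2)^-1 ^+ b.+1) <= 1.
Proof.
move=> w0 pb; set q := (1 + w ^+ 2)^-1.
have w2 : 0 <= w ^+ 2 by rewrite sqr_ge0.
have q0 : 0 <= q by rewrite invr_ge0 addr_ge0.
have q1 : q <= 1 by rewrite invf_le1 ?lerDl// ltr_wpDr.
have wq : w ^+ 2 * q <= 1 by rewrite ler_pdivrMr ?mul1r ?lerDr// ltr_wpDr.
have wq0 : 0 <= w ^+ 2 * q by rewrite mulr_ge0.
have qb : q ^+ b.+1 <= 1 by rewrite exprn_ile1.
have qb0 : 0 <= q ^+ b.+1 by rewrite exprn_ge0.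
have E : w * (w ^+ (2 * b).+1 * q ^+ b.+1) = (w ^+ 2 * q) ^+ b.+1.
  by rewrite mulrA -exprS exprMn -exprM mulnS.
have [w1|w1] := leP w 1.
  have H : w ^+ p.+1 * q ^+ b.+1 <= w.
    by rewrite -[X in _ <= X]mulr1 ler_pM ?exprn_ge0// exprS ler_piMr// exprn_ile1.
  by split=> //; rewrite (le_trans (ler_wpM2l w0 H))// -expr2 exprn_ile1.
have H : w * (w ^+ p.+1 * q ^+ b.+1) <= 1.
  apply: (@le_trans _ _ (w * (w ^+ (2 * b).+1 * q ^+ b.+1))).
    by rewrite ler_wpM2l// ler_wpM2r// ler_weXn2l// ltW.
  by rewrite E exprn_ile1.
split=> //; rewrite (le_trans _ (ltW w1))//; apply: le_trans H.
by rewrite ler_peMl ?mulr_ge0 ?exprn_ge0// ltW.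
Qed.

(* [|U|^(p+1) / (1 + U^2)^(b+1)] is at most [min (|U|, 1/|U|)], and for [U = t^n] this is
   [exp (- n (1 - v))] with [v = min (|t|, 1/|t|)] at most. *)
Lemma localized_power_bound t (n l p b : nat) : (p <= 2 * b)%N ->
  n%:R ^+ l * (`|t ^+ n| ^+ p.+1 * (1 + (t ^+ n) ^+ 2)^-1 ^+ b.+1 * `|t ^+ 2 - 1| ^+ l)
  <= l`!%:R * (2 * (1 + t ^+ 2)) ^+ l.
Proof.
move=> pb; have n0 : 0 <= n%:R :> R by [].
rewrite -[in (1 + (t ^+ n) ^+ 2)](real_normK (num_real (t ^+ n))) normrX.
rewrite -[in t ^+ 2](real_normK (num_real t)).
move: `|t| (normr_ge0 t) => v v0.
have [A B] := pow_div_bound (v ^+ n) p b (exprn_ge0 _ v0) pb.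
set X := (v ^+ n) ^+ p.+1 * _ in A B *.
have X0 : 0 <= X.
  by rewrite mulr_ge0 ?exprn_ge0// invr_ge0 addr_ge0// sqr_ge0.
have F0 : 0 <= l`!%:R :> R by [].
clearbody X.
have [v1|v1] := leP v 1.
  have -> : `|v ^+ 2 - 1| = (1 - v) * (1 + v).
    by rewrite distrC ger0_norm ?subr_ge0 ?exprn_ile1//; ring.
  have -> : n%:R ^+ l * (X * ((1 - v) * (1 + v)) ^+ l) =
    X * (n%:R * (1 - v)) ^+ l * (1 + v) ^+ l by rewrite !exprMn; ring.
  have nv : 0 <= n%:R * (1 - v) by rewrite mulr_ge0// subr_ge0.
  apply: ler_pM; first by rewrite mulr_ge0// exprn_ge0.
  - by rewrite exprn_ge0// addr_ge0.
  - apply: le_trans (pow_one_sub_bound v n l _); last by rewrite v0.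
    by rewrite ler_wpM2r// exprn_ge0.
  rewrite lerXn2r ?nnegrE ?addr_ge0 ?mulr_ge0 ?sqr_ge0//.
  - by rewrite addr_ge0// sqr_ge0.
  - exact: (one_add_le_sqr v).1.
(* For [v > 1] the decay comes from powers of [1 / v]; the leftover factor [v (v + 1)] obeys the
   same bound [2 (1 + v ^ 2)] as [1 + v] in the first case. *)
have vp : 0 < v by rewrite (lt_trans ltr01).
have -> : `|v ^+ 2 - 1| = (1 - v^-1) * (v * (v + 1)).
  rewrite ger0_norm ?subr_ge0 ?exprn_ege1// 1?ltW//; field; rewrite gt_eqF//.
have vi : 0 <= v^-1 <= 1 by rewrite invr_ge0 v0/= invf_le1// ltW.
have XV : X <= v^-1 ^+ n.
  by rewrite exprVn -[X in _ <= X]mul1r ler_pdivlMr ?exprn_gt0// mulrC.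
have -> : n%:R ^+ l * (X * ((1 - v^-1) * (v * (v + 1))) ^+ l) =
    X * (n%:R * (1 - v^-1)) ^+ l * (v * (v + 1)) ^+ l by rewrite !exprMn; ring.
have vi1 : 0 <= 1 - v^-1 by rewrite subr_ge0; case/andP: vi.
have nv : 0 <= n%:R * (1 - v^-1) by rewrite mulr_ge0.
apply: ler_pM; first by rewrite mulr_ge0// exprn_ge0.
- by rewrite exprn_ge0// mulr_ge0// addr_ge0.
- apply: le_trans (pow_one_sub_bound v^-1 n l vi).
  by rewrite ler_wpM2r// exprn_ge0.
rewrite lerXn2r ?nnegrE ?addr_ge0 ?mulr_ge0 ?sqr_ge0 ?addr_ge0//.
- by rewrite mulr_ge0// addr_ge0.
- exact: (one_add_le_sqr v).2.
Qed.

End power_estimates.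

(** * Derivatives of localized powers, with uniform bounds in [n] *)

Section localized_powers.
Context {R : realType} {d : nat}.
Variables (u : 'rV[R]_d -> R) (L : R).
Hypothesis su : smooth u.
Implicit Types (S : 'rV[R]_d -> R) (x : 'rV[R]_d) (F : nat -> 'rV[R]_d -> R).
Local Notation e_ i := (delta_mx ord0 i : 'rV[R]_d).

(** For [c = p = b = 0] the middle factors give [u^n / (1 + u^(2n))]. The exponents of [n] and of
    [u^2 - 1] are tied so that, for [p <= 2b] and [S] of compact support, the term has size
    [n^(-s)]. *)
Definition loc_term (e s c p b : nat) S n x : R :=
  n%:R ^+ c * (u x ^+ e * ((u x ^+ n) ^+ p.+1 * ((1 + (u x ^+ n) ^+ 2)^-1 ^+ b.+1 *
    ((u x ^+ 2 - 1) ^+ (c + s) * S x)))).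

(* [e] and [s] count the derivatives that may still be taken: each one costs at most a power
   of [u] and either a factor [n] or a power of [u^2 - 1]. *)
Inductive loc_family (e s : nat) : (nat -> 'rV[R]_d -> R) -> Prop :=
| LocTerm c p b S : (p <= 2 * b)%N -> smooth S -> supported L S ->
    loc_family e s (loc_term e s c p b S)
| LocAdd F G : loc_family e s F -> loc_family e s G ->
    loc_family e s (fun n x => F n x + G n x).

Lemma loc_family_scale e s (k : R) F : loc_family e s F ->
  loc_family e s (fun n x => k * F n x).
Proof.
elim=> {F} [c p b S pb sS LS|F G _ ihF _ ihG].
  rewrite (_ : (fun n => _) = loc_term e s c p b (fun x => k * S x)).
    exact: (LocTerm _ _ c p b _ pb (smoothM (fun=> k) S (smooth_cst _) sS)
      (supportedMl _ _ _ LS)).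
  by apply/funext => n; apply/funext => x; rewrite /loc_term; ring.
rewrite (_ : (fun n => _) = fun n x => k * F n x + k * G n x); first exact: LocAdd.
by apply/funext => n; apply/funext => x; rewrite mulrDr.
Qed.

(** The surplus factors [u] and [u^2 - 1] are moved into [S]. This puts [F] and its derivatives in
    one family. *)
Lemma loc_family_weaken e s F : loc_family e.+1 s.+1 F -> loc_family e s F.
Proof.
elim=> {F} [c p b S pb sS LS|F G _ ihF _ ihG]; last exact: LocAdd.
rewrite (_ : loc_term _ _ _ _ _ _ =
    loc_term e s c p b (fun x => (u x * (u x ^+ 2 - 1)) * S x)).
  apply: (LocTerm _ _ c p b _ pb _ (supportedMl _ _ _ LS)).
  apply: (smoothM (fun x => u x * (u x ^+ 2 - 1)) S _ sS).
  apply: (smoothM u (fun x => u x ^+ 2 - 1) su).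
  exact: (smoothB (fun x => u x ^+ 2) (fun=> 1) (smoothX _ _ su) (smooth_cst _)).
apply/funext => n; apply/funext => x; rewrite /loc_term addnS !exprS.
by ring.
Qed.

Lemma loc_family_derive e s F j : loc_family e.+1 s.+1 F ->
  exists2 F', loc_family e s F' & forall n x, is_derive x (e_ j) (F n) (F' n x).
Proof.
elim=> {F} [c p b S pb sS LS|F G _ [F' PF dF] _ [G' PG dG]]; last first.
  exists (fun n x => F' n x + G' n x) => [|n x]; first exact: LocAdd.
  exact: (is_derive_add (dF n x) (dG n x)).
pose V x := u x ^+ 2 - 1; pose u' := partial j u.
have su' : smooth u' by exact: smooth_partial.
have sV : smooth V.
  exact: (smoothB (fun x => u x ^+ 2) (fun=> 1) (smoothX _ _ su) (smooth_cst _)).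
have sM := fun (k : R) (g h : 'rV[R]_d -> R) (sg : smooth g) (sh : smooth h) =>
  smoothM (fun=> k) _ (smooth_cst k) (smoothM g h sg sh).
have sc (k : R) (g : 'rV[R]_d -> R) : smooth g -> smooth (fun x => k * g x).
  exact: (smoothM (fun=> k) g (smooth_cst k)).
have suS : smooth (fun x => u' x * S x) by exact: (smoothM u' S su' sS).
have LuS : supported L (fun x => u' x * S x) by exact: supportedMl.
(* The five terms of the product rule, from differentiating in turn the spare power of [u], the
   power of [u^n], the inverse power of [1 + u^(2n)], the power of [u^2 - 1], and [S]. Only the
   second and third bring a factor [n]. *)
pose S1 x := e.+1%:R * (V x * (u' x * S x)).
pose S2 x := p.+1%:R * (u' x * S x).
pose S3 x := (- (2 * b.+1%:R)) * (u' x * S x).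
pose S4 x := (2 * (c + s).+1%:R) * ((u x * u x) * (u' x * S x)).
pose S5 x := (u x * V x) * partial j S x.
exists (fun n x => loc_term e s c p b S1 n x + (loc_term e s c.+1 p b S2 n x +
  (loc_term e s c.+1 p.+2 b.+1 S3 n x + (loc_term e s c p b S4 n x +
   loc_term e s c p b S5 n x)))).
  have sS1 : smooth S1 := sM _ V _ sV suS.
  have sS2 : smooth S2 := sc _ _ suS.
  have sS3 : smooth S3 := sc _ _ suS.
  have sS4 : smooth S4 := sM _ (fun x => u x * u x) _ (smoothM u u su su) suS.
  have sS5 : smooth S5 := smoothM (fun x => u x * V x) _ (smoothM u V su sV)
    (smooth_partial j _ sS).
  have LS1 : supported L S1 := supportedMl _ _ _ (supportedMl _ _ _ LuS).
  have LS2 : supported L S2 := supportedMl _ _ _ LuS.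
  have LS3 : supported L S3 := supportedMl _ _ _ LuS.
  have LS4 : supported L S4 := supportedMl _ _ _ (supportedMl _ _ _ LuS).
  have LS5 : supported L S5 := supportedMl _ _ _ (supported_partial _ _ j sS LS).
  have pb2 : (p.+2 <= 2 * b.+1)%N by rewrite mulnS !addSn add0n !ltnS.
  exact: (LocAdd _ _ _ _ (LocTerm _ _ _ _ _ _ pb sS1 LS1)
    (LocAdd _ _ _ _ (LocTerm _ _ _ _ _ _ pb sS2 LS2)
    (LocAdd _ _ _ _ (LocTerm _ _ _ _ _ _ pb2 sS3 LS3)
    (LocAdd _ _ _ _ (LocTerm _ _ _ _ _ _ pb sS4 LS4)
      (LocTerm _ _ _ _ _ _ pb sS5 LS5))))).
move=> n x; have du := smooth_is_derive _ j x su; have dS := smooth_is_derive _ j x sS.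
(* The derivative of [u^n] enters only multiplied by a spare factor [u], which removes the exponent
   [n - 1] and treats [n = 0] and zeros of [u] uniformly. *)
have [dU dUE udU] : exists2 dU, is_derive x (e_ j) (fun y => u y ^+ n) dU &
    u x * dU = n%:R * (u x ^+ n * u' x).
  exists (n%:R * u x ^+ n.-1 * u' x); first exact: is_derive_exp.
  by case: n => [|n] /=; rewrite ?mul0r ?mulr0// exprS; ring.
have q0 : 1 + (u x ^+ n) ^+ 2 != 0 by rewrite gt_eqF// ltr_wpDr// sqr_ge0.
have dQ : is_derive x (e_ j) (fun y => (1 + (u y ^+ n) ^+ 2)^-1)
    (- (1 + (u x ^+ n) ^+ 2) ^- 2 * (0 + 2 * (u x ^+ n) * dU)).
  exact: (is_derive_inv
    (is_derive_add (is_derive_const _ _ 1) (is_derive_exp 2 dUE)) q0).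
have dV : is_derive x (e_ j) V (2 * u x * u' x + - 0).
  exact: (is_derive_add (is_derive_exp 2 du) (is_derive_opp (is_derive_const _ _ _))).
have D := is_derive_scale (n%:R ^+ c) (is_derive_mul (is_derive_exp e.+1 du)
  (is_derive_mul (is_derive_exp p.+1 dUE) (is_derive_mul (is_derive_exp b.+1 dQ)
  (is_derive_mul (is_derive_exp (c + s.+1) dV) dS)))).
apply: (is_derive_eq D); rewrite /loc_term /S1 /S2 /S3 /S4 /S5 /= addnS /= -/(V x).
rewrite -exprVn addSn -/u' -/(u' x).
move: (1 + _)^-1 => q; move: (partial j S x) (u' x) (V x) (S x) udU => S' w v z.
rewrite !exprS; move: (u x) (u x ^+ e) => y Y udU.
move: (n%:R : R) udU => N udU.
move: (y ^+ n) udU (v ^+ (c + s)) (N ^+ c) (q ^+ b) => U udU l M r.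
move: (U ^+ p) => T; rewrite expr0.
rewrite [LHS](_ : _ = M * (e.+1%:R * Y * w) * (U * T * (q * r * (v * l * z))) +
  M * (y * Y) * (U * T * (q * r * ((c + s).+1%:R * l * (2 * y * w) * z + v * l * S'))) +
  M * Y * (p.+1%:R * T * (q * r * (v * l * z)) -
    U * T * (b.+1%:R * r * (q * q) * (2 * U) * (v * l * z))) * (y * dU)); last by ring.
by rewrite udU; ring.
Qed.

Lemma loc_family_sub_sqr e s F j : loc_family e.+2 s.+2 F ->
  loc_family e s (fun n x => F n x - partial j (partial j (F n)) x).
Proof.
move=> PF; have [F1 PF1 dF] := loc_family_derive _ _ _ j PF.
have [F2 PF2 dF1] := loc_family_derive _ _ _ j PF1.
rewrite (_ : (fun n => _) = fun n x => F n x + -1 * F2 n x).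
  apply: LocAdd; last exact: loc_family_scale.
  by do 2 apply: loc_family_weaken.
apply/funext => n; apply/funext => x.
by rewrite (partialE j _ _ (dF n)) (partialE j _ _ (dF1 n)) mulN1r.
Qed.

Lemma loc_family_one_sub_sqr_partials (t : seq 'I_d) e s F :
  loc_family ((size t).*2 + e) ((size t).*2 + s) F ->
  loc_family e s (fun n => one_sub_sqr_partials t (F n)).
Proof.
elim: t e s => [|j t ih] e s //= PF.
apply: loc_family_sub_sqr; apply: ih; by rewrite !addnS -!addSn.
Qed.

Lemma loc_family_supported e s F n : loc_family e s F -> supported L (F n).
Proof.
elim=> {F} [c p b S pb sS LS|F G _ LF _ LG] x i xi.
  by rewrite /loc_term (LS x i xi) !mulr0.
by rewrite (LF x i xi) (LG x i xi) addr0.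
Qed.

Lemma loc_family_bound e s F : loc_family e s F ->
  exists2 C, 0 <= C & forall n x, n%:R ^+ s * `|F n x| <= C.
Proof.
elim=> {F} [c p b S pb sS LS|F G _ [C C0 FC] _ [D D0 GD]]; last first.
  exists (C + D) => [|n x]; first exact: addr_ge0.
  rewrite (le_trans _ (lerD (FC n x) (GD n x)))// -mulrDr ler_wpM2l ?exprn_ge0//.
  exact: ler_normD.
(* [H] collects what [localized_power_bound] leaves, a polynomial in [u]; it is bounded on the
   support of [S]. *)
pose H x := (2 * (1 + u x ^+ 2)) ^+ (c + s) * u x ^+ e.
have sH : smooth H.
  apply: (smoothM (fun x => (2 * (1 + u x ^+ 2)) ^+ (c + s)) (fun x => u x ^+ e)
    _ (smoothX _ _ su)).
  apply: (smoothX (fun x => 2 * (1 + u x ^+ 2))).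
  apply: (smoothM (fun=> 2) (fun x => 1 + u x ^+ 2) (smooth_cst _)).
  exact: (smoothD (fun=> 1) (fun x => u x ^+ 2) (smooth_cst _) (smoothX _ _ su)).
have [C C0 HC] := supported_bounded L _ (smooth_continuous _ (smoothM H S sH sS))
  (supportedMl _ _ _ LS).
exists ((c + s)`!%:R * C) => [|n x]; first by rewrite mulr_ge0.
apply: (@le_trans _ _ ((c + s)`!%:R * `|H x * S x|)); last by rewrite ler_wpM2l.
have B := localized_power_bound (u x) n (c + s) p b pb.
rewrite /loc_term /H !normrM.
have q0 : 0 <= (1 + (u x ^+ n) ^+ 2)^-1 by rewrite invr_ge0 addr_ge0// sqr_ge0.
rewrite [`|n%:R ^+ c|]ger0_norm ?exprn_ge0// [`|(_ ^-1) ^+ _|]ger0_norm ?exprn_ge0//.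
rewrite [`|(2 * _) ^+ _|]ger0_norm ?exprn_ge0 ?mulr_ge0 ?addr_ge0 ?sqr_ge0//.
rewrite [`|(u x ^+ n) ^+ _|]normrX [`|(_ - 1) ^+ _|]normrX.
have := ler_wpM2r (mulr_ge0 (normr_ge0 (u x ^+ e)) (normr_ge0 (S x))) B.
congr (_ <= _); last by ring.
by rewrite exprD; ring.
Qed.

End localized_powers.

(** * Decay in [n] of the Sobolev-type norm *)

Section localized_decay.
Context {R : realType} {d : nat}.
Variables (u : 'rV[R]_d -> R) (chi : 'rV[R]_d -> R).
Hypotheses (su : smooth u) (tc : test_fun chi).

(** After the [2d] derivatives of [test_norm] no spare power of [u] remains, and one power of
    [u^2 - 1] is left to give the factor [1 / n]. *)
Definition loc_chi (n : nat) (x : 'rV[R]_d) : R :=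
  u x ^+ n / (1 + (u x ^+ n) ^+ 2) * ((u x ^+ 2 - 1) ^+ d.*2.+1 * (u x ^+ d.*2 * chi x)).

Lemma smooth_loc_power n : smooth (fun x => u x ^+ n / (1 + (u x ^+ n) ^+ 2)).
Proof.
apply: (smoothM (fun x => u x ^+ n) (fun x => (1 + (u x ^+ n) ^+ 2)^-1) (smoothX _ _ su)).
apply: (smoothV (fun x => 1 + (u x ^+ n) ^+ 2)); last first.
  by move=> x; rewrite gt_eqF// ltr_wpDr// sqr_ge0.
apply: (smoothD (fun=> 1) (fun x => (u x ^+ n) ^+ 2) (smooth_cst _)).
exact: (smoothX (fun x => u x ^+ n) 2 (smoothX _ _ su)).
Qed.

Lemma test_loc_chi n : test_fun (loc_chi n).
Proof.
apply: (test_smoothM _ (fun x => (u x ^+ 2 - 1) ^+ d.*2.+1 * (u x ^+ d.*2 * chi x))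
  (smooth_loc_power n)).
apply: (test_smoothM (fun x => (u x ^+ 2 - 1) ^+ d.*2.+1) (fun x => u x ^+ d.*2 * chi x)).
  apply: (smoothX (fun x => u x ^+ 2 - 1)).
  exact: (smoothB (fun x => u x ^+ 2) (fun=> 1) (smoothX _ _ su) (smooth_cst _)).
exact: (test_smoothM (fun x => u x ^+ d.*2) chi (smoothX _ _ su) tc).
Qed.

Lemma loc_chi_test_norm : exists2 C, 0 <= C & forall n, n%:R * test_norm (loc_chi n) <= C.
Proof.
have [sc [L cL]] := tc.
have PF : loc_family u L (d.*2 + 0) (d.*2 + 1) loc_chi.
  rewrite (_ : loc_chi = loc_term u (d.*2 + 0) (d.*2 + 1) 0 0 0 chi).
    exact: LocTerm.
  apply/funext => n; apply/funext => x; rewrite /loc_chi /loc_term addn0 add0n addn1 !expr1.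
  by rewrite expr0; ring.
have := loc_family_one_sub_sqr_partials u L su (index_enum 'I_d) 0 1 loc_chi.
have -> : size (index_enum 'I_d) = d by rewrite -[RHS](size_enum_ord d) enumT.
move=> /(_ PF) PG; have [C C0 GC] := loc_family_bound _ _ su _ _ _ PG.
exists (C * \int[lebesgue_rV R d]_x \1_(cube L) x).
  by rewrite mulr_ge0//; apply: Rintegral_ge0 => x _; rewrite indicE.
move=> n; rewrite /test_norm -RintZ; last first.
  exact/Rintegrable_norm/test_integrable/test_one_sub_sqr_partials/test_loc_chi.
rewrite -RintZ; last exact: Rintegrable_obox.
apply: le_Rintegral => //.
- exact/RintegrableZ/Rintegrable_norm/test_integrable/test_one_sub_sqr_partials/test_loc_chi.
- exact: Rintegrable_cube.
move=> x _; have LG := loc_family_supported _ _ _ _ _ n PG.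
have := supported_cube L (fun x => n%:R * one_sub_sqr_partials (index_enum 'I_d) (loc_chi n) x)
  C C0 (supportedMl _ _ _ LG).
rewrite -[n%:R in X in _ -> X]normr_nat -normrM; apply => y _.
by rewrite normrM normr_nat; have := GC n y; rewrite expr1.
Qed.

End localized_decay.

(** * Separation by band-limited functions *)

Section complex_integral.
Context {R : realType} {d : nat}.
Local Notation Re := (@complex.Re R).
Local Notation Im := (@complex.Im R).
Local Notation mu := (lebesgue_rV R d).
Local Notation S := (schwartz R d).
Local Notation normc := (@Normc.normc R).
Implicit Types (f g h phi : 'rV[R]_d -> R[i]) (c : R[i]) (x xi eta : 'rV[R]_d)
  (chi : 'rV[R]_d -> R).

Lemma cmeasurableD f g : cmeasurable f -> cmeasurable g -> cmeasurable (f + g).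
Proof.
move=> [fr fi] [gr gi]; split.
  rewrite (_ : Re \o _ = fun x => Re (f x) + Re (g x)); first exact: measurable_funD.
  by apply/funext => x; exact: complexReD.
rewrite (_ : Im \o _ = fun x => Im (f x) + Im (g x)); first exact: measurable_funD.
by apply/funext => x; exact: complexImD.
Qed.

Lemma cmeasurableM f g : cmeasurable f -> cmeasurable g -> cmeasurable (fun x => f x * g x).
Proof.
move=> [fr fi] [gr gi]; split.
  rewrite (_ : Re \o _ = fun x => Re (f x) * Re (g x) - Im (f x) * Im (g x)).
    by apply: measurable_funB; exact: measurable_funM.
  by apply/funext => x; exact: complexReM.
rewrite (_ : Im \o _ = fun x => Re (f x) * Im (g x) + Im (f x) * Re (g x)).
  by apply: measurable_funD; exact: measurable_funM.
by apply/funext => x; exact: complexImM.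
Qed.

Lemma cmeasurable_cst c : cmeasurable (fun _ : 'rV[R]_d => c).
Proof. by split; exact: measurable_cst. Qed.

Lemma cmeasurableZ c f : cmeasurable f -> cmeasurable (c *: f).
Proof. exact: cmeasurableM (cmeasurable_cst c). Qed.

Lemma measurable_normc f : cmeasurable f ->
  measurable_fun [set: 'rV[R]_d] (fun x => normc (f x)).
Proof.
move=> [fr fi]; rewrite (_ : (fun x => _) =
    fun x => Num.sqrt (Re (f x) ^+ 2 + Im (f x) ^+ 2)).
  apply: measurableT_comp; first by apply: continuous_measurable_fun; exact: sqrt_continuous.
  by apply: measurable_funD; exact: measurable_funX.
by apply/funext => x; case: (f x).
Qed.

Definition cintegrable f :=
  Rintegrable mu (fun x => Re (f x)) /\ Rintegrable mu (fun x => Im (f x)).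

Lemma cintegrable_dom f (g : 'rV[R]_d -> R) : cmeasurable f -> Rintegrable mu g ->
  (forall x, normc (f x) <= g x) -> cintegrable f.
Proof.
move=> [fr fi] ig fg; split; apply: (Rintegrable_dom _ _ _ _ ig) => // x.
  by rewrite (le_trans (Re_normc _)).
by rewrite (le_trans (Im_normc _)).
Qed.

Lemma cintegral_le f (g : 'rV[R]_d -> R) : cmeasurable f -> Rintegrable mu g ->
  (forall x, normc (f x) <= g x) -> normc (cintegral f) <= 2 * \int[mu]_x g x.
Proof.
move=> [fr fi] ig fg; rewrite (le_trans (normc_le_Re_Im _))// mulr_natl mulr2n /=.
rewrite lerD//; apply: Rint_norm_le => // x.
  by rewrite (le_trans (Re_normc _)).
by rewrite (le_trans (Im_normc _)).
Qed.

Lemma cintegral_ae_eq f g : cmeasurable f -> cmeasurable g -> aeeq f g ->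
  cintegral f = cintegral g.
Proof.
move=> [fr fi] [gr gi] fg; rewrite /cintegral; congr (_ +i* _).
  by apply: Rint_ae_eq => //; apply: filterS fg => x /= -> .
by apply: Rint_ae_eq => //; apply: filterS fg => x /= -> .
Qed.

Lemma cintegralD f g : cintegrable f -> cintegrable g ->
  cintegral (fun x => f x + g x) = cintegral f + cintegral g.
Proof.
move=> [fr fi] [gr gi]; rewrite /cintegral; apply: complex_eq => /=.
  by rewrite -RintD//; apply: eq_Rintegral => x _; exact: complexReD.
by rewrite -RintD//; apply: eq_Rintegral => x _; exact: complexImD.
Qed.

Lemma cintegralZ c f : cintegrable f ->
  cintegral (fun x => c * f x) = c * cintegral f.
Proof.
move=> [fr fi]; rewrite /cintegral; apply: complex_eq; rewrite ?complexReM ?complexImM /=.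
  rewrite -!RintZ// -RintB; [|exact: RintegrableZ..].
  by apply: eq_Rintegral => x _; rewrite complexReM.
rewrite -!RintZ// -RintD; [|exact: RintegrableZ..].
by apply: eq_Rintegral => x _; rewrite complexImM.
Qed.

Lemma cintegrableZ c f : cintegrable f -> cintegrable (fun x => c * f x).
Proof.
move=> [fr fi]; split.
  rewrite (_ : (fun x => _) = fun x => Re c * Re (f x) - Im c * Im (f x)).
    by apply: RintegrableB; exact: RintegrableZ.
  by apply/funext => x; rewrite complexReM.
rewrite (_ : (fun x => _) = fun x => Re c * Im (f x) + Im c * Re (f x)).
  by apply: RintegrableD; exact: RintegrableZ.
by apply/funext => x; rewrite complexImM.
Qed.

(** The condition that makes the pairing with any function dominated by a multiple of [weight]
    absolutely convergent. *)
Definition wintegrable g :=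
  cmeasurable g /\ Rintegrable mu (fun x => normc (g x) * weight x).

Definition wnorm g : R := \int[mu]_x (normc (g x) * weight x).

Lemma wintegrableZ c g : wintegrable g -> wintegrable (c *: g).
Proof.
move=> [mg ig]; split; first exact: cmeasurableZ.
have := RintegrableZ _ (normc c) _ ig; congr Rintegrable; apply/funext => x.
by rewrite mulrA -Normc.normcM.
Qed.

Lemma wintegrableD f g : wintegrable f -> wintegrable g -> wintegrable (f + g).
Proof.
move=> [mf if_] [mg ig]; split; first exact: cmeasurableD.
apply: (Rintegrable_dom _ _ (fun x => normc (f x) * weight x + normc (g x) * weight x)).
- apply: (measurable_funM (measurable_normc _ (cmeasurableD _ _ mf mg))).
  exact: (Rintegrable_measurable _ _ (@Rintegrable_weight R d)).
- exact: RintegrableD.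
- move=> x; rewrite ger0_norm ?mulr_ge0 ?normc_ge0 ?(ltW (weight_gt0 _))//.
  rewrite -mulrDl ler_wpM2r ?(ltW (weight_gt0 _))//.
  by rewrite -lecR rmorphD -!norm_normc; exact: ler_normD.
Qed.

Section pairing.
Variables (g phi : 'rV[R]_d -> R[i]) (K : R).
Hypotheses (wg : wintegrable g) (mphi : cmeasurable phi)
  (phiK : forall x, normc (phi x) <= K * weight x).

Let bnd x : normc (g x * phi x) <= K * (normc (g x) * weight x).
Proof.
by rewrite Normc.normcM mulrCA ler_wpM2l// normc_ge0.
Qed.

Lemma cintegrable_pairing : cintegrable (fun x => g x * phi x).
Proof.
apply: (cintegrable_dom _ (fun x => K * (normc (g x) * weight x))) => //.
  by apply: cmeasurableM => //; exact: wg.1.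
by apply: RintegrableZ; exact: wg.2.
Qed.

Lemma pairing_bound : normc (cintegral (fun x => g x * phi x)) <= 2 * (K * wnorm g).
Proof.
rewrite /wnorm -RintZ; last exact: wg.2.
apply: (cintegral_le _ (fun x => K * (normc (g x) * weight x))) => //.
  by apply: cmeasurableM => //; exact: wg.1.
by apply: RintegrableZ; exact: wg.2.
Qed.

End pairing.

Lemma cmeasurable_ifourier chi : test_fun chi -> cmeasurable (ifourier chi).
Proof.
move=> tc; split; apply: continuous_measurable_rV.
  exact: (continuous_costr 0 _ tc).
exact: (continuous_costr (- (pi / 2)) _ tc).
Qed.

Lemma ifourier_weight_bound chi x : test_fun chi ->
  normc (ifourier chi x) <= 2 * test_norm chi * weight x.
Proof.
move=> tc; rewrite (le_trans (normc_le_Re_Im _))// -mulrA mulr_natl mulr2n /=.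
by rewrite lerD// costr_weight_bound.
Qed.

Lemma cmeasurable_schwartz (phi : S) : cmeasurable phi.
Proof.
by have [? ?] := schwartz_continuous phi; split; exact: continuous_measurable_rV.
Qed.

Lemma costrD (th s : R) chi x : test_fun chi ->
  costr (th + s) chi x = cos s * costr th chi x + sin s * costr (th + pi / 2) chi x.
Proof.
move=> tc; have ic := test_integrable _ tc.
rewrite -!RintZ; try exact: Rintegrable_costr.
rewrite -RintD; try by apply: RintegrableZ; exact: Rintegrable_costr.
apply: eq_Rintegral => z _; rewrite !addrA cosDpihalf [cos (_ + th + s)]cosD; ring.
Qed.

Lemma ifourier_bump (N : R) eta x : 0 < N ->
  ifourier (flat_bump N eta) x = ifourier (flat_bump N 0) x * expi (dotp x eta).
Proof.
move=> N0; have tb := test_flat_bump N (0 : 'rV[R]_d) N0.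
rewrite [dotp x eta]dotpC; apply: complex_eq; rewrite ?complexReM ?complexImM /=.
  rewrite costr_bump_shift// costrD// add0r.
  rewrite [X in sin _ * X](_ : _ = - costr (- (pi / 2)) (flat_bump N 0) x).
    by ring.
  rewrite -RintN; last by apply: Rintegrable_costr; exact: test_integrable.
  by apply: eq_Rintegral => z _; rewrite cosDpihalf cosBpihalf mulrN.
by rewrite costr_bump_shift// costrD// addNr; ring.
Qed.

(* Multiplying by the inverse transform of a bump makes [g] integrable, and the
   Fourier transform of the product is a pairing of [g] with a translated flat_bump. *)
Lemma separation g : wintegrable g ->
  (forall chi, test_fun chi -> cintegral (fun x => g x * ifourier chi x) = 0) ->
  aeeq g 0.
Proof.
move=> wg g0.
have N0 (n : nat) : 0 < n.+1%:R :> R by [].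
have H (n : nat) : {ae mu, forall x, g x * ifourier (flat_bump n.+1%:R 0) x = 0}.
  have tb := test_flat_bump n.+1%:R (0 : 'rV[R]_d) (N0 n).
  have [ir ii] := cintegrable_pairing _ _ _ wg (cmeasurable_ifourier _ tb)
    (fun x => ifourier_weight_bound _ x tb).
  apply: fourier_uniqueness => //; apply: aeW => xi.
  rewrite -[RHS](g0 _ (test_flat_bump n.+1%:R (- xi) (N0 n))).
  congr cintegral; apply/funext => x; rewrite [in RHS]ifourier_bump// mulrA.
  by congr (_ * expi _); rewrite [in RHS]dotpC dotpNl dotpC.
have := ae_foralln H; apply: filterS => x gx _.
(* Each bump only has a transform known to be nonzero on a bounded set, so [n] is chosen after [x];
   the exceptional null sets are countably many. *)
pose n := Num.bound (2 * \sum_i `|x ord0 i|).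
have xn : \sum_i `|x ord0 i| <= n.+1%:R / 2.
  rewrite ler_pdivlMr// mulrC (@le_trans _ _ n%:R)//; last by rewrite ler_nat.
  by apply/ltW/archi_boundP; rewrite mulr_ge0// sumr_ge0.
have := costr_bump_gt0 _ x (N0 n) xn => cp.
have := gx n => /eqP; rewrite mulf_eq0 => /orP[/eqP//|].
by rewrite eq_complex /= gt_eqF.
Qed.

Lemma trigintB (A B A' B' : 'rV[R]_d -> R) xi :
  Rintegrable mu A -> Rintegrable mu B -> Rintegrable mu A' -> Rintegrable mu B' ->
  trigint (fun x => A x - A' x) (fun x => B x - B' x) xi =
  trigint A B xi - trigint A' B' xi.
Proof.
move=> iA iB iA' iB'; rewrite /trigint -RintB; try exact: Rintegrable_trig.
by apply: eq_Rintegral => x _; ring.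
Qed.

Lemma fourierB f g xi : cintegrable f -> cintegrable g ->
  fourier (fun x => f x - g x) xi = fourier f xi - fourier g xi.
Proof.
move=> [fr fi] [gr gi]; rewrite !fourierE; apply: complex_eq => /=.
  rewrite -trigintB//; try exact: RintegrableN.
  apply: eq_Rintegral => x _; case: (f x) (g x) => [? ?] [? ?] /=; ring.
rewrite -trigintB//.
by apply: eq_Rintegral => x _; case: (f x) (g x) => [? ?] [? ?] /=; ring.
Qed.

(** The adjoint applied to [ifourier chi] and the function [ifourier] of [m (- xi) * chi xi] have
    the same transform almost everywhere, so they agree almost everywhere by uniqueness. *)
Lemma multiplier_eq_ifourier m (Theta : S -> S) f g chi : is_multiplier m Theta ->
  (forall xi, m xi \is Num.real) -> wintegrable f -> multiplier_eq m Theta f g ->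
  test_fun chi ->
  cintegral (fun x => g x * ifourier chi x) =
  cintegral (fun x => f x * ifourier (fun xi => Re (m (- xi)) * chi xi) x).
Proof.
move=> mT mreal wf fg tc.
have [[smr smi] _ _ FT] := multiplier_adjP _ _ mT mreal.
have tmc : test_fun (fun xi => Re (m (- xi)) * chi xi).
  exact: (test_smoothM (fun xi => Re (m (- xi))) chi smr tc).
have := congr1 (fun T => T (schwartz_ifourier chi tc)) fg.
rewrite /multiplier_ext /regular_distribution /= => <-.
set psi := multiplier_adj _ _ _ in FT *.
apply: cintegral_ae_eq.
- by apply: cmeasurableM; [exact: wf.1|exact: cmeasurable_schwartz].
- by apply: cmeasurableM; [exact: wf.1|exact: cmeasurable_ifourier].
pose psi' := schwartz_ifourier _ tmc.
have : {ae mu, forall x, (psi - psi' : S) x = 0}.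
  have [? ?] := schwartz_integrable (psi - psi').
  apply: fourier_uniqueness => //.
  near=> xi.
  rewrite [LHS](_ : _ = fourier (fun x => psi x - psi' x) xi)//.
  rewrite fourierB; [|exact: schwartz_integrable..].
  have -> : fourier psi' xi = ((2 * pi) ^+ d * (Re (m (- xi)) * chi xi))%:C.
    by near: xi; exact: fourier_ifourier.
  rewrite FT; have -> : fourier (schwartz_ifourier chi tc) xi = ((2 * pi) ^+ d * chi xi)%:C.
    by near: xi; exact: fourier_ifourier.
  rewrite -[m (- xi)](RRe_real (mreal _)) -rmorphM -rmorphB /=.
  by rewrite mulrCA subrr.
apply: filterS => x /= /eqP; rewrite subr_eq0 => /eqP E _.
by congr (_ * _).
Unshelve. all: by end_near. Qed.

End complex_integral.

(** * From [L^p] bounds to weighted [L^1] bounds *)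

Section lebesgue_spaces.
Context {R : realType} {d : nat}.
Local Notation mu := (lebesgue_rV R d).
Local Notation normc := (@Normc.normc R).
Implicit Types (f g h : 'rV[R]_d -> R[i]) (p : \bar R).

Lemma Lnorm_mono p (F G : 'rV[R]_d -> R) : (1 <= p)%E ->
  measurable_fun [set: 'rV[R]_d] F -> measurable_fun [set: 'rV[R]_d] G ->
  (forall x, `|F x| <= `|G x|) ->
  ('N[mu]_p[EFin \o F] <= 'N[mu]_p[EFin \o G])%E.
Proof.
move=> p1 mF mG FG; rewrite unlock /Lnorm; case: p p1 => [r|_|//]; last first.
  case: ifPn => // _; apply: ess_sup_inf.le_ess_sup; apply: aeW => x /=.
  by rewrite lee_fin.
rewrite lee_fin => r1; have r0 : 0 <= r by rewrite (le_trans ler01).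
apply: gt0_ler_poweR; rewrite ?invr_ge0//.
- by rewrite in_itv /= leey andbT integral_ge0// => x _; exact: poweR_ge0.
- by rewrite in_itv /= leey andbT integral_ge0// => x _; exact: poweR_ge0.
apply: ge0_le_integral => //.
- by move=> x _; exact: poweR_ge0.
- apply: (@measurableT_comp _ _ _ _ _ _ (fun y : \bar R => poweR y r)).
    exact: measurable_poweR.
  by apply: measurableT_comp => //; exact/measurable_EFinP.
- apply: (@measurableT_comp _ _ _ _ _ _ (fun y : \bar R => poweR y r)).
    exact: measurable_poweR.
  by apply: measurableT_comp => //; exact/measurable_EFinP.
- move=> x _ /=; rewrite lee_fin ge0_ler_powR// nnegrE//.
Qed.

Lemma in_Lp_le_add p f g h : (1 <= p)%E -> in_Lp p f -> in_Lp p g -> cmeasurable h ->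
  (forall x, normc (h x) <= normc (f x) + normc (g x)) -> in_Lp p h.
Proof.
move=> p1 [mf Nf] [mg Ng] mh hfg; split=> //.
have mf' := measurable_normc _ mf; have mg' := measurable_normc _ mg.
have mh' := measurable_normc _ mh.
apply: le_lt_trans (le_lt_trans (eminkowski mu mf' mg' p1) _); last exact: lte_add_pinfty.
apply: Lnorm_mono => //; first exact: measurable_funD.
by move=> x; rewrite !ger0_norm ?addr_ge0 ?normc_ge0.
Qed.

(** A pointwise substitute for Hoelder's inequality: [W] alone dominates when [t <= 1], and [t ^ r]
    alone when [t > 1]. *)
Lemma mul_weight_le (t W r : R) : 0 <= t -> 0 <= W <= 1 -> 1 <= r -> t * W <= t `^ r + W.
Proof.
move=> t0 /andP[W0 W1] r1; have [tl|tg] := leP t 1.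
  by rewrite -[X in X <= _]add0r lerD ?powR_ge0// ler_piMl.
rewrite -[X in X <= _]addr0 lerD// (@le_trans _ _ t)// ?ler_piMr//.
by rewrite -{1}(powRr1 t0) ler_powR// ltW.
Qed.

(** [K] is chosen before [f], so that one constant serves a whole sequence bounded by [M]. *)
Lemma cLnorm_wnorm p (M : R) : (1 <= p)%E -> exists K, forall f, cmeasurable f ->
  (cLnorm p f <= M%:E)%E -> wintegrable f /\ wnorm f <= K.
Proof.
have iW := @Rintegrable_weight R d.
have W0 x : 0 <= @weight R d x by exact/ltW/weight_gt0.
case: p => [r|_|//]; last first.
  exists (`|M| * \int[mu]_x weight x) => f mf fM; have mf' := measurable_normc _ mf.
  (* The bound by [M] holds almost everywhere; truncating at [|M|] makes it hold everywhere, as the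
     domination lemma requires. *)
  have ae : {ae mu, forall x, normc (f x) * weight x =
      Num.min (normc (f x)) `|M| * weight x}.
    suff : {ae mu, forall x, normc (f x) <= M}.
      by apply: filterS => x fx; rewrite min_l// (le_trans fx)// ler_norm.
    move: fM; rewrite /cLnorm unlock /Lnorm; case: ifPn => [_ /ess_sup_inf.ess_supP|].
      by apply: filterS => x /=; rewrite lee_fin => /(le_trans (ler_norm _)).
    (* The norm at infinity is defined by cases on whether the space has positive measure; if not,
       every property holds almost everywhere. *)
    rewrite -leNgt => mu0 _; exists setT; split=> //.
    by apply/eqP; rewrite eq_le mu0 measure_ge0.
  have mm : measurable_fun [set: 'rV[R]_d] (fun x => Num.min (normc (f x)) `|M| * weight x).
    apply: measurable_funM; last exact: (Rintegrable_measurable _ _ iW).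
    by apply: measurable_minr => //; exact: measurable_cst.
  have m1 : measurable_fun [set: 'rV[R]_d] (fun x => normc (f x) * weight x).
    by apply: measurable_funM => //; exact: (Rintegrable_measurable _ _ iW).
  have ii : Rintegrable mu (fun x => Num.min (normc (f x)) `|M| * weight x).
    apply: (Rintegrable_dom _ _ (fun x => `|M| * weight x)) => //; first exact: RintegrableZ.
    move=> x; rewrite ger0_norm ?mulr_ge0// ?le_min ?normc_ge0//=.
    by rewrite ler_wpM2r// ge_min lexx orbT.
  split; first split=> //.
    by apply: (Rintegrable_ae_eq _ _ _ ii) => //; apply: filterS ae => x.
  rewrite /wnorm (Rint_ae_eq _ _ _ m1 mm ae) -RintZ//; apply: le_Rintegral => //.
    exact: RintegrableZ.
  by move=> x _; rewrite ler_wpM2r// ge_min lexx orbT.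
rewrite lee_fin => r1; have r0 : 0 < r by rewrite (lt_le_trans ltr01).
exists (`|M| `^ r + \int[mu]_x weight x) => f mf fM; have mf' := measurable_normc _ mf.
have mp : measurable_fun [set: 'rV[R]_d] (fun x => normc (f x) `^ r).
  by apply: (@measurableT_comp _ _ _ _ _ _ (fun y : R => y `^ r)) => //; exact: measurable_powR.
have B : (\int[mu]_x (normc (f x) `^ r)%:E <= (`|M| `^ r)%:E)%E.
  have := poweR_Lnorm mu (EFin \o normc \o f) (lt0r_neq0 r0).
  under eq_integral do rewrite /= ger0_norm ?normc_ge0//.
  move=> <-; rewrite -poweR_EFin; apply: gt0_ler_poweR; first exact: ltW.
  - by rewrite in_itv /= leey andbT Lnorm_ge0.
  - by rewrite in_itv /= leey andbT.
  - by apply: le_trans fM _; rewrite lee_fin ler_norm.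
have ip : Rintegrable mu (fun x => normc (f x) `^ r).
  apply/integrableP; split; first exact/measurable_EFinP.
  under eq_integral do rewrite /= ger0_norm ?powR_ge0//.
  by rewrite (le_lt_trans B)// ltry.
have le x : normc (f x) * weight x <= normc (f x) `^ r + weight x.
  by rewrite mul_weight_le// ?normc_ge0// W0 weight_le1.
have m1 : measurable_fun [set: 'rV[R]_d] (fun x => normc (f x) * weight x).
  by apply: measurable_funM => //; exact: (Rintegrable_measurable _ _ iW).
have iD := RintegrableD _ _ _ ip iW.
have iw : Rintegrable mu (fun x => normc (f x) * weight x).
  apply: (Rintegrable_dom _ _ _ m1 iD) => x.
  by rewrite ger0_norm// mulr_ge0// normc_ge0.
split; first by [].
apply: (@le_trans _ _ (\int[mu]_x (normc (f x) `^ r + weight x))).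
  by apply: le_Rintegral => // x _; exact: le.
rewrite RintD// lerD2r -lee_fin (le_trans _ B)// /Rintegral fineK//.
exact: integrable_fin_num.
Qed.

Lemma in_Lp_wintegrable p f : (1 <= p)%E -> in_Lp p f -> wintegrable f.
Proof.
move=> p1 [mf Nf]; have [K HK] := cLnorm_wnorm p (fine (cLnorm p f)) p1.
have [|//] := HK f mf; rewrite fineK// ge0_fin_numE//; exact: Lnorm_ge0.
Qed.

End lebesgue_spaces.

Section complex_norm_facts.
Context {R : realType}.
Implicit Types (z w : R[i]).
Local Notation normc := (@Normc.normc R).

Lemma normcD z w : normc (z + w) <= normc z + normc w.
Proof. by rewrite -lecR rmorphD -!norm_normc; exact: ler_normD. Qed.

Lemma normcB z w : normc (z - w) <= normc z + normc w.
Proof. by rewrite -lecR rmorphD -!norm_normc; exact: ler_normB. Qed.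

Lemma normc_real (t : R) : normc t%:C = `|t|.
Proof. by rewrite /= expr0n addr0 sqrtr_sqr. Qed.

Lemma normcX z n : normc (z ^+ n) = normc z ^+ n.
Proof.
elim: n => [|n ih]; first by rewrite (normc_real 1) normr1.
by rewrite !exprS Normc.normcM ih.
Qed.

Lemma le0_natmul_bounded (t B : R) : (forall n, n%:R * t <= B) -> t <= 0.
Proof.
move=> tB; have [//|t0] := leP t 0.
have := archi_boundP (divr_ge0 (normr_ge0 B) (ltW t0)).
rewrite ltr_pdivrMr// => /lt_le_trans/(_ (tB _)).
by rewrite ltNge ler_norm.
Qed.

(** Such a sequence is affine in [n], and a bounded affine sequence has slope zero. *)
Lemma bounded_second_difference0 (v : nat -> R[i]) (B : R) :
  (forall n, normc (v n) <= B) -> (forall n, v n.+2 - v n.+1 *+ 2 + v n = 0) -> v 1%N = v 0%N.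
Proof.
move=> vB dv; apply/eqP; rewrite -subr_eq0; apply/eqP; apply: Normc.eq0_normc.
have E n : v n.+1 - v n = v 1%N - v 0%N /\ v n = v 0%N + (v 1%N - v 0%N) *+ n.
  elim: n => [|n [ih1 ih2]]; first by rewrite mulr0n addr0.
  split; last by rewrite mulrSr addrA -ih2 -ih1 addrC subrK.
  rewrite -ih1; apply/eqP; rewrite -subr_eq0 -[X in _ == X](dv n); apply/eqP.
  by rewrite mulr2n; ring.
apply/eqP; rewrite eq_le normc_ge0 andbT.
apply: (le0_natmul_bounded _ (B + B)) => n.
rewrite -[n%:R]normr_nat -normc_real -Normc.normcM.
rewrite (_ : n%:R%:C * _ = v n - v 0%N); last first.
  by rewrite (E n).2 [in RHS](addrC (v 0%N)) addrK -[RHS]mulr_natl rmorph_nat.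
by rewrite (le_trans (normcB _ _))// lerD.
Qed.

End complex_norm_facts.

(** * Functionals shifted by a multiplication operator *)

Section shift_functionals.
Context {R : realType} {d : nat}.
Local Notation normc := (@Normc.normc R).
Variables (u : 'rV[R]_d -> R) (T : int -> ('rV[R]_d -> R) -> R[i]) (w : R[i]) (K : R).
Hypotheses (su : smooth u) (w1 : normc w = 1) (K0 : 0 <= K).
Hypothesis Tlin : forall k (a b : R) chi1 chi2, test_fun chi1 -> test_fun chi2 ->
  T k (fun x => a * chi1 x + b * chi2 x) = a%:C * T k chi1 + b%:C * T k chi2.
Hypothesis Tbnd : forall k chi, test_fun chi -> normc (T k chi) <= K * test_norm chi.
Hypothesis Tshift : forall k chi, test_fun chi ->
  T k (fun x => u x * chi x) = w * T (k + 1) chi.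
Implicit Types (chi g : 'rV[R]_d -> R) (k : int).

Let V x : R := u x ^+ 2 - 1.

Let sV : smooth V.
Proof.
exact: (smoothB (fun x => u x ^+ 2) (fun=> 1) (smoothX _ _ su) (smooth_cst _)).
Qed.

Let testu n g : test_fun g -> test_fun (fun x => u x ^+ n * g x).
Proof. exact: (test_smoothM (fun x => u x ^+ n) g (smoothX _ _ su)). Qed.

Let testV n g : test_fun g -> test_fun (fun x => V x ^+ n * g x).
Proof. exact: (test_smoothM (fun x => V x ^+ n) g (smoothX _ _ sV)). Qed.

Lemma shift_pow k n chi : test_fun chi ->
  T k (fun x => u x ^+ n * chi x) = w ^+ n * T (k + n%:Z) chi.
Proof.
move=> tc; elim: n k => [|n ih] k.
  by rewrite expr0 mul1r addr0; congr (T k); apply/funext => x; rewrite expr0 mul1r.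
rewrite (_ : (fun x => _) = fun x => u x * (u x ^+ n * chi x)); last first.
  by apply/funext => x; rewrite exprS mulrA.
by rewrite (Tshift _ _ (testu n _ tc)) ih exprS mulrA -addrA -intS.
Qed.

Lemma normc_shift_pow k n chi : test_fun chi ->
  normc (T k (fun x => u x ^+ n * chi x)) = normc (T (k + n%:Z) chi).
Proof. by move=> tc; rewrite shift_pow// Normc.normcM normcX w1 expr1n mul1r. Qed.

(* With [h_n = u^n / (1 + u^(2n))], a test function [G] splits as
   [u^n (h_n G) + G / (1 + u^(2n))]; up to unimodular factors, [T k] of the first summand is
   [T (k + n) (h_n G)] and [T k] of the second one is [T (k - n) (h_n G)]. *)
Lemma shift_loc_vanish k chi : test_fun chi ->
  T k (fun x => V x ^+ d.*2.+1 * (u x ^+ d.*2 * chi x)) = 0.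
Proof.
move=> tc; set G := fun x => _; have tG : test_fun G by exact/testV/testu.
have [C C0 HC] := loc_chi_test_norm u chi su tc.
apply: Normc.eq0_normc; apply/eqP; rewrite eq_le normc_ge0 andbT.
apply: (le0_natmul_bounded _ (K * C + K * C)) => n.
pose q x := (1 + (u x ^+ n) ^+ 2)^-1.
have den x : 1 + (u x ^+ n) ^+ 2 != 0 by rewrite gt_eqF// ltr_wpDr// sqr_ge0.
have sq : smooth q.
  apply: (smoothV (fun x => 1 + (u x ^+ n) ^+ 2) _ den).
  apply: (smoothD (fun=> 1) (fun x => (u x ^+ n) ^+ 2) (smooth_cst _)).
  exact: (smoothX (fun x => u x ^+ n) 2 (smoothX _ _ su)).
have tq : test_fun (fun x => q x * G x) := test_smoothM q G sq tG.
have tl : test_fun (loc_chi u chi n) := test_loc_chi u chi su tc n.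
have E : G = fun x => 1 * (u x ^+ n * loc_chi u chi n x) + 1 * (q x * G x).
  by apply/funext => x; rewrite /loc_chi -/(V x) /q /G; field; exact: den.
have N1 : normc (T k (fun x => u x ^+ n * loc_chi u chi n x)) <= K * test_norm (loc_chi u chi n).
  by rewrite normc_shift_pow// Tbnd.
have N2 : normc (T k (fun x => q x * G x)) <= K * test_norm (loc_chi u chi n).
  rewrite -[k](subrK n%:Z) -(normc_shift_pow _ n _ tq).
  rewrite (_ : (fun x => _) = loc_chi u chi n); first exact: Tbnd.
  by apply/funext => x; exact: mulrA.
rewrite E Tlin ?mul1r; [|exact: testu|exact: tq].
apply: (@le_trans _ _ (n%:R * (K * test_norm (loc_chi u chi n) +
    K * test_norm (loc_chi u chi n)))).
  by rewrite ler_wpM2l// (le_trans (normcD _ _))// lerD.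
by rewrite mulrDr mulrCA lerD// ler_wpM2l.
Qed.

Lemma shift_power_vanish k chi : test_fun chi ->
  T k (fun x => V x ^+ d.*2.+1 * chi x) = 0.
Proof.
move=> tc; apply: Normc.eq0_normc.
rewrite -[k](subrK d.*2%:Z) -(normc_shift_pow _ _ _ (testV _ _ tc)).
rewrite (_ : (fun x => _) = fun x => V x ^+ d.*2.+1 * (u x ^+ d.*2 * chi x)).
  by rewrite shift_loc_vanish// /= expr0n addr0 sqrtr0.
by apply/funext => x; rewrite mulrCA.
Qed.

(* The sequence [n |-> T k (u^(2n) V^j chi)] is bounded with zero second difference, hence
   constant. *)
Lemma shift_power_descent j :
  (forall k chi, test_fun chi -> T k (fun x => V x ^+ j.+2 * chi x) = 0) ->
  forall k chi, test_fun chi -> T k (fun x => V x ^+ j.+1 * chi x) = 0.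
Proof.
move=> H k chi tc; pose g x := V x ^+ j * chi x; have tg : test_fun g by exact: testV.
pose v n := T k (fun x => u x ^+ n.*2 * g x).
have vB n : normc (v n) <= K * test_norm g by rewrite /v normc_shift_pow// Tbnd.
have := bounded_second_difference0 v _ vB.
have Tcomb n : T k (fun x => u x ^+ n.*2 * (V x * g x)) = v n.+1 - v n.
  rewrite (_ : (fun x => _) = fun x => 1 * (u x ^+ n.+1.*2 * g x) + -1 * (u x ^+ n.*2 * g x)).
    by rewrite Tlin; [rewrite mul1r rmorphN mulN1r|exact: testu..].
  by apply/funext => x; rewrite doubleS !exprS /V; ring.
have tVg : test_fun (fun x => V x * g x) by exact: (test_smoothM V g sV tg).
move=> vE; have : v 1%N = v 0%N.
  apply: vE => n; have := H k _ (testu n.*2 _ tc).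
  rewrite (_ : (fun x => _) = fun x => 1 * (u x ^+ n.+1.*2 * (V x * g x)) +
     -1 * (u x ^+ n.*2 * (V x * g x))); last first.
    by apply/funext => x; rewrite doubleS !exprS /g /V; ring.
  rewrite Tlin; [|exact: testu..].
  by rewrite !Tcomb => <-; rewrite mul1r rmorphN mulN1r mulr2n; ring.
move/eqP; rewrite -subr_eq0 -Tcomb => /eqP <-; congr (T k); apply/funext => x.
by rewrite expr0 mul1r /g exprS mulrA.
Qed.

Lemma shift_vanish k chi : test_fun chi -> T k (fun x => (u x ^+ 2 - 1) * chi x) = 0.
Proof.
have H j : (forall k chi, test_fun chi -> T k (fun x => V x ^+ j.+1 * chi x) = 0) ->
    forall k chi, test_fun chi -> T k (fun x => V x ^+ 1 * chi x) = 0.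
  by elim: j => // j ih /shift_power_descent.
exact: (H _ shift_power_vanish k chi).
Qed.

End shift_functionals.

(** * Bilateral sequences *)

Section regular_distributions.
Context {R : realType} {d : nat}.
Local Notation mu := (lebesgue_rV R d).
Local Notation S := (schwartz R d).
Local Notation normc := (@Normc.normc R).
Implicit Types (f g h : 'rV[R]_d -> R[i]) (a b c : R[i]) (chi : 'rV[R]_d -> R) (phi : S).

Lemma scale_funE c f x : (c *: f) x = c * f x.
Proof. by []. Qed.

Lemma regular_distribution_lin a b f g phi : wintegrable f -> wintegrable g ->
  regular_distribution (a *: f + b *: g) phi =
  a * regular_distribution f phi + b * regular_distribution g phi.
Proof.
move=> wf wg; rewrite /regular_distribution; have [L L0 phiL] := schwartz_decay phi.
have jf := cintegrable_pairing f phi L wf (cmeasurable_schwartz phi) phiL.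
have jg := cintegrable_pairing g phi L wg (cmeasurable_schwartz phi) phiL.
rewrite -!cintegralZ// -cintegralD; [|exact: cintegrableZ..].
congr cintegral; apply/funext => x.
rewrite [(_ + _) x](_ : _ = a * f x + b * g x)//; ring.
Qed.

Lemma regular_distribution_ae f g : cmeasurable f -> cmeasurable g -> aeeq f g ->
  regular_distribution f = regular_distribution g.
Proof.
move=> mf mg fg; apply/funext => phi; apply: cintegral_ae_eq.
- exact: cmeasurableM mf (cmeasurable_schwartz phi).
- exact: cmeasurableM mg (cmeasurable_schwartz phi).
- by apply: filterS fg => x /= fgx _; rewrite fgx.
Qed.

Lemma separation_eq f g c : wintegrable f -> wintegrable g ->
  (forall chi, test_fun chi -> cintegral (fun x => f x * ifourier chi x) =
     c * cintegral (fun x => g x * ifourier chi x)) ->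
  aeeq f (c *: g).
Proof.
move=> wf wg fg; have w : wintegrable (1 *: f + (- c) *: g).
  by apply: wintegrableD; exact: wintegrableZ.
have : aeeq (1 *: f + (- c) *: g) 0.
  apply: separation => // chi tc.
  have := regular_distribution_lin 1 (- c) f g (schwartz_ifourier chi tc) wf wg.
  by rewrite /regular_distribution /= fg// mul1r mulNr subrr.
apply: filterS => x /= H _; have := H I.
rewrite [(_ + _) x](_ : _ = 1 * f x + - c * g x)// mul1r mulNr => /eqP.
by rewrite [(0 : 'rV[R]_d -> R[i]) x](_ : _ = 0)// subr_eq0 => /eqP.
Qed.

Section multiplier_equations.
Variables (m : 'rV[R]_d -> R[i]) (Theta : S -> S).

Lemma multiplier_eq_ae f g g' : cmeasurable g -> cmeasurable g' -> aeeq g g' ->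
  multiplier_eq m Theta f g -> multiplier_eq m Theta f g'.
Proof.
by move=> mg mg' gg' E; rewrite /multiplier_eq E; exact: regular_distribution_ae.
Qed.

Lemma multiplier_eq_lin a b f f' g g' :
  wintegrable f -> wintegrable g -> wintegrable f' -> wintegrable g' ->
  multiplier_eq m Theta f f' -> multiplier_eq m Theta g g' ->
  multiplier_eq m Theta (a *: f + b *: g) (a *: f' + b *: g').
Proof.
move=> wf wg wf' wg' ff' gg'; apply/funext => phi.
rewrite /multiplier_ext !regular_distribution_lin//.
by rewrite -ff' -gg'.
Qed.

End multiplier_equations.

Lemma costr_lin th (a b : R) chi1 chi2 x : test_fun chi1 -> test_fun chi2 ->
  costr th (fun z => a * chi1 z + b * chi2 z) x = a * costr th chi1 x + b * costr th chi2 x.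
Proof.
move=> t1 t2; have i1 := Rintegrable_costr th _ x (test_integrable _ t1).
have i2 := Rintegrable_costr th _ x (test_integrable _ t2).
rewrite -!RintZ// -RintD; [|exact: RintegrableZ..].
by apply: eq_Rintegral => z _; rewrite mulrDl !mulrA.
Qed.

Lemma ifourier_lin (a b : R) chi1 chi2 x : test_fun chi1 -> test_fun chi2 ->
  ifourier (fun z => a * chi1 z + b * chi2 z) x =
  a%:C * ifourier chi1 x + b%:C * ifourier chi2 x.
Proof.
move=> t1 t2; apply: complex_eq => /=; rewrite costr_lin//; ring.
Qed.

End regular_distributions.

(** * Relations between the terms of the bilateral sequence *)

Section bilateral_sequence.
Context {R : realType} {d : nat}.
Local Notation Re := (@complex.Re R).
Local Notation S := (schwartz R d).
Local Notation normc := (@Normc.normc R).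
Variables (m : 'rV[R]_d -> R[i]) (Theta : S -> S) (f : int -> 'rV[R]_d -> R[i]) (A : R[i]) (K : R).
Hypothesis mT : is_multiplier m Theta.
Hypothesis mreal : forall xi, m xi \is Num.real.
Hypothesis A0 : A != 0.
Hypothesis wf : forall k, wintegrable (f k).
Hypothesis wfK : forall k, wnorm (f k) <= K.
Hypothesis fT : forall k : int, multiplier_eq m Theta (f k) (A *: f (k + 1)).
Implicit Types (chi : 'rV[R]_d -> R).

Let a : R := normc A.

Let a0 : 0 < a.
Proof.
rewrite lt_neqAle normc_ge0 andbT eq_sym; apply: contra A0 => /eqP.
by move/Normc.eq0_normc => ->.
Qed.

Let w : R[i] := A / a%:C.

Let aC0 : a%:C != 0 :> R[i].
Proof. by rewrite eq_complex /= gt_eqF. Qed.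

Let w1 : normc w = 1.
Proof.
have : normc (w * a%:C) = a by rewrite /w divfK.
rewrite Normc.normcM normc_real gtr0_norm// => /(canRL (mulfK (lt0r_neq0 a0))).
by rewrite divff ?lt0r_neq0.
Qed.

Let u xi : R := Re (m (- xi)) / a.

Let smr : smooth (fun xi => Re (m (- xi))).
Proof. by have [[H _] _ _ _] := multiplier_adjP _ _ mT mreal; exact: H. Qed.

Let su : smooth u.
Proof. exact: (smoothM (fun xi => Re (m (- xi))) (fun=> a^-1) smr (smooth_cst _)). Qed.

Let T (k : int) chi : R[i] := cintegral (fun x => f k x * ifourier chi x).

Let Tlin k (b c : R) chi1 chi2 : test_fun chi1 -> test_fun chi2 ->
  T k (fun x => b * chi1 x + c * chi2 x) = b%:C * T k chi1 + c%:C * T k chi2.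
Proof.
move=> t1 t2.
have j1 := cintegrable_pairing _ _ _ (wf k) (cmeasurable_ifourier _ t1)
  (fun x => ifourier_weight_bound _ x t1).
have j2 := cintegrable_pairing _ _ _ (wf k) (cmeasurable_ifourier _ t2)
  (fun x => ifourier_weight_bound _ x t2).
rewrite /T -!cintegralZ// -cintegralD; [|exact: cintegrableZ..].
by congr cintegral; apply/funext => x; rewrite ifourier_lin//; ring.
Qed.

Let K0 : 0 <= K.
Proof.
rewrite (le_trans _ (wfK 0))//; apply: Rintegral_ge0 => x _.
by rewrite mulr_ge0 ?normc_ge0// ltW// weight_gt0.
Qed.

Let Tbnd k chi : test_fun chi -> normc (T k chi) <= (4 * K) * test_norm chi.
Proof.
move=> tc; rewrite (le_trans (pairing_bound _ _ _ (wf k) (cmeasurable_ifourier _ tc)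
  (fun x => ifourier_weight_bound _ x tc)))//.
(* One factor [2] comes from the real and imaginary parts of [ifourier chi], the other from those of
   the integral. *)
rewrite (_ : 4 * K * _ = 2 * (2 * test_norm chi * K)); last by ring.
rewrite ler_wpM2l// ler_wpM2l// mulr_ge0//.
by apply: Rintegral_ge0.
Qed.

Let Tshift k chi : test_fun chi -> T k (fun x => u x * chi x) = w * T (k + 1) chi.
Proof.
move=> tc; have tmc := test_smoothM _ _ smr tc.
rewrite (_ : (fun x => _) = fun x => a^-1 * (Re (m (- x)) * chi x) + 0 * chi x); last first.
  by apply/funext => x; rewrite /u; ring.
have E : T k (fun x => Re (m (- x)) * chi x) =
    cintegral (fun x => (A *: f (k + 1)) x * ifourier chi x).
  exact: esym (multiplier_eq_ifourier _ _ _ _ _ mT mreal (wf k) (fT k) tc).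
rewrite (Tlin k _ _ _ _ tmc tc) E mul0r addr0 /w fmorphV mulrAC mulrC; congr (_ * _).
have j := cintegrable_pairing _ _ _ (wf (k + 1)) (cmeasurable_ifourier _ tc)
  (fun x => ifourier_weight_bound _ x tc).
rewrite /T -(cintegralZ A _ j); congr cintegral; apply/funext => x.
by rewrite mulrA.
Qed.

Let Tvanish k chi : test_fun chi -> T k (fun x => (u x ^+ 2 - 1) * chi x) = 0.
Proof.
apply: (shift_vanish u T w (4 * K) su w1 _ Tlin Tbnd Tshift).
by rewrite mulr_ge0.
Qed.

Lemma second_shift_ae : aeeq (f 0) ((A / (normc A)%:C) ^+ 2 *: f 2).
Proof.
apply: separation_eq => // chi tc.
change (T 0 chi = w ^+ 2 * T 2 chi).
have tuc : test_fun (fun x => u x * chi x) := test_smoothM _ _ su tc.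
have := Tvanish 0 _ tc.
rewrite (_ : (fun x => _) = fun x => 1 * (u x * (u x * chi x)) + -1 * chi x); last first.
  by apply/funext => x; ring.
rewrite (Tlin 0 _ _ _ _ (test_smoothM u _ su tuc) tc).
rewrite (Tshift _ _ tuc) (Tshift _ _ tc) add0r mul1r rmorphN mulN1r mulrA => /eqP.
by rewrite subr_eq0 => /eqP <-.
Qed.

Lemma one_sided_shift_ae (s : R) : s ^+ 2 = 1 -> ~ range m (- (s * normc A))%:C ->
  aeeq (f 0) (s%:C * (A / (normc A)%:C) *: f 1).
Proof.
move=> s2 ms; apply: separation_eq => // chi tc; change (T 0 chi = s%:C * w * T 1 chi).
have us x : u x + s != 0.
  apply/eqP => E; apply: ms; exists (- x) => //.
  rewrite -(RRe_real (mreal (- x))); congr (_%:C).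
  have -> : Re (m (- x)) = u x * a by rewrite /u divfK ?lt0r_neq0.
  by move/eqP: E; rewrite addr_eq0 => /eqP ->; rewrite mulNr.
have tq : test_fun (fun x => (u x + s)^-1 * chi x).
  apply: (test_smoothM (fun x => (u x + s)^-1) chi _ tc).
  exact: (smoothV (fun x => u x + s) (smoothD u (fun=> s) su (smooth_cst _)) us).
have := Tvanish 0 _ tq.
rewrite (_ : (fun x => _) = fun x => 1 * (u x * chi x) + (- s) * chi x); last first.
  apply/funext => x; have -> : u x ^+ 2 - 1 = (u x - s) * (u x + s) by rewrite -s2; ring.
  by rewrite -mulrA mulVKf ?us//; ring.
rewrite (Tlin 0 _ _ _ _ (test_smoothM u _ su tc) tc) (Tshift _ _ tc) add0r mul1r.
rewrite rmorphN mulNr => /eqP; rewrite subr_eq0 => /eqP E.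
by rewrite -mulrA E mulrA -rmorphM -expr2 s2 mul1r.
Qed.

(** Both signs of the one-sided relation are available: [f 0] equals [w f 1] and also [- w f 1],
    with [w = A / |A|]. *)
Lemma no_eigenvalue_ae : ~ range m (normc A)%:C -> ~ range m (- normc A)%:C ->
  aeeq (f 0) 0.
Proof.
move=> mp mn.
have E1 : aeeq (f 0) (1%:C * (A / (normc A)%:C) *: f 1).
  by apply: one_sided_shift_ae; rewrite ?expr1n ?mul1r.
have E2 : aeeq (f 0) ((-1)%:C * (A / (normc A)%:C) *: f 1).
  by apply: one_sided_shift_ae; rewrite ?sqrrN ?expr1n// mulN1r opprK.
apply: filterS2 E1 E2 => x H1 H2 _; have := H1 I; have := H2 I.
rewrite !scale_funE mul1r rmorphN mulN1r mulNr => E3 E4.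
have : f 0 x + f 0 x = 0 by rewrite {1}E3 E4 addNr.
by rewrite -mulr2n => /eqP; rewrite mulrn_eq0 => /eqP.
Qed.

Section Lp_solutions.
Variables (p : \bar R).
Hypotheses (p1 : (1 <= p)%E) (fp : forall k, in_Lp p (f k)).

Lemma eigen_decomposition_exists : exists fplus fminus,
  eigen_decomposition m Theta p (normc A)%:C (f 0) fplus fminus.
Proof.
have w2 := second_shift_ae; rewrite -/a -/w in w2.
pose h := 2^-1 : R[i].
have comb (c1 c2 : R[i]) : normc c1 <= 1 -> normc c2 <= 1 -> in_Lp p (c1 *: f 0 + c2 *: f 1).
  move=> c11 c21; apply: (in_Lp_le_add p (f 0) (f 1)) => //.
    by apply: cmeasurableD; apply: cmeasurableZ; exact: (fp _).1.
  move=> x; rewrite (le_trans (normcD _ _))// lerD//.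
    by rewrite [X in normc X](_ : _ = c1 * f 0 x)// Normc.normcM ler_piMl ?normc_ge0.
  by rewrite [X in normc X](_ : _ = c2 * f 1 x)// Normc.normcM ler_piMl ?normc_ge0.
have h1 : normc h <= 1.
  rewrite /h (_ : 2^-1 = (2^-1)%:C); last by rewrite fmorphV rmorph_nat.
  by rewrite normc_real ger0_norm ?invr_ge0// invf_le1// ler1n.
have hw1 : normc (h * w) <= 1 by rewrite Normc.normcM w1 mulr1.
have hwN1 : normc (- (h * w)) <= 1 by rewrite normcN.
have Aw : A = w * a%:C by rewrite /w divfK.
(* With [J = Theta / |A|], one has [J (f 0) = w f 1] and, by [second_shift_ae], [J (J (f 0)) = f 0];
   the two functions are the images of [f 0] under the projections [(1 + J) / 2] and
   [(1 - J) / 2]. *)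
exists (h *: f 0 + (h * w) *: f 1), (h *: f 0 + (- (h * w)) *: f 1).
have wA k : wintegrable (A *: f k) by exact: wintegrableZ.
have mLp (g : 'rV[R]_d -> R[i]) c : in_Lp p g -> cmeasurable (c *: g).
  by move=> gp; exact: cmeasurableZ gp.1.
split; [exact: comb|exact: comb|..].
- apply: aeW => x _; rewrite [RHS](_ : _ = (h * f 0 x + h * w * f 1 x) +
    (h * f 0 x + - (h * w) * f 1 x))// /h; by field.
- refine (multiplier_eq_ae m Theta _ _ _ _ _ _ (multiplier_eq_lin m Theta h (h * w) _ _ _ _
    (wf 0) (wf 1) (wA _) (wA _) (fT 0) (fT 1))).
  + by apply: cmeasurableD; apply: cmeasurableZ; exact: (wA _).1.
  + exact/mLp/comb.
  apply: filterS w2 => x E _; have {}E := E I.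
  rewrite [LHS](_ : _ = h * (A * f 1 x) + h * w * (A * f 2 x))//.
  rewrite [RHS](_ : _ = a%:C * (h * f 0 x + h * w * f 1 x))//.
  by rewrite E [X in _ * (_ * X + _)](_ : _ = w ^+ 2 * f 2 x)// Aw; ring.
- refine (multiplier_eq_ae m Theta _ _ _ _ _ _ (multiplier_eq_lin m Theta h (- (h * w)) _ _ _ _
    (wf 0) (wf 1) (wA _) (wA _) (fT 0) (fT 1))).
  + by apply: cmeasurableD; apply: cmeasurableZ; exact: (wA _).1.
  + exact/mLp/comb.
  apply: filterS w2 => x E _; have {}E := E I.
  rewrite [LHS](_ : _ = h * (A * f 1 x) + - (h * w) * (A * f 2 x))//.
  rewrite [RHS](_ : _ = - a%:C * (h * f 0 x + - (h * w) * f 1 x))//.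
  by rewrite E [X in _ * (_ * X + _)](_ : _ = w ^+ 2 * f 2 x)// Aw; ring.
Qed.

(* The decomposition is determined by [f 0 = gp + gm] and [A f 1 = |A| (gp - gm)]. *)
Lemma eigen_decomposition_ae gp gm :
  eigen_decomposition m Theta p (normc A)%:C (f 0) gp gm ->
  aeeq gp (2^-1 *: (f 0 + (A / (normc A)%:C) *: f 1)) /\
  aeeq gm (2^-1 *: (f 0 - (A / (normc A)%:C) *: f 1)).
Proof.
move=> [Lgp Lgm f0E Tgp Tgm]; rewrite -/a -/w.
have wp := in_Lp_wintegrable _ _ p1 Lgp; have wm := in_Lp_wintegrable _ _ p1 Lgm.
have wpm b c : wintegrable (b *: gp + c *: gm) by apply: wintegrableD; exact: wintegrableZ.
have f0E' : aeeq (f 0) (1 *: gp + 1 *: gm).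
  by apply: filterS f0E => x H I; rewrite H// !scale1r.
have T1 : multiplier_eq m Theta (f 0) (a%:C *: gp + - a%:C *: gm).
  have := multiplier_eq_lin m Theta 1 1 _ _ _ _ wp wm (wintegrableZ a%:C _ wp)
    (wintegrableZ (- a%:C) _ wm) Tgp Tgm.
  rewrite !scale1r /multiplier_eq => <-.
  by rewrite (regular_distribution_ae _ _ (wf 0).1 (wpm _ _).1 f0E') !scale1r.
have E : regular_distribution (A *: f 1) = regular_distribution (a%:C *: gp + - a%:C *: gm).
  by rewrite -(fT 0) T1.
(* [separation_eq] upgrades the equality of distributions to one of functions, giving a second
   linear equation for [gp] and [gm]. *)
have F : aeeq (f 1) (A^-1 *: (a%:C *: gp + - a%:C *: gm)).
  apply: separation_eq => // chi tc.
  have := congr1 (fun D => D (schwartz_ifourier chi tc)) E.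
  rewrite /regular_distribution /= => <-.
  have j := cintegrable_pairing _ _ _ (wf 1) (cmeasurable_ifourier _ tc)
    (fun x => ifourier_weight_bound _ x tc).
  rewrite -cintegralZ//; last first.
    by have := cintegrableZ A _ j; congr cintegrable; apply/funext => x; rewrite mulrA.
  congr cintegral; apply/funext => x.
  by rewrite [X in _ = _ * (X * _)](_ : _ = A * f 1 x)// mulrA mulKf.
have G : {ae lebesgue_rV R d, forall x, f 0 x = gp x + gm x /\ w * f 1 x = gp x - gm x}.
  apply: filterS2 f0E F => x H1 H2; split; first exact: (H1 I).
  rewrite (H2 I) [X in _ * X](_ : _ = A^-1 * (a%:C * gp x + - a%:C * gm x))// /w.
  by field; rewrite A0 aC0.
split; apply: filterS G => x [H1 H2] _.
  rewrite [RHS](_ : _ = 2^-1 * (f 0 x + w * f 1 x))// H1 H2; by field.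
rewrite [RHS](_ : _ = 2^-1 * (f 0 x - w * f 1 x))// H1 H2; by field.
Qed.

End Lp_solutions.

End bilateral_sequence.

Theorem theorem1p6 (R : realType) (d : nat)
    (m : 'rV[R]_d -> R[i]) (Theta : schwartz R d -> schwartz R d)
    (p : \bar R) (f : int -> 'rV[R]_d -> R[i]) (A : R[i]) (M : R) :
  is_multiplier m Theta ->
  (forall xi, m xi \is Num.real) ->
  (1 <= p)%E ->
  A != 0 ->
  0 < M ->
  (forall k : int, cmeasurable (f k)) ->
  (forall k : int, multiplier_eq m Theta (f k) (A *: f (k + 1))) ->
  (forall k : int, (cLnorm p (f k) <= M%:E)%E) ->
  [/\ (* (a) *)
      range m `|A| -> ~ range m (- `|A|) ->
      multiplier_eq m Theta (f 0) (`|A| *: f 0),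
      (* (b) *)
      range m (- `|A|) -> ~ range m `|A| ->
      multiplier_eq m Theta (f 0) (- `|A| *: f 0),
      (* (c) *)
      range m `|A| -> range m (- `|A|) ->
      exists fp fm, eigen_decomposition m Theta p `|A| (f 0) fp fm /\
        forall gp gm, eigen_decomposition m Theta p `|A| (f 0) gp gm ->
          aeeq gp fp /\ aeeq gm fm
    & (* (d) *)
      ~ range m `|A| -> ~ range m (- `|A|) ->
      aeeq (f 0) 0].
Proof.
move=> mT mreal p1 A0 M0 mf fT fM.
have [K HK] := @cLnorm_wnorm R d p M p1.
have wf k : wintegrable (f k) by have [] := HK (f k) (mf k) (fM k).
have wfK k : wnorm (f k) <= K by have [] := HK (f k) (mf k) (fM k).
have fLp k : in_Lp p (f k) by split; [exact: mf|exact: le_lt_trans (fM k) (ltry M)].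
rewrite norm_normc; set a := Normc.normc A.
have a0 : a%:C != 0.
  by rewrite -norm_normc normr_eq0.
(* Both one-sided cases at once, with [s = 1] or [s = -1]: [Theta f 0] is [A f 1 = |A| w f 1], while
   [f 0 = s w f 1], and [s] is its own inverse. *)
have eigen (s : R) : s ^+ 2 = 1 -> ~ range m (- (s * a))%:C ->
    multiplier_eq m Theta (f 0) ((s * a)%:C *: f 0).
  move=> s2 ms; have E := one_sided_shift_ae m Theta f A K mT mreal A0 wf wfK fT s s2 ms.
  refine (multiplier_eq_ae m Theta _ _ _ (cmeasurableZ _ _ (mf _))
    (cmeasurableZ _ _ (mf _)) _ (fT 0)).
  apply: filterS E => x H _; rewrite !scale_funE (H I) scale_funE rmorphM.
  have -> : s%:C * a%:C * (s%:C * (A / a%:C) * f 1 x) =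
      (s%:C * s%:C) * (A / a%:C * a%:C) * f 1 x by ring.
  by rewrite -rmorphM -expr2 s2 mul1r divfK.
split.
- move=> _ mN; have := eigen 1 (expr1n _ _); rewrite mul1r; apply.
  by rewrite rmorphN.
- move=> _ mP; have := eigen (-1); rewrite sqrrN expr1n mulN1r opprK rmorphN; exact.
- move=> _ _.
  have [fp [fm fpm]] := eigen_decomposition_exists m Theta f A K mT mreal A0 wf wfK fT p p1 fLp.
  exists fp, fm; split=> // gp gm gpm.
  have [F1 F2] := eigen_decomposition_ae m Theta f A A0 wf fT p p1 fp fm fpm.
  have [G1 G2] := eigen_decomposition_ae m Theta f A A0 wf fT p p1 gp gm gpm.
  split.
    by apply: filterS2 F1 G1 => x H1 H2 _; rewrite H1 ?H2.
  by apply: filterS2 F2 G2 => x H1 H2 _; rewrite H1 ?H2.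
- move=> mP mN; apply: (no_eigenvalue_ae m Theta f A K mT mreal A0 wf wfK fT) => //.
  by rewrite rmorphN.
Qed.
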